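(* Let $G$ be a locally compact, Hausdorff, étale groupoid, let $\mathcal{E}$ be a twist over $G$, and let $S$ be an open subgroupoid of $G$ that is also closed in $G$. Then the following statements are equivalent. (i) $i(C^*_r(S;\mathcal{E}_S))$ is maximal abelian in $C^*_r(G;\mathcal{E})$. (ii) $G^{(0)}\subset\operatorname{int}_{\mathcal{E}}(\Omega_S^{-1}(\{1\}))=\mathcal{E}_S$ and $\operatorname{int}_{\mathcal{E}}(\Omega_S^{-1}(\mathbf{Z}_{>1}))=\emptyset$. (iii) $S$ is maximal among the open subgroupoids of $G'$ for which $\mathcal{E}_S$ is abelian, and $\operatorname{int}_{\mathcal{E}}(\Omega_S^{-1}(\mathbf{Z}_{>1}))=\emptyset$.
   Context: All groupoids are locally compact and Hausdorff. For a groupoid $G$ with unit space $G^{(0)}$, range $r$ and source $s$: $G^u=r^{-1}(u)$, $G_u=s^{-1}(u)$, $G(u)=G^u\cap G_u$, and $G'=\bigcup_{u}G(u)$ is the isotropy bundle. $G$ is étale if $r$ and $s$ are local homeomorphisms. A subgroupoid $S$ need not contain all units; $S^{(0)}$ is its unit space. ''Open subgroupoid of $G'$'' means a subgroupoid contained in $G'$ that is open in $G$. A groupoid is abelian if it is a bundle of abelian groups (so $r=s$ and every isotropy group is abelian). $\operatorname{int}_X(Y)$ is the interior of $Y$ in $X$. A twist $\mathcal{E}$ over $G$ is a central groupoid extension $G^{(0)}\times\mathbf{T}\xrightarrow{\iota}\mathcal{E}\xrightarrow{\pi}G$, where $\iota,\pi$ are continuous groupoid homomorphisms, $\iota$ is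 a homeomorphism onto its range, $\pi$ is an open surjection inducing a homeomorphism of unit spaces with kernel $\iota(G^{(0)}\times\mathbf{T})$, and $\iota(r(e),z)e=e\,\iota(s(e),z)$ for all $e\in\mathcal{E},z\in\mathbf{T}$ (unit spaces of $\mathcal{E}$ and $G$ are identified). Write $z\cdot e=\iota(r(e),z)e$. $\mathcal{E}_S=\pi^{-1}(S)$; for open $S$ it is a twist over $S$. For $u\in G^{(0)}$ and $e\in\mathcal{E}(u)$ let $\operatorname{Ad}_S(e)=\{\tau^{-1}e\tau:\tau\in\mathcal{E}_S(u)\}$ (empty if $u\notin S^{(0)}$), and $\operatorname{Ad}_S(\pi(e))=\pi(\operatorname{Ad}_S(e))$. Define $\Omega_S\colon\mathcal{E}'\to\mathbf{Z}_{\ge0}\cup\{\infty\}$ by $\Omega_S(e)=|\operatorname{Ad}_S(e)|$ if $|\operatorname{Ad}_S(e)|=|\operatorname{Ad}_S(\pi(e))|<\infty$, and $\Omega_S(e)=\infty$ otherwise. $C_0(G;\mathcal{E})=\{f\in C_0(\mathcal{E}): f(z\cdot e)=zf(e)\ \forall z\in\mathbf{T},e\in\mathcal{E}\}$ and $C_c(G;\mathcal{E})=C_0(G;\mathcal{E})\cap C_c(\mathcal{E})$. The latter is a $*$-algebra with $f_1*f_2(e')=\sum_{\{\pi(e)\in G:\,r(e)=r(e')\}}f_1(e)f_2(e^{-1}e')$ (sum over $G^{r(e')}$, one representative $e$ for each element) and $f^*(e)=\overline{f(e^{-1})}$. For $u\in G^{(0)}$, $\ell^2(G_u;\mathcal{E}_u)$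 is the Hilbert space of $\xi\colon\mathcal{E}_u\to\mathbf{C}$ with $\xi(z\cdot e)=z\xi(e)$ and $\sum_{\pi(e)\in G_u}|\xi(e)|^2<\infty$; $C_c(G;\mathcal{E})$ acts on it by $\theta_u(f)\xi=f*\xi$. $C^*_r(G;\mathcal{E})$ is the completion of $C_c(G;\mathcal{E})$ in $\|f\|_r=\sup_u\|\theta_u(f)\|$. For an open subgroupoid $S$, $i\colon C^*_r(S;\mathcal{E}_S)\to C^*_r(G;\mathcal{E})$ is the injective $*$-homomorphism extending extension by zero $C_c(S;\mathcal{E}_S)\to C_c(G;\mathcal{E})$. *)

(* Defs.v *)
From HB Require Import structures.
From mathcomp Require Export all_boot all_order all_algebra.
From mathcomp Require Export finmap.
From mathcomp Require Export complex.
From mathcomp Require Export all_classical all_reals all_analysis.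

Set Implicit Arguments.
Unset Strict Implicit.
Unset Printing Implicit Defensive.

Import Order.TTheory GRing.Theory Num.Theory.
Import numFieldNormedType.Exports.

Local Open Scope classical_set_scope.
Local Open Scope ring_scope.

Definition homeo_onto_image (X Y : topologicalType) (A : set X) (f : X -> Y) :=
  [/\ {within A, continuous f},
      {in A &, injective f} &
      forall W : set X, open W ->
        exists2 V : set Y, open V & f @` (A `&` W) = V `&` f @` A].

(* A groupoid is given by its set of arrows.  Units are identified with the
   identity arrows, so that range and source are maps from arrows to arrows;
   the product is a total function that is meaningful on composable pairs only. *)
Record groupoid := Groupoid {
  arrows :> topologicalType;
  rng : arrows -> arrows;
  src : arrows -> arrows;
  gmul : arrows -> arrows -> arrows;
  ginv : arrows -> arrows;
  rng_rng : forall g, rng (rng g) = rng g;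
  src_rng : forall g, src (rng g) = rng g;
  rng_src : forall g, rng (src g) = src g;
  src_src : forall g, src (src g) = src g;
  rng_gmul : forall g h, src g = rng h -> rng (gmul g h) = rng g;
  src_gmul : forall g h, src g = rng h -> src (gmul g h) = src h;
  gmulA : forall g h k, src g = rng h -> src h = rng k ->
    gmul g (gmul h k) = gmul (gmul g h) k;
  gmul_rng : forall g, gmul (rng g) g = g;
  gmul_src : forall g, gmul g (src g) = g;
  rng_ginv : forall g, rng (ginv g) = src g;
  src_ginv : forall g, src (ginv g) = rng g;
  gmulV : forall g, gmul g (ginv g) = rng g;
  gmulVg : forall g, gmul (ginv g) g = src g;
  gmul_continuous :
    {within [set p : arrows * arrows | src p.1 = rng p.2],
      continuous (fun p => gmul p.1 p.2)};
  ginv_continuous : continuous ginv;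
  groupoid_hausdorff : hausdorff_space arrows;
  groupoid_locally_compact : locally_compact [set: arrows]
}.

Section Groupoids.
Variable G : groupoid.

Definition units : set G := [set u | rng u = u].

Definition isotropy : set G := [set g | rng g = src g].

Definition local_homeo_to_units (f : G -> G) :=
  forall g : G, exists U : set G,
    [/\ open U, U g, homeo_onto_image U f &
        exists2 V : set G, open V & f @` U = V `&` units].

Definition etale := local_homeo_to_units (@rng G) /\ local_homeo_to_units (@src G).

Definition subgroupoid (S : set G) :=
  (forall g h, S g -> S h -> src g = rng h -> S (gmul g h)) /\
  (forall g, S g -> S (ginv g)).

(* open subgroupoid of the isotropy bundle; openness is in the whole groupoid *)
Definition open_isotropy_subgroupoid (S : set G) :=
  [/\ subgroupoid S, S `<=` isotropy & open S].

(* for a subgroupoid A: A is a bundle of abelian groups *)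
Definition abelian_subset (A : set G) :=
  A `<=` isotropy /\
  (forall g h, A g -> A h -> src g = rng h -> gmul g h = gmul h g).

End Groupoids.

Section Circle.
Variable R : realType.
Definition circle : set R[i]^o := [set z | `|z| = 1].
End Circle.
Arguments circle {R}.

Record twist (R : realType) (G : groupoid) := Twist {
  total :> groupoid;
  iota_tw : G -> R[i]^o -> total;
  proj : total -> G;
  iota_rng : forall u z, units u -> circle z ->
    rng (iota_tw u z) = iota_tw u 1;
  iota_src : forall u z, units u -> circle z ->
    src (iota_tw u z) = iota_tw u 1;
  iota_mul : forall u z w, units u -> circle z -> circle w ->
    gmul (iota_tw u z) (iota_tw u w) = iota_tw u (z * w);
  iota_homeo :
    homeo_onto_image (@units G `*` @circle R) (fun p => iota_tw p.1 p.2);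
  proj_rng : forall e, proj (rng e) = rng (proj e);
  proj_src : forall e, proj (src e) = src (proj e);
  proj_mul : forall e f, src e = rng f ->
    proj (gmul e f) = gmul (proj e) (proj f);
  proj_continuous : continuous proj;
  proj_open : forall U : set total, open U -> open (proj @` U);
  proj_surj : forall g, exists e, proj e = g;
  proj_units_homeo : homeo_onto_image (@units total) proj;
  proj_units : proj @` @units total = @units G;
  proj_kernel : proj @^-1` @units G =
    (fun p => iota_tw p.1 p.2) @` (@units G `*` @circle R);
  (* the identification of the unit spaces *)
  proj_iota : forall u z, units u -> circle z -> proj (iota_tw u z) = u;
  iota_central : forall e z, circle z ->
    gmul (iota_tw (proj (rng e)) z) e = gmul e (iota_tw (proj (src e)) z)
}.

Section TwistedAlgebras.
Variables (R : realType) (G : groupoid) (E : twist R G).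
Local Notation C := R[i]^o.

Definition tact (z : C) (e : E) : E := gmul (iota_tw E (proj (rng e)) z) e.

Definition restr (S : set G) : set E := @proj R G E @^-1` S.

(* a representative in E of each element of G *)
Definition rep (g : G) : E := sval (cid (proj_surj E g)).

Definition Ad (S : set G) (e : E) : set E :=
  [set f | exists t, [/\ restr S t, rng t = rng e, src t = rng e &
                         f = gmul (ginv t) (gmul e t)]].

(* [None] stands for infinity; only meaningful for e in the isotropy of E *)
Definition Omega (S : set G) (e : E) : option nat :=
  if pselect (finite_set (Ad S e) /\
      #|` fset_set (Ad S e)| = #|` fset_set (@proj R G E @` Ad S e)|)
  then Some #|` fset_set (Ad S e)|
  else None.

Definition Omega_preimage (S : set G) (N : set nat) : set E :=
  @isotropy E `&` [set e | exists2 n, N n & Omega S e = Some n].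

(* Functions on [restr H] are represented by their extensions by zero to E, so
   that the case of G itself is [H := setT] and extension by zero from
   C_c(S; E_S) to C_c(G; E) is the identity on representatives. *)

Definition equivariant (f : E -> C) :=
  forall (z : C) (e : E), circle z -> f (tact z e) = z * f e.

Definition vanishes_off (A : set E) (f : E -> C) := forall e, ~ A e -> f e = 0.

Definition Cc (H : set G) : set (E -> C) :=
  [set f | [/\ vanishes_off (restr H) f,
               {within restr H, continuous f},
               compact (closure [set e | f e != 0] `&` restr H) &
               equivariant f]].

(* The sum is over G^{r(e')}; for the functions used below it has finite
   support, and each term depends on [proj (rep g) = g] only. *)
Definition conv (f1 f2 : E -> C) (e' : E) : C :=
  \sum_(g \in [set g : G | rng g = proj (rng e')])
    (f1 (rep g) * f2 (gmul (ginv (rep g)) e')).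

Definition starf (f : E -> C) (e : E) : C := conjc (f (ginv e)).

Definition l2norm (H : set G) (u : G) (xi : E -> C) : \bar R :=
  sqrte (\esum_(g in [set g | H g /\ src g = u])
           ((Normc.normc (xi (rep g)) ^+ 2)%:E)).

Definition ell2 (H : set G) (u : G) : set (E -> C) :=
  [set xi | [/\ vanishes_off [set e | restr H e /\ proj (src e) = u] xi,
                equivariant xi & (l2norm H u xi < +oo)%E]].

(* operator norm of theta_u(f) on l^2(H_u; E_u) *)
Definition opnorm (H : set G) (u : G) (f : E -> C) : \bar R :=
  ereal_sup [set l2norm H u (conv f xi) |
              xi in [set xi | ell2 H u xi /\ (l2norm H u xi <= 1)%E]].

(* 0 is added so that the norm is 0, and not -oo, if H has no unit *)
Definition rnorm (H : set G) (f : E -> C) : \bar R :=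
  ereal_sup (0%E |` [set opnorm H u f | u in H `&` @units G]).

(* C*_r(H; E_H), for H an open subgroupoid: the set of classes of sequences of
   C_c(H; E_H) that are Cauchy for [rnorm H], modulo the sequences converging
   to 0.  The operations below act on classes through representatives. *)

Definition cauchy_Cc (H : set G) (a : nat -> E -> C) :=
  (forall n, Cc H (a n)) /\
  forall eps : R, 0 < eps -> exists N, forall m n, (N <= m)%N -> (N <= n)%N ->
    (rnorm H (a m \- a n)%R < eps%:E)%E.

Definition null_dist (H : set G) (a b : nat -> E -> C) :=
  rnorm H (a n \- b n) @[n --> \oo] --> 0%E.

Definition cls (H : set G) (a : nat -> E -> C) : set (nat -> E -> C) :=
  [set b | cauchy_Cc H b /\ null_dist H a b].

Definition Cstar (H : set G) : set (set (nat -> E -> C)) :=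
  [set cls H a | a in cauchy_Cc H].

Implicit Types X Y : set (nat -> E -> C).

Definition cadd (H : set G) X Y :=
  \bigcup_(a in X) \bigcup_(b in Y) cls H (fun n e => a n e + b n e).

Definition cscale (H : set G) (k : C) X :=
  \bigcup_(a in X) cls H (fun n e => k * a n e).

Definition cmul (H : set G) X Y :=
  \bigcup_(a in X) \bigcup_(b in Y) cls H (fun n => conv (a n) (b n)).

Definition cstar (H : set G) X :=
  \bigcup_(a in X) cls H (fun n => starf (a n)).

Definition czero (H : set G) := cls H (fun _ _ => 0).

Definition cdist_lt (H : set G) X Y (eps : R) :=
  exists a b, [/\ X a, Y b &
    \forall n \near \oo, (rnorm H (a n \- b n)%R < eps%:E)%E].

Definition cstar_subalgebra (H : set G) (D : set (set (nat -> E -> C))) :=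
  [/\ D `<=` Cstar H /\ D (czero H),
      (forall X Y, D X -> D Y -> D (cadd H X Y)) /\
      (forall k X, D X -> D (cscale H k X)),
      forall X Y, D X -> D Y -> D (cmul H X Y),
      forall X, D X -> D (cstar H X) &
      forall X, Cstar H X ->
        (forall eps : R, 0 < eps -> exists2 Y, D Y & cdist_lt H X Y eps) -> D X].

Definition abelian_cstar_subalgebra (H : set G) (D : set (set (nat -> E -> C))) :=
  cstar_subalgebra H D /\
  forall X Y, D X -> D Y -> cmul H X Y = cmul H Y X.

Definition maximal_abelian (H : set G) (B : set (set (nat -> E -> C))) :=
  abelian_cstar_subalgebra H B /\
  forall D, abelian_cstar_subalgebra H D -> B `<=` D -> D = B.

(* The map i from C*_r(S; E_S) to C*_r(G; E): extension by zero is the identity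
   on representatives, so that i sends the class of a sequence for S to its class
   for G. *)
Definition incl (S : set G) X := \bigcup_(a in X) cls setT a.

End TwistedAlgebras.

Arguments restr {R G} E S _.
Arguments Omega_preimage {R G} E S N _.
Arguments Cstar {R G} E H _.
Arguments incl {R G} E S X _.

(* Main.v *)
(* (ii) <-> (iii): Omega_S = 1 on E_S when E_S is abelian, and adjoining to S a
   bisection whose preimage lies in int (Omega_S^-1 {1}) generates an open
   subgroupoid with abelian preimage, which maximality identifies with S.
   (i) -> (ii): let B be the image of C*_r(S; E_S).  If B is maximal abelian, then a
   function in C_c(G; E) that commutes with C_c(S; E_S) vanishes off E_S, since
   the bicommutant of B and a self-adjoint such function is abelian.  Sums of bump
   functions over the orbits Ad_S(e) are such functions on int (Omega_S^-1 {n}),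
   which is therefore contained in E_S, and by Baire category one of these
   interiors meets int (Omega_S^-1 Z_{>1}) when the latter is not empty.
   (ii) -> (i): an element of C*_r(G; E) is a C_0 function on E.  If it commutes with B,
   then it vanishes off the isotropy and is constant on the orbits Ad_S(e), so
   Omega_S is finite where it is not 0.  Omega_S being lower semicontinuous, (ii)
   shows that it vanishes off the clopen set E_S; and restriction to E_S does
   not increase norms. *)
Require Import Defs.
From mathcomp Require Import ring lra.
Set Implicit Arguments.
Unset Strict Implicit.
Unset Printing Implicit Defensive.
Import Order.TTheory GRing.Theory Num.Theory.
Import numFieldNormedType.Exports.
Local Open Scope classical_set_scope.
Local Open Scope ring_scope.

(** No operators on Hilbert spaces are formed. Norm bounds are expressed by [bnd] on finite lists of
    points of one source fibre, where a function f acts by the kernel f(x y^-1). Each instance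
    involves finitely many values of f, so bounds survive pointwise limits. Hence a Cauchy sequence
    that tends to 0 pointwise is null, and membership in B can be read off from values on E.
    Restriction to E_S does not increase norms because it compresses the kernel to the S-orbits in a
    fibre, which are orthogonal to each other. Source fibres of E consist of circles and no local
    sections are used: points are moved to nearby fibres by openness of the projection and of the
    source map, and they are listed and counted through their images in G. That Omega_S compares
    Ad_S(e) with its image in G is what commuting functions detect: if z e lies in Ad_S(e) and f
    commutes with C_c(S; E_S), then f(e) = z f(e), so f(e) = 0 unless z = 1. Closedness of S makes
    restriction to E_S continuous and the set of units outside S open; bump functions on the latter
    force all units into S. *)

Section ComplexNumbers.
Variable R : realType.
Local Notation C := R[i]^o.
Implicit Types (z w a b : C).

(** The norm of [R[i]] takes its values in [R[i]] itself; with a modulus in [R], the tactics [lra]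
    and [nra] apply to all estimates. *)
Definition cabs z : R := Normc.normc z.
Definition csq z : R := cabs z ^+ 2.
Definition cre z : R := complex.Re z.

Lemma normE z : `|z| = (cabs z)%:C%C.
Proof. by rewrite normc_def; case: z. Qed.

Lemma cabs_ge0 z : 0 <= cabs z.
Proof. by rewrite -ler0c -normE. Qed.

Lemma cabs0 : cabs 0 = 0. Proof. exact: Normc.normc0. Qed.

Lemma cabs0_eq0 z : cabs z = 0 -> z = 0. Proof. exact: Normc.eq0_normc. Qed.

Lemma cabsD z w : cabs (z + w) <= cabs z + cabs w. Proof. exact: le_normcD. Qed.

Lemma cabsM z w : cabs (z * w) = cabs z * cabs w. Proof. exact: Normc.normcM. Qed.

Lemma cabsN z : cabs (- z) = cabs z. Proof. exact: normcN. Qed.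

Lemma cabsB z w : cabs (z - w) = cabs (w - z).
Proof. by rewrite -cabsN opprB. Qed.

Lemma cabs_tri z w a : cabs (z - w) <= cabs (z - a) + cabs (a - w).
Proof. by apply: le_trans (cabsD _ _); rewrite addrA subrK. Qed.

Lemma csqE z : csq z = complex.Re z ^+ 2 + complex.Im z ^+ 2.
Proof. by case: z => x y; rewrite /csq /cabs /= sqr_sqrtr // addr_ge0 ?sqr_ge0. Qed.

Lemma csq_ge0 z : 0 <= csq z. Proof. exact: sqr_ge0. Qed.

Lemma csqM z w : csq (z * w) = csq z * csq w.
Proof. by rewrite /csq cabsM exprMn. Qed.

Lemma csq0 : csq 0 = 0. Proof. by rewrite /csq cabs0 expr0n. Qed.

Lemma csq_eq0 z : csq z = 0 -> z = 0.
Proof. by move/eqP; rewrite sqrf_eq0 => /eqP /cabs0_eq0. Qed.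

Lemma creD z w : cre (z + w) = cre z + cre w. Proof. by case: z w => ? ? []. Qed.

Lemma Re_le z : `|complex.Re z| <= cabs z.
Proof.
by case: z => x y; rewrite /cabs /= -sqrtr_sqr ler_wsqrtr // lerDl sqr_ge0.
Qed.

Lemma Im_le z : `|complex.Im z| <= cabs z.
Proof.
case: z => x y; rewrite /cabs /= -[X in X <= _]sqrtr_sqr ler_wsqrtr //.
by rewrite lerDr sqr_ge0.
Qed.

Lemma cabs_le_Re_Im z : cabs z <= `|complex.Re z| + `|complex.Im z|.
Proof.
case: z => x y; rewrite /cabs /= -(@ler_pXn2r _ 2) ?nnegrE ?sqrtr_ge0 ?addr_ge0 //.
rewrite sqr_sqrtr ?addr_ge0 ?sqr_ge0 // -(real_normK (num_real x)).
rewrite -(real_normK (num_real y)); have := normr_ge0 x; have := normr_ge0 y; nra.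
Qed.

Lemma cre_le z : cre z <= cabs z.
Proof. exact: le_trans (ler_norm _) (Re_le z). Qed.

Lemma cabs_le_eps z : (forall eps : R, 0 < eps -> cabs z <= eps) -> z = 0.
Proof.
move=> h; apply/cabs0_eq0/eqP; rewrite eq_le cabs_ge0 andbT.
by apply/ler_addgt0Pr => eps /h; rewrite add0r.
Qed.

Lemma cre_sum (I : Type) (r : seq I) (F : I -> C) :
  cre (\sum_(i <- r) F i) = \sum_(i <- r) cre (F i).
Proof.
elim: r => [|i r IH]; first by rewrite !big_nil.
by rewrite !big_cons creD IH.
Qed.

Lemma cabs_sum (I : Type) (r : seq I) (F : I -> C) :
  cabs (\sum_(i <- r) F i) <= \sum_(i <- r) cabs (F i).
Proof.
elim: r => [|i r IH]; first by rewrite !big_nil cabs0.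
by rewrite !big_cons (le_trans (cabsD _ _)) // lerD2l.
Qed.

Lemma cabs_sum_lt n (F : 'I_n -> C) (eps : R) : 0 < eps ->
  (forall i, cabs (F i) < eps / n.+1%:R) -> cabs (\sum_(i < n) F i) < eps.
Proof.
move=> eps0 hF; apply: le_lt_trans (cabs_sum _ _) _.
apply: (@le_lt_trans _ _ (\sum_(i < n) eps / n.+1%:R)).
  by apply: ler_sum => i _; exact: ltW.
rewrite sumr_const card_ord -[X in X < _]mulr_natr -mulrA gtr_pMr // mulrC.
by rewrite ltr_pdivrMr ?ltr0n // mul1r ltr_nat.
Qed.

Lemma cre_conj z : cre (conjc z) = cre z. Proof. by case: z. Qed.

Lemma cabs_conj z : cabs (conjc z) = cabs z.
Proof. by case: z => x y; rewrite /cabs /= sqrrN. Qed.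

Lemma conjM z w : conjc (z * w) = conjc z * conjc w.
Proof. exact: (rmorphM (@conjc R)). Qed.

Lemma conjB z w : conjc (z - w) = conjc z - conjc w.
Proof. exact: (rmorphB (@conjc R)). Qed.

Lemma mul_conj z : conjc z * z = (csq z)%:C%C.
Proof.
rewrite csqE; case: z => x y; rewrite /GRing.mul /=; congr (_ +i* _)%C; ring.
Qed.

Lemma circleP z : circle z <-> cabs z = 1.
Proof.
rewrite /circle /= normE; split=> [|->//]; exact: complexI.
Qed.

Lemma circle1 : circle (1 : C).
Proof. by apply/circleP; exact: Normc.normc1. Qed.

Lemma circleM z w : circle z -> circle w -> circle (z * w).
Proof. by move=> /circleP hz /circleP hw; apply/circleP; rewrite cabsM hz hw mulr1. Qed.

Lemma circle_neq0 z : circle z -> z != 0.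
Proof.
move=> /circleP h; apply/eqP => z0; move: h; rewrite z0 cabs0 => /eqP.
by rewrite eq_sym oner_eq0.
Qed.

Lemma circleV z : circle z -> z^-1 = conjc z.
Proof.
move=> hz; have z0 := circle_neq0 hz; apply: (mulIf z0); rewrite mulVf //.
by rewrite mul_conj /csq; move/circleP: hz => ->; rewrite expr1n.
Qed.

Lemma circle_conj z : circle z -> circle (conjc z : C).
Proof. by move=> /circleP h; apply/circleP; rewrite cabs_conj. Qed.

Lemma circle_inv z : circle z -> circle z^-1.
Proof. by move=> hz; rewrite (circleV hz); exact: circle_conj. Qed.

Lemma nbhs_cabs z (A : set C) :
  nbhs z A <-> exists2 e : R, 0 < e & forall w, cabs (z - w) < e -> A w.
Proof.
split.
  move/nbhs_normP => [e /= e0 h].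
  (* A positive element of [R[i]] has imaginary part 0, so a radius in [R[i]] is a real number. *)
  have e0' : 0 < complex.Re e by move: e0; rewrite ltcE => /andP[_].
  have eE : e = (complex.Re e)%:C%C.
    by move: e0; rewrite ltcE => /andP[/eqP /= ei _]; case: e ei {h e0'} => x y /= ->.
  by exists (complex.Re e) => // w hw; apply: h => /=; rewrite eE normE ltcR.
move=> [e e0 h]; apply: (nbhs_normP z A).2; exists (e%:C%C); first by rewrite /= ltcR.
by move=> w /=; rewrite normE ltcR; exact: h.
Qed.

Lemma cvg_cabs (T : Type) (F : set_system T) (FF : Filter F) (f : T -> C) z :
  f @ F --> z <-> forall e : R, 0 < e -> \forall x \near F, cabs (z - f x) < e.
Proof.
split=> [h e e0|h A /nbhs_cabs [e e0 hA]].
  by apply: (h [set w | cabs (z - w) < e]); apply/nbhs_cabs; exists e.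
by apply: filterS (h e e0) => x; exact: hA.
Qed.

Lemma continuous_cabs (T : topologicalType) (f : T -> C) (x : T) :
  {for x, continuous f} <->
  forall e : R, 0 < e -> \forall y \near x, cabs (f x - f y) < e.
Proof. exact: cvg_cabs. Qed.

Lemma mk_complex_continuous : continuous (fun p : R * R => (p.1 +i* p.2)%C : C).
Proof.
move=> [x y]; apply/continuous_cabs => e e0.
have e2 : 0 < e / 2 by rewrite divr_gt0.
exists ([set t | `|x - t| < e / 2], [set t | `|y - t| < e / 2]).
  by split; [apply: (@nbhs_normP R R^o x _).2 | apply: (@nbhs_normP R R^o y _).2]; exists (e / 2).
move=> p /= [h1 h2]; change (cabs ((x +i* y)%C - (p.1 +i* p.2)%C : C) < e).
by apply: (le_lt_trans (cabs_le_Re_Im _)); rewrite (splitr e); exact: ltrD.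
Qed.

(** Such a set is the continuous image of a closed subset of the square [-1, 1]^2. *)
Lemma closed_unit_subset_compact (A : set C) :
  closed A -> (forall z, A z -> cabs z <= 1) -> compact A.
Proof.
move=> clA A1; pose f := fun p : R * R => (p.1 +i* p.2)%C : C.
have -> : A = f @` ((`[-1, 1] `*` `[-1, 1])%classic `&` f @^-1` A).
  apply/seteqP; split=> [z Az|z [p [_ h] <-]//].
  exists (complex.Re z, complex.Im z); last by case: z {Az}.
  split=> /=; last by rewrite /f /=; case: z Az.
  have := A1 z Az; rewrite /cabs; case: z {Az} => x y /= h.
  have {}h : x ^+ 2 + y ^+ 2 <= 1.
    rewrite -[leLHS]sqr_sqrtr ?addr_ge0 ?sqr_ge0 // -(expr1n R 2).
    by rewrite lerXn2r ?nnegrE ?sqrtr_ge0.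
  split; rewrite /= in_itv /=; nra.
apply: continuous_compact.
  by apply: continuous_subspaceT; exact: mk_complex_continuous.
apply: compact_closedI.
  by apply: compact_setX; exact: segment_compact.
by apply: closed_comp clA => p _; exact: mk_complex_continuous.
Qed.

Lemma cabs_continuous : continuous (cabs : C -> R).
Proof.
move=> z A /(@nbhs_normP R R^o _ A).1 [e /= e0 hA].
apply/nbhs_cabs; exists e => // w h; apply: hA => /=; rewrite ltr_norml.
have := cabs_tri w 0 z; have := cabs_tri z 0 w.
rewrite !subr0 (cabsB w z) => h1 h2; apply/andP; split; lra.
Qed.

Lemma circle_compact : compact (@circle R).
Proof.
apply: closed_unit_subset_compact => [|z /circleP -> //].
have -> : circle = cabs @^-1` [set 1 : R].
  by apply/seteqP; split=> z /= /circleP.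
apply: closed_comp => [z _|]; first exact: cabs_continuous.
exact: closed_eq.
Qed.

Definition cdisc : set C := [set z | cabs z <= 1].

Lemma cdisc0 : cdisc 0.
Proof. by change (cabs (0 : C) <= 1); rewrite cabs0. Qed.

Lemma cdisc_compact : compact cdisc.
Proof.
apply: closed_unit_subset_compact => //.
have -> : cdisc = cabs @^-1` [set x : R | x <= 1] by [].
apply: closed_comp => [z _|]; first exact: cabs_continuous.
exact: closed_le.
Qed.

Lemma complex_complete (z : nat -> C) :
  (forall eps : R, 0 < eps -> exists N, forall m n, (N <= m)%N -> (N <= n)%N ->
     cabs (z m - z n) <= eps) ->
  exists l : C, forall eps : R, 0 < eps -> exists N, forall n, (N <= n)%N ->
     cabs (l - z n) <= eps.
Proof.
move=> hz.
have real_lim (a : nat -> R) : (forall m n, `|a m - a n| <= cabs (z m - z n)) ->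
    exists l : R, forall eps, 0 < eps -> exists N, forall n, (N <= n)%N -> `|l - a n| <= eps.
  move=> ha; have /cvg_ex[l /cvgrPdist_le hl] : cvgn a.
    apply/cauchy_cvgP/cauchy_exP => eps eps0.
    have [|N hN] := hz (eps / 2); first exact: divr_gt0.
    exists (a N); exists N => // n /= Nn; rewrite /ball /=.
    apply: le_lt_trans (ha _ _) _; apply: le_lt_trans (hN N n (leqnn N) Nn) _.
    by rewrite ltr_pdivrMr // ltr_pMr // ltr1n.
  by exists l => eps /hl [N _ hN]; exists N => n /hN.
have [|a ha] := real_lim (fun n => complex.Re (z n)).
  move=> m n; apply: le_trans (Re_le _); by case: (z m) (z n) => ? ? [].
have [|b hb] := real_lim (fun n => complex.Im (z n)).
  move=> m n; apply: le_trans (Im_le _); by case: (z m) (z n) => ? ? [].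
exists (a +i* b)%C => eps eps0; have e2 : 0 < eps / 2 by rewrite divr_gt0.
have [N1 h1] := ha _ e2; have [N2 h2] := hb _ e2.
exists (maxn N1 N2) => n; rewrite geq_max => /andP[/h1 {}h1 /h2 {}h2].
apply: le_trans (cabs_le_Re_Im _) _; rewrite (splitr eps).
by case: (z n) h1 h2 => x y; exact: lerD.
Qed.

End ComplexNumbers.

(** * Centres of smallest enclosing discs *)

Section Circumcenter.
Variable R : realType.
Local Notation C := R[i]^o.
Implicit Types (K : set C) (w z a b : C).

(** The squared radius of the smallest disc about [w] that contains [K]; squares give access to the
    parallelogram identity. *)
Definition radius2 K w : R := sup [set csq (a - w) | a in K].

Lemma csq_sub_le4 a w : cdisc a -> cdisc w -> csq (a - w) <= 4.
Proof.
rewrite /cdisc /csq /= => ha hw; have := cabsD a (- w); rewrite cabsN.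
have := cabs_ge0 (a - w); nra.
Qed.

(** This is x^2 - y^2 = (x - y)(x + y), where x + y <= 4 because points of the unit disc are at
    distance at most 2. *)
Lemma csq_sub_lip a b w v : cdisc a -> cdisc b -> cdisc w -> cdisc v ->
  csq (a - w) <= csq (b - v) + 4 * (cabs (a - b) + cabs (w - v)).
Proof.
rewrite /cdisc /csq /= => ha hb hw hv.
have h1 := cabs_tri a w b; have h2 := cabs_tri b w v.
have := cabsD a (- w); have := cabsD b (- v); rewrite !cabsN (cabsB w v).
move: h1 h2; have := cabs_ge0 (a - w); have := cabs_ge0 (b - v).
have := cabs_ge0 (a - b); have := cabs_ge0 (v - w).
set x := cabs (a - w); set y := cabs (b - v); set p := cabs (a - b).
set q := cabs (v - w) => q0 p0 y0 x0 h1 h2 h3 h4.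
have {}h1 : x <= y + (p + q) by have : cabs (b - w) <= y + q by []; lra.
have [h5|h5] := leP x y; first by nra.
have : x ^+ 2 - y ^+ 2 = (x - y) * (x + y) by ring.
have : (x - y) * (x + y) <= (p + q) * 4.
  by apply: ler_pM; lra.
lra.
Qed.

Lemma half_complex : (2^-1 : C) = (2^-1 : R)%:C%C.
Proof. by rewrite fmorphV rmorph_nat. Qed.

Lemma parallelogram a w v : csq (a - (w + v) / 2) =
  (csq (a - w) + csq (a - v)) / 2 - csq (w - v) / 4.
Proof.
rewrite half_complex !csqE; case: a w v => [x y] [x1 y1] [x2 y2] /=; by field.
Qed.

Section FixedSet.
Variable K : set C.
Hypotheses (K0 : K !=set0) (K1 : K `<=` @cdisc R).

Lemma radius2_ub w a : cdisc w -> K a -> csq (a - w) <= radius2 K w.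
Proof.
move=> hw Ka; apply: ub_le_sup; last by exists a.
by exists 4 => _ [b Kb <-]; apply: csq_sub_le4 => //; exact: K1.
Qed.

Lemma radius2_le w r : (forall a, K a -> csq (a - w) <= r) -> radius2 K w <= r.
Proof.
move=> h; apply: ge_sup; first by case: K0 => a Ka; exists (csq (a - w)), a.
by move=> _ [a Ka <-]; exact: h.
Qed.

Lemma radius2_lip w v : cdisc w -> cdisc v ->
  radius2 K w <= radius2 K v + 4 * cabs (w - v).
Proof.
move=> hw hv; apply: radius2_le => a Ka.
have := csq_sub_lip (K1 Ka) (K1 Ka) hw hv.
have := radius2_ub hv Ka; rewrite subrr cabs0; lra.
Qed.

Lemma cdisc_mid w v : cdisc w -> cdisc v -> cdisc ((w + v) / 2).
Proof.
rewrite /cdisc /= => hw hv; rewrite cabsM; have := cabsD w v.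
have -> : cabs (2^-1 : C) = 2^-1.
  by rewrite /cabs half_complex /= expr0n addr0 sqrtr_sqr ger0_norm // invr_ge0.
lra.
Qed.

(** Strict convexity, inherited from [parallelogram]; the term [csq (w - v) / 4] makes the centre
    unique and stable. *)
Lemma radius2_convex w v : cdisc w -> cdisc v ->
  radius2 K ((w + v) / 2) <= (radius2 K w + radius2 K v) / 2 - csq (w - v) / 4.
Proof.
move=> hw hv; apply: radius2_le => a Ka; rewrite parallelogram.
have := radius2_ub hw Ka; have := radius2_ub hv Ka; lra.
Qed.

(** Competitors stay in the closed unit disc, so that compactness yields a minimum. *)
Definition is_center c :=
  cdisc c /\ forall w, cdisc w -> radius2 K c <= radius2 K w.

Lemma center_exists : exists c, is_center c.
Proof.
have [||c cin cmin] := @compact_EVT_min C R (radius2 K) _ _ (@cdisc_compact R).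
- by exists 0; exact: cdisc0.
- apply/subspace_continuousP => w hw; apply/cvgrPdist_le => e e0.
  apply/nbhs_cabs; exists (e / 4); first by rewrite divr_gt0.
  move=> v h hv; have := radius2_lip hw hv; have := radius2_lip hv hw.
  rewrite (cabsB v w) => h1 h2.
  change (`|radius2 K w - radius2 K v| <= e).
  by rewrite ler_norml; apply/andP; split; lra.
- exists c; split; first by rewrite inE in cin.
  by move=> w hw; apply: cmin; rewrite inE.
Qed.

(** The midpoint of [c] and [v] cannot do better than [c], which with [radius2_convex] bounds the
    distance from [c] to a near-minimiser. *)
Lemma center_near c v : is_center c -> cdisc v ->
  csq (c - v) <= 2 * (radius2 K v - radius2 K c).
Proof.
move=> [hc cmin] hv; have := radius2_convex hc hv.
have := cmin _ (cdisc_mid hc hv); lra.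
Qed.

End FixedSet.

Definition center K : C := get (is_center K).

Lemma centerP K : K !=set0 -> K `<=` @cdisc R -> is_center K (center K).
Proof. by move=> K0 K1; have [c hc] := center_exists K0 K1; exact: (getI hc). Qed.

Lemma center_uniq K c : K !=set0 -> K `<=` @cdisc R -> is_center K c ->
  center K = c.
Proof.
move=> K0 K1 hc; have [h1 h2] := centerP K0 K1.
have := center_near K0 K1 hc h1; have := h2 c hc.1 => h3 h4.
have : csq (c - center K) = 0 by apply/eqP; rewrite eq_le csq_ge0 andbT; lra.
by move/csq_eq0/eqP; rewrite subr_eq0 => /eqP.
Qed.

(** Passing between [K] and [K'] changes [radius2] by at most 4d at each point, so the centre of
    [K'] is within 8d of the minimum for [K]; [center_near] doubles this. *)
Lemma center_perturb K K' d : K !=set0 -> K `<=` @cdisc R ->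
  K' !=set0 -> K' `<=` @cdisc R ->
  (forall a, K a -> exists2 b, K' b & cabs (a - b) <= d) ->
  (forall b, K' b -> exists2 a, K a & cabs (b - a) <= d) ->
  csq (center K - center K') <= 16 * d.
Proof.
move=> K0 K1 K0' K1' h h'.
have cmp A B w : A !=set0 -> A `<=` @cdisc R -> B `<=` @cdisc R -> cdisc w ->
    (forall a, A a -> exists2 b, B b & cabs (a - b) <= d) ->
    radius2 A w <= radius2 B w + 4 * d.
  move=> A0 A1 B1 hw hAB; apply: radius2_le => // a Aa.
  have [b Bb ab] := hAB a Aa.
  have := csq_sub_lip (A1 _ Aa) (B1 _ Bb) hw hw.
  have := radius2_ub B1 hw Bb; rewrite subrr cabs0; lra.
have [c1 cmin] := centerP K0 K1; have [c1' cmin'] := centerP K0' K1'.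
have := center_near K0 K1 (conj c1 cmin) c1'.
have := cmp _ _ _ K0 K1 K1' c1' h; have := cmp _ _ _ K0' K1' K1 c1 h'.
have := cmin' _ c1; lra.
Qed.

Lemma center_rot K K' z : circle z -> K !=set0 -> K `<=` @cdisc R ->
  (forall a, K' a <-> K (z^-1 * a)) -> center K' = z * center K.
Proof.
move=> hz K0 K1 h; have z0 := circle_neq0 hz; move/circleP: (hz) => z1.
have rotd w : cdisc (z * w) <-> cdisc w by rewrite /cdisc /= cabsM z1 mul1r.
have K'z a : K a -> K' (z * a) by move=> Ka; apply/h; rewrite mulKf.
have rotr w : radius2 K' (z * w) = radius2 K w.
  congr sup; apply/seteqP; split=> _ [a Ka <-].
    exists (z^-1 * a); first exact/h.
    by rewrite -[in RHS](mulVKf z0 a) -mulrBr csqM /csq z1 expr1n mul1r.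
  by exists (z * a); [exact: K'z|rewrite -mulrBr csqM /csq z1 expr1n mul1r].
have [c1 cmin] := centerP K0 K1; apply: center_uniq.
- by case: K0 => a Ka; exists (z * a); exact: K'z.
- by move=> a /h /K1 /rotd; rewrite mulVKf.
split; first exact/rotd.
by move=> w hw; rewrite -[w](mulVKf z0) !rotr; apply: cmin; apply/rotd; rewrite mulVKf.
Qed.

Lemma center_set0 : center [set 0] = 0.
Proof.
apply: center_uniq; first by exists 0.
  by move=> _ ->; exact: cdisc0.
split; first exact: cdisc0.
move=> w hw; apply: radius2_le; first by exists 0.
move=> _ ->; rewrite subrr csq0; apply: le_trans (radius2_ub _ hw _); last first.
- by [].
- by move=> _ ->; exact: cdisc0.
- exact: csq_ge0.
Qed.

(** A disc about 0 that contains 1 has radius at least 1, and the disc about [w] is smaller. *)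
Lemma center_neq0 K w : K `<=` @cdisc R -> K 1 -> cdisc w ->
  radius2 K w < 1 -> center K != 0.
Proof.
move=> K1 K11 hw hr; apply/eqP => c0.
have [c1 cmin] := centerP (ex_intro _ _ K11) K1.
have := cmin w hw; have := radius2_ub K1 c1 K11; rewrite c0 subr0.
by rewrite /csq /cabs Normc.normc1 expr1n; lra.
Qed.

End Circumcenter.

Lemma hausdorff_separate (T : topologicalType) (x y : T) :
  hausdorff_space T -> x <> y ->
  exists A B : set T, [/\ open A, open B, A x, B y & A `&` B = set0].
Proof.
rewrite open_hausdorff => h /eqP /h [[A B] /= [Ax By] [oA oB /eqP AB]].
by exists A, B; split => //; exact: set_mem.
Qed.

Lemma closed_coincidence (T U : topologicalType) (f g : T -> U) :
  hausdorff_space U -> continuous f -> continuous g -> closed [set x | f x = g x].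
Proof.
move=> hU cf cg x hx; apply: contrapT => fgx.
have [A [B [oA oB Ax Bx AB]]] := hausdorff_separate hU fgx.
have : nbhs x (f @^-1` A `&` g @^-1` B).
  by apply: filterI; [apply: cf|apply: cg]; exact: open_nbhs_nbhs.
move=> /hx [y [/= e [fA gB]]]; suff : (A `&` B) (f y) by rewrite AB.
by split => //; rewrite /= e.
Qed.

Lemma open_setC1 (T : topologicalType) (x : T) : hausdorff_space T -> open (~` [set x]).
Proof.
move=> hT; apply: closed_openC; apply: accessible_closed_set1.
exact: hausdorff_accessible.
Qed.

Lemma preimage_nbhs (T U : topologicalType) (f : T -> U) (x : T) (A : set U) :
  {for x, continuous f} -> nbhs (f x) A -> nbhs x (f @^-1` A).
Proof. by move=> cf nA; exact: cf. Qed.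

(** Discharges composability conditions: ranges and sources are computed by rewriting, and isotropy
    hypotheses become equations for [congruence]. *)
Ltac grpd :=
  repeat match goal with H : @isotropy ?G ?e |- _ =>
    change (@rng G e = @src G e) in H end;
  try match goal with |- @isotropy ?G ?e => change (@rng G e = @src G e) end;
  repeat first [ rewrite rng_ginv | rewrite src_ginv | rewrite rng_rng
               | rewrite src_rng | rewrite rng_src | rewrite src_src
               | rewrite rng_gmul | rewrite src_gmul ];
  try congruence.

(** * Calculus and topology in groupoids *)

Section GroupoidAlgebra.
Variable G : groupoid.
Implicit Types (g h k u : G).

Lemma units_src u : units u -> src u = u.
Proof. by move=> hu; rewrite -{1}(hu : rng u = u) src_rng. Qed.

Lemma units_rngE g : units (rng g). Proof. exact: rng_rng. Qed.

Lemma units_srcE g : units (src g). Proof. exact: rng_src. Qed.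

Lemma gmulKg g h : src g = rng h -> gmul (ginv g) (gmul g h) = h.
Proof.
by move=> gh; rewrite gmulA ?src_ginv // gmulVg gh gmul_rng.
Qed.

Lemma gmulVKg g h : rng g = rng h -> gmul g (gmul (ginv g) h) = h.
Proof. by move=> gh; rewrite gmulA ?src_ginv ?rng_ginv // gmulV gh gmul_rng. Qed.

Lemma gmulgK g h : src g = rng h -> gmul (gmul g h) (ginv h) = g.
Proof. by move=> gh; rewrite -gmulA ?rng_ginv // gmulV -gh gmul_src. Qed.

Lemma gmulgVK g h : src g = src h -> gmul (gmul g (ginv h)) h = g.
Proof. by move=> gh; rewrite -gmulA ?rng_ginv ?src_ginv // gmulVg -gh gmul_src. Qed.

Lemma ginv_uniq g h : src g = rng h -> gmul g h = rng g -> h = ginv g.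
Proof.
move=> gh e; rewrite -[LHS](gmulKg gh) e -[rng g](src_ginv g) gmul_src //.
Qed.

Lemma ginvK g : ginv (ginv g) = g.
Proof. by apply/esym/ginv_uniq; rewrite ?src_ginv ?rng_ginv ?gmulVg. Qed.

Lemma ginvM g h : src g = rng h -> ginv (gmul g h) = gmul (ginv h) (ginv g).
Proof.
move=> gh; apply/esym/ginv_uniq.
  by rewrite src_gmul // rng_gmul ?rng_ginv // src_ginv.
rewrite gmulA ?src_gmul ?rng_ginv // ?src_ginv //.
by rewrite gmulgK // gmulV rng_gmul.
Qed.

Lemma ginv_unit u : units u -> ginv u = u.
Proof.
move=> hu; apply/esym/ginv_uniq; first by rewrite (units_src hu).
by rewrite -{1}(hu : rng u = u) gmul_rng.
Qed.

Lemma ginvMV g h : src g = src h -> ginv (gmul g (ginv h)) = gmul h (ginv g).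
Proof. by move=> gh; rewrite ginvM ?rng_ginv // ginvK. Qed.

Lemma gmulVM g h k : src g = src h -> src h = src k ->
  gmul (gmul g (ginv h)) (gmul h (ginv k)) = gmul g (ginv k).
Proof.
move=> gh hk; rewrite gmulA ?src_gmul ?rng_ginv ?src_ginv // ?gmulgVK //.
Qed.

Lemma gmul_injr g h k : src g = rng k -> src h = rng k ->
  gmul g k = gmul h k -> g = h.
Proof. by move=> gk hk e; rewrite -(gmulgK gk) e gmulgK. Qed.

Lemma gmul_injl g h k : src k = rng g -> src k = rng h ->
  gmul k g = gmul k h -> g = h.
Proof. by move=> gk hk e; rewrite -(gmulKg gk) e gmulKg. Qed.

Lemma gmul_near g h (A : set G) : src g = rng h -> nbhs (gmul g h) A ->
  exists B D : set G, [/\ nbhs g B, nbhs h D &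
    forall x y, B x -> D y -> src x = rng y -> A (gmul x y)].
Proof.
move=> gh nA; have /subspace_continuousP/(_ (g, h) gh) := @gmul_continuous G.
move=> /(_ A nA) /= [[B D] /= [nB nD] BD]; exists B, D; split => // x y Bx Dy xy.
exact: (BD (x, y)).
Qed.

(** The range is the continuous map g -> g g^-1. *)
Lemma rng_continuous : continuous (@rng G).
Proof.
move=> g A nA; have e : src g = rng (ginv g) by rewrite rng_ginv.
move: nA; rewrite -(gmulV g) => /(gmul_near e) [B [D [nB nD BD]]].
have := @ginv_continuous G g D nD => nD'.
apply: filterS (filterI nB nD') => x [Bx Dx] /=.
by rewrite -gmulV; apply: BD => //; rewrite rng_ginv.
Qed.

Lemma src_continuous : continuous (@src G).
Proof.
move=> g; have -> : @src G = @rng G \o @ginv G.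
  by apply/funext => x; rewrite /= rng_ginv.
by apply: continuous_comp; [exact: ginv_continuous|exact: rng_continuous].
Qed.

Lemma composable_closed : closed [set p : G * G | src p.1 = rng p.2].
Proof.
apply: closed_coincidence; first exact: groupoid_hausdorff.
- by move=> p; apply: continuous_comp; [exact: cvg_fst|exact: src_continuous].
- by move=> p; apply: continuous_comp; [exact: cvg_snd|exact: rng_continuous].
Qed.

Definition setprod (A B : set G) : set G :=
  [set k | exists g h, [/\ A g, B h, src g = rng h & k = gmul g h]].

Lemma setprod_compact (A B : set G) :
  compact A -> compact B -> compact (setprod A B).
Proof.
move=> cA cB; have -> : setprod A B =
    (fun p : G * G => gmul p.1 p.2) @` ((A `*` B) `&` [set p | src p.1 = rng p.2]).
  apply/seteqP; split=> [k [g [h [Ag Bh gh ->]]]|_ [[g h] [[/= Ag Bh] gh] <-]].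
    by exists (g, h).
  by exists g, h.
apply: continuous_compact; last first.
  by apply: compact_closedI; [exact: compact_setX|exact: composable_closed].
apply: continuous_subspaceW; last exact: gmul_continuous.
by move=> p [].
Qed.

Lemma ginv_compact (A : set G) : compact A -> compact (@ginv G @` A).
Proof.
by apply: continuous_compact; apply: continuous_subspaceT; exact: ginv_continuous.
Qed.

Lemma compact_closed_groupoid (A : set G) : compact A -> closed A.
Proof. by apply: compact_closed; exact: groupoid_hausdorff. Qed.

Lemma compact_nbhs g : exists2 K : set G, nbhs g K & compact K.
Proof.
have := @groupoid_locally_compact G g I; rewrite withinET => -[K nK [cK _]].
by exists K.
Qed.

Lemma compact_nbhs_in g (A : set G) : nbhs g A ->
  exists K : set G, [/\ nbhs g K, compact K & K `<=` A].
Proof.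
move=> nA; have [K nK cK] := compact_nbhs g.
have nKg : nbhs g K := nK.
have [B nB BA] := @compact_regular G g K (@groupoid_hausdorff G) cK nKg _ nA.
exists (K `&` closure B); split.
- by apply: filterI => //; apply: filterS nB; exact: subset_closure.
- by apply: compact_closedI => //; exact: closed_closure.
- by move=> x [_ /BA].
Qed.

Section Etale.
Hypothesis etG : etale G.

(** Let [U] be a neighbourhood of a unit on which the range is injective. For x near the unit, x and
    [rng x] both lie in [U] and have the same range, so they are equal. *)
Lemma units_open : open (@units G).
Proof.
rewrite openE => u hu; have [U [oU Uu [_ Uinj _] _]] := etG.1 u.
have n1 : nbhs u U by exact: open_nbhs_nbhs.
have n2 : nbhs u (@rng G @^-1` U).
  by apply: rng_continuous; rewrite (hu : rng u = u).
apply: filterS (filterI n1 n2) => x [Ux rUx] /=.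
by apply: Uinj; rewrite ?inE // rng_rng.
Qed.

Lemma src_inj_nbhs g : exists U : set G,
  [/\ open U, U g & forall x y, U x -> U y -> src x = src y -> x = y].
Proof.
have [U [oU Ug [_ Uinj _] _]] := etG.2 g; exists U; split => // x y Ux Uy.
by apply: Uinj; rewrite inE.
Qed.

Lemma src_open (B : set G) : open B -> open (@src G @` B).
Proof.
move=> oB; rewrite openE => _ [g Bg <-].
have [U [oU Ug [_ _ Uhomeo] [V oV UV]]] := etG.2 g.
have [W oW UW] := Uhomeo B oB.
have : (W `&` @src G @` U) (src g) by rewrite -UW; exists g.
rewrite UV => -[Wg [Vg _]].
have o3 : open (W `&` (V `&` @units G)).
  by apply: openI => //; apply: openI => //; exact: units_open.
have : nbhs (src g) (W `&` (V `&` @units G)).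
  by apply: open_nbhs_nbhs; split => //; split => //; split => //; exact: units_srcE.
by apply: filterS => x; rewrite -UV -UW => -[y [Uy By] <-]; exists y.
Qed.

Lemma near_src g (B : set G) : nbhs g B ->
  \forall x \near src g, units x -> exists2 y, B y & src y = x.
Proof.
rewrite nbhsE => -[B' [oB' B'g] sB].
have : nbhs (src g) (@src G @` B').
  by apply: open_nbhs_nbhs; split; [exact: src_open|exists g].
by apply: filterS => _ [y B'y <-] _; exists y => //; exact: sB.
Qed.

End Etale.
End GroupoidAlgebra.

(** * The circle action on a twist, lifting along fibres, and the convolution sum *)

Section Twist.
Variables (R : realType) (G : groupoid) (E : twist R G).
Local Notation C := R[i]^o.
Local Notation pi := (@proj R G E).
Implicit Types (e f x y w : E) (z : C) (g : G).

Lemma proj_unit_inj e f : units e -> units f -> pi e = pi f -> e = f.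
Proof.
by move=> he hf; have [_ h _] := proj_units_homeo E; apply: h; rewrite inE.
Qed.

Lemma proj_ginv e : pi (ginv e) = ginv (pi e).
Proof.
by apply: ginv_uniq; rewrite -?proj_src -?proj_rng ?rng_ginv // -proj_mul ?rng_ginv // gmulV.
Qed.

Lemma src_proj e f : (src (pi e) = src (pi f)) <-> (src e = src f).
Proof.
rewrite -!proj_src; split=> [|->//]; apply: proj_unit_inj; exact: units_srcE.
Qed.

Lemma rng_proj e f : (rng (pi e) = rng (pi f)) <-> (rng e = rng f).
Proof.
rewrite -!proj_rng; split=> [|->//]; apply: proj_unit_inj; exact: units_rngE.
Qed.

Lemma src_rng_proj e f : (src (pi e) = rng (pi f)) <-> (src e = rng f).
Proof.
rewrite -proj_src -proj_rng; split=> [|->//].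
by apply: proj_unit_inj; [exact: units_srcE|exact: units_rngE].
Qed.

Lemma isotropy_proj e : isotropy (pi e) <-> isotropy e.
Proof.
rewrite /isotropy /= -proj_src -proj_rng; split=> [|->//].
by apply: proj_unit_inj; [exact: units_rngE|exact: units_srcE].
Qed.

Lemma units_proj e : units e -> units (pi e).
Proof. by move=> he; rewrite /units /= -proj_rng (he : rng e = e). Qed.

Lemma iota1 e : iota_tw E (pi (rng e)) 1 = rng e.
Proof.
have u1 : units (pi (rng e)) by apply: units_proj; exact: units_rngE.
apply: proj_unit_inj; last by rewrite proj_iota //; exact: circle1.
- by rewrite /units /= iota_rng //; exact: circle1.
- exact: units_rngE.
Qed.

Lemma iota_rngE e z : circle z -> rng (iota_tw E (pi (rng e)) z) = rng e.
Proof.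
by move=> hz; rewrite iota_rng ?iota1 //; apply: units_proj; exact: units_rngE.
Qed.

Lemma iota_srcE e z : circle z -> src (iota_tw E (pi (rng e)) z) = rng e.
Proof.
by move=> hz; rewrite iota_src ?iota1 //; apply: units_proj; exact: units_rngE.
Qed.

Lemma rng_tact z e : circle z -> rng (tact z e) = rng e.
Proof. by move=> hz; rewrite /tact rng_gmul ?iota_rngE ?iota_srcE. Qed.

Lemma src_tact z e : circle z -> src (tact z e) = src e.
Proof. by move=> hz; rewrite /tact src_gmul ?iota_srcE. Qed.

Lemma proj_tact z e : circle z -> pi (tact z e) = pi e.
Proof.
move=> hz; rewrite /tact proj_mul ?iota_srcE // proj_iota //.
  by rewrite proj_rng gmul_rng.
by apply: units_proj; exact: units_rngE.
Qed.

Lemma tact1 e : tact 1 e = e.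
Proof. by rewrite /tact iota1 gmul_rng. Qed.

Lemma tactA (z w : C) e : circle z -> circle w -> tact z (tact w e) = tact (z * w) e.
Proof.
move=> hz hw; have u1 : units (pi (rng e)) by apply: units_proj; exact: units_rngE.
rewrite {1}/tact rng_tact // /tact gmulA ?iota_srcE ?iota_rngE //.
by rewrite iota_mul.
Qed.

Lemma tact_gmull z e f : circle z -> src e = rng f ->
  tact z (gmul e f) = gmul (tact z e) f.
Proof.
by move=> hz ef; rewrite /tact rng_gmul // gmulA ?iota_srcE.
Qed.

Lemma tactE z e : circle z -> tact z e = gmul e (iota_tw E (pi (src e)) z).
Proof. by move=> hz; rewrite /tact iota_central. Qed.

Lemma tact_gmulr z e f : circle z -> src e = rng f ->
  tact z (gmul e f) = gmul e (tact z f).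
Proof.
move=> hz ef; rewrite !tactE // src_gmul // gmulA //.
by rewrite -[src f]rng_src iota_rngE // rng_src.
Qed.

Lemma tact_ginv z e : circle z -> ginv (tact z e) = tact z^-1 (ginv e).
Proof.
move=> hz; have hz' := circle_inv hz; apply/esym/ginv_uniq.
  by rewrite src_tact // rng_tact // rng_ginv.
rewrite -tact_gmull // ?rng_tact // ?rng_ginv // -tact_gmulr // ?rng_ginv //.
by rewrite tactA // mulfV ?circle_neq0 // tact1 gmulV.
Qed.

Lemma tact_inj (z w : C) e : circle z -> circle w -> tact z e = tact w e -> z = w.
Proof.
move=> hz hw h; have u1 : units (pi (rng e)) by apply: units_proj; exact: units_rngE.
have {}h : iota_tw E (pi (rng e)) z = iota_tw E (pi (rng e)) w.
  by apply: gmul_injr h; rewrite ?iota_srcE.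
have [_ inj _] := iota_homeo E.
have := inj (pi (rng e), z) (pi (rng e), w).
by rewrite !inE => /(_ (conj u1 hz) (conj u1 hw) h) [].
Qed.

(** The element f e^-1 lies over a unit, so it comes from [iota_tw]; comparing ranges identifies its
    unit. *)
Lemma phase e f : pi e = pi f -> exists2 z, circle z & f = tact z e.
Proof.
move=> ef; have sef : src e = src f by apply/src_proj; rewrite ef.
have : (pi @^-1` @units G) (gmul f (ginv e)).
  rewrite /= proj_mul ?rng_ginv // proj_ginv ef gmulV; exact: units_rngE.
rewrite proj_kernel => -[[u z] [/= hu hz] h]; exists z => //.
rewrite -[f](gmulgVK (h := e)) // -h /tact; congr (gmul (iota_tw E _ z) e).
have : rng (iota_tw E u z) = rng f by rewrite h rng_gmul ?rng_ginv.
move/(congr1 pi); rewrite iota_rng // proj_iota //; last exact: circle1.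
by move=> ->; rewrite proj_rng proj_rng ef.
Qed.

Lemma tact_near z e (A : set E) : circle z -> nbhs (tact z e) A ->
  exists (B : set C) (D : set E), [/\ nbhs z B, nbhs e D &
    forall (w : C) x, circle w -> B w -> D x -> A (tact w x)].
Proof.
move=> hz nA; have [B [D [nB nD BD]]] := gmul_near (iota_srcE e hz) nA.
have [ci _ _] := iota_homeo E.
have hu : (@units G `*` @circle R) (pi (rng e), z).
  by split => //; apply: units_proj; exact: units_rngE.
have /subspace_continuousP/(_ _ hu B nB) /= := ci.
move=> [[B1 B2] /= [nB1 nB2] B12].
have nD' : nbhs e (D `&` (pi \o @rng E) @^-1` B1).
  apply: filterI => //; apply: (continuous_comp (@rng_continuous E e)) nB1.
  exact: proj_continuous.
exists B2, (D `&` (pi \o @rng E) @^-1` B1); split => // w x hw Bw [Dx Bx].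
apply: BD => //; last by rewrite iota_srcE.
apply: (B12 (pi (rng x), w)) => //=; split => //.
by apply: units_proj; exact: units_rngE.
Qed.

Lemma tact_cont z : circle z -> continuous (tact z : E -> E).
Proof.
move=> hz e A /(tact_near hz) [B [D [nB nD BD]]].
by apply: filterS nD => x Dx; apply: BD => //; exact: nbhs_singleton.
Qed.

Definition saturation (K : set E) : set E :=
  [set f | exists z e, [/\ circle z, K e & f = tact z e]].

Lemma saturation_compact K : compact K -> compact (saturation K).
Proof.
move=> cK; have -> : saturation K =
    (fun p : C * E => tact p.1 p.2) @` (@circle R `*` K).
  apply/seteqP; split=> [_ [z [e [hz Ke ->]]]|_ [[z e] [/= hz Ke] <-]].
    by exists (z, e).
  by exists z, e.
apply: continuous_compact; last by apply: compact_setX => //; exact: circle_compact.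
apply/subspace_continuousP => -[z e] [/= hz Ke] A /(tact_near hz).
move=> [B [D [nB nD BD]]]; exists (B, D) => // -[w x] [/= Bw Dx] [/= hw Kx].
exact: BD.
Qed.

Lemma restr_gmul (S : set G) e f : subgroupoid S -> src e = rng f ->
  restr E S e -> restr E S f -> restr E S (gmul e f).
Proof.
move=> hS ef Se Sf; rewrite /restr /= proj_mul //; apply: hS.1 => //.
exact/src_rng_proj.
Qed.

Lemma restr_ginv (S : set G) e : subgroupoid S ->
  restr E S e -> restr E S (ginv e).
Proof. by move=> hS Se; rewrite /restr /= proj_ginv; apply: hS.2. Qed.

Lemma restr_rng (S : set G) e : subgroupoid S ->
  restr E S e -> restr E S (rng e).
Proof.
move=> hS Se; rewrite -gmulV; apply: restr_gmul => //; first by rewrite rng_ginv.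
exact: restr_ginv.
Qed.

Lemma restr_src (S : set G) e : subgroupoid S ->
  restr E S e -> restr E S (src e).
Proof.
by move=> hS Se; rewrite -rng_ginv; apply: restr_rng => //; exact: restr_ginv.
Qed.

Lemma restr_tact (S : set G) z e : circle z -> restr E S e -> restr E S (tact z e).
Proof. by move=> hz; rewrite /restr /= proj_tact. Qed.

Lemma restr_open (S : set G) : open S -> open (restr E S).
Proof. by apply: open_comp => x _; exact: proj_continuous. Qed.

Lemma restr_nbhs (S : set G) e : open S -> restr E S e -> nbhs e (restr E S).
Proof. by move=> oS Se; apply: open_nbhs_nbhs; split => //; exact: restr_open. Qed.

Lemma restr_closed (S : set G) : closed S -> closed (restr E S).
Proof. by apply: closed_comp => x _; exact: proj_continuous. Qed.

Lemma rep_proj g : pi (rep E g) = g.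
Proof. by rewrite /rep; case: cid. Qed.

Section Lifting.
Hypothesis etG : etale G.

(** A substitute for local sections of the source map: the projection and the source map of [G] are
    open, and a unit of [E] is determined by its image in [G]. *)
Lemma near_lift_src e0 e (B : set E) : nbhs e B -> src e0 = src e ->
  \forall x \near e0, exists2 y, B y & src y = src x.
Proof.
move=> nB e0e; have nB' : nbhs (pi e) (pi @` B).
  move: nB; rewrite nbhsE => -[B' [oB' B'e] sB].
  have : nbhs (pi e) (pi @` B').
    by apply: open_nbhs_nbhs; split; [exact: proj_open|exists e].
  by apply: filterS => _ [y By <-]; exists y => //; exact: sB.
have := near_src etG nB'; rewrite -proj_src -e0e => h.
have : {for e0, continuous (pi \o @src E)}.
  by apply: continuous_comp; [exact: src_continuous|exact: proj_continuous].
move=> /(_ _ h) h'; apply: (@filterS _ (nbhs e0) _ _ _ _ h') => x /= [].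
   by apply: units_proj; exact: units_srcE.
move=> _ [y By <-]; rewrite -proj_src => ps; exists y => //.
by apply: proj_unit_inj ps; exact: units_srcE.
Qed.

Lemma near_lift_rng e0 e (B : set E) : nbhs e B -> src e0 = rng e ->
  \forall x \near e0, exists2 y, B y & rng y = src x.
Proof.
move=> nB e0e; have nB' : nbhs (ginv e) (@ginv E @^-1` B).
  by apply: ginv_continuous; rewrite ginvK.
have := @near_lift_src e0 _ _ nB'; rewrite src_ginv => /(_ e0e).
by apply: filterS => x [y By <-]; exists (ginv y) => //; rewrite rng_ginv.
Qed.

End Lifting.

(** Changing the representative by a phase multiplies one factor by [z] and the other by its
    inverse. *)
Lemma conv_term (f1 f2 : E -> C) e t t' : equivariant f1 -> equivariant f2 ->
  rng t = rng e -> pi t = pi t' ->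
  f1 t' * f2 (gmul (ginv t') e) = f1 t * f2 (gmul (ginv t) e).
Proof.
move=> h1 h2 te /phase [z hz ->]; rewrite h1 // tact_ginv //.
have hz' := circle_inv hz.
rewrite -tact_gmull // ?src_ginv // h2 //.
by rewrite mulrACA mulfV ?mul1r // circle_neq0.
Qed.

Lemma conv_equivariant (f1 f2 : E -> C) : equivariant f2 -> equivariant (conv f1 f2).
Proof.
move=> h2 z e hz; rewrite /conv rng_tact // mulr_fsumr; apply: eq_fsbigr => g.
rewrite inE /= => ge; have re : src (ginv (rep E g)) = rng e.
  by rewrite src_ginv; apply/rng_proj; rewrite rep_proj ge proj_rng.
by rewrite -tact_gmulr // h2 // mulrCA.
Qed.

(** The substitution of x w^-1 for the summation variable replaces the range fibre by a source
    fibre. In terms of kernels f(x y^-1), convolution becomes matrix multiplication, with a free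
    choice of the representatives [W]. *)
Lemma convE (f1 f2 : E -> C) x y (W : seq E) :
  equivariant f1 -> equivariant f2 -> src x = src y ->
  (forall w, w \in W -> src w = src y) -> uniq (map pi W) ->
  (forall w, src w = src y ->
     f1 (gmul x (ginv w)) * f2 (gmul w (ginv y)) != 0 -> pi w \in map pi W) ->
  conv f1 f2 (gmul x (ginv y)) =
  \sum_(w <- W) f1 (gmul x (ginv w)) * f2 (gmul w (ginv y)).
Proof.
move=> h1 h2 xy sW uW cov; rewrite /conv rng_gmul ?rng_ginv //.
pose T g := f1 (rep E g) * f2 (gmul (ginv (rep E g)) (gmul x (ginv y))).
have TE w : src w = src y ->
    T (pi (gmul x (ginv w))) = f1 (gmul x (ginv w)) * f2 (gmul w (ginv y)).
  move=> wy; rewrite /T (@conv_term _ _ _ (gmul x (ginv w))) ?rep_proj //.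
    by rewrite ginvMV ?xy // gmulVM // ?wy.
  by rewrite !rng_gmul ?rng_ginv ?xy.
transitivity (\sum_(g <- [seq pi (gmul x (ginv w)) | w <- W]) T g); last first.
  by rewrite big_map; apply: eq_big_seq => w /sW /TE.
have mapE : [seq pi (gmul x (ginv w)) | w <- W] =
    [seq gmul (pi x) (ginv h) | h <- map pi W].
  rewrite -map_comp; apply/eq_in_map => w /sW wy /=.
  by rewrite proj_mul ?proj_ginv ?rng_ginv // xy.
have sm h : h \in map pi W -> src h = src (pi x).
  by move=> /mapP[w /sW wy ->]; apply/src_proj; rewrite wy.
rewrite [RHS]fsbig_seq; last first.
  rewrite mapE map_inj_in_uniq // => h k /sm hx /sm kx e.
  have := @gmul_injl _ (ginv h) (ginv k) (pi x).
  by rewrite !rng_ginv hx kx => /(_ erefl erefl e) /(congr1 (@ginv G)); rewrite !ginvK.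
apply/esym/fsbig_widen.
  move=> g /=; rewrite mapE => /mapP[h /sm hx ->].
  by rewrite rng_gmul ?rng_ginv // proj_rng.
move=> g /= [gx gW]; apply: contrapT => /eqP Tg; apply: gW.
pose w := gmul (ginv (rep E g)) x.
have rx : rng (rep E g) = rng x by apply/rng_proj; rewrite rep_proj gx proj_rng.
have wy : src w = src y by rewrite /w src_gmul ?src_ginv.
have gE : g = pi (gmul x (ginv w)).
  by rewrite /w ginvM ?src_ginv // ginvK gmulVKg ?rep_proj.
have : pi w \in map pi W by apply: cov => //; rewrite -TE // -gE.
rewrite mapE => Ww; apply/mapP; exists (pi w) => //.
by rewrite {1}gE proj_mul ?proj_ginv ?rng_ginv // xy.
Qed.

End Twist.

Lemma card_set_seq (T : choiceType) (s : seq T) :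
  #|` fset_set [set` s]| = size (undup s).
Proof.
rewrite -card_fseq; congr (#|` _|); rewrite -[RHS]set_fsetK; congr fset_set.
by apply/seteqP; split=> x /=; rewrite inE.
Qed.

Lemma uniq_map_inj (T U : eqType) (f : T -> U) (s : seq T) :
  uniq (map f s) -> {in s &, injective f}.
Proof.
move=> us x y xs ys e; rewrite -(nth_index x xs) -(nth_index x ys).
congr nth; apply/eqP; rewrite -(nth_uniq (f x) _ _ us) ?size_map ?index_mem //.
by rewrite !(nth_map x) ?index_mem // !nth_index // e.
Qed.

Lemma uniq_map_tnth_inj (T : Type) (U : eqType) (f : T -> U) (s : seq T) :
  uniq (map f s) -> injective (fun i : 'I_(size s) => f (tnth (in_tuple s) i)).
Proof.
case: s => [|x s] us i j; first by case: i.
rewrite !(tnth_nth x) => ij; apply/val_inj/eqP.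
by rewrite -(nth_uniq (f x) _ _ us) ?size_map ?ltn_ord // !(nth_map x) ?ltn_ord // ij.
Qed.

(** * Conjugation orbits, and the equivalence of (ii) and (iii) *)

Section ConditionsTwoThree.
Variables (R : realType) (G : groupoid) (E : twist R G) (S : set G).
Hypotheses (etG : etale G) (subS : subgroupoid S) (oS : open S).
Local Notation pi := (@proj R G E).
Implicit Types (e f x y t : E) (g h k : G).

(** Equal finite cardinalities of the orbit and its image mean that the projection is injective on
    the orbit, so that one list enumerates both. *)
Lemma Omega_seqP e n : Omega S e = Some n <->
  exists s : seq E, [/\ size s = n, uniq (map pi s) & Ad S e = [set` s]].
Proof.
have img (s : seq E) : pi @` [set` s] = [set` map pi s].
  by apply/seteqP; split=> [_ [x xs <-]|_ /mapP[x xs ->]]; [exact: map_f|exists x].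
rewrite /Omega; split.
  case: pselect => // -[fA cA] [<-]; exists (enum_fset (fset_set (Ad S e))).
  have AE : Ad S e = [set` enum_fset (fset_set (Ad S e))] by rewrite -{1}(fset_setK fA).
  split => //; apply: contraT; rewrite -ltn_size_undup -card_set_seq -img -AE -cA.
  by rewrite size_map ltnn.
move=> [s [<- us AE]]; case: pselect => [|[]].
  by rewrite AE card_set_seq undup_id // (map_uniq us).
rewrite AE img; split; first exact: finite_seq.
by rewrite !card_set_seq !undup_id ?size_map // (map_uniq us).
Qed.

Lemma Omega_preimageP N e : Omega_preimage E S N e <->
  isotropy e /\ exists s : seq E,
    [/\ N (size s), uniq (map pi s) & Ad S e = [set` s]].
Proof.
split=> [[ie [n Nn /Omega_seqP [s [sn us As]]]]|[ie [s [Nn us As]]]].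
  by split => //; exists s; rewrite sn.
by split => //; exists (size s) => //; apply/Omega_seqP; exists s.
Qed.

Lemma Ad_self e : isotropy e -> restr E S (rng e) -> Ad S e e.
Proof.
move=> ie Se; exists (rng e); split; rewrite ?rng_rng ?src_rng //.
by rewrite (ginv_unit (units_rngE e)) [gmul e _](_ : _ = e) ?gmul_rng // ie gmul_src.
Qed.

Lemma Ad_rng e f : isotropy e -> Ad S e f -> rng f = rng e.
Proof. by move=> ie [t [St rt st ->]]; grpd. Qed.

Lemma Ad_src e f : isotropy e -> Ad S e f -> src f = rng e.
Proof. by move=> ie [t [St rt st ->]]; grpd. Qed.

Lemma Ad_isotropy e f : isotropy e -> Ad S e f -> isotropy f.
Proof. by move=> ie Af; rewrite /isotropy /= (Ad_rng ie Af) (Ad_src ie Af). Qed.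

Lemma conj_conj e t t' : isotropy e -> rng t = rng e -> src t = rng e ->
  rng t' = rng e -> src t' = rng e ->
  gmul (ginv t') (gmul (gmul (ginv t) (gmul e t)) t') =
  gmul (ginv (gmul t t')) (gmul e (gmul t t')).
Proof.
move=> ie rt st rt' st'; rewrite ginvM; last by grpd.
by rewrite !gmulA; grpd.
Qed.

Lemma Ad_trans e f x : isotropy e -> Ad S e f -> Ad S f x -> Ad S e x.
Proof.
move=> ie Af [t' [St']]; rewrite (Ad_rng ie Af) => rt' st' ->.
have [t [St rt st ->]] := Af; exists (gmul t t').
have tt' : src t = rng t' by rewrite st rt'.
split; rewrite ?rng_gmul ?src_gmul //; first exact: restr_gmul.
exact: conj_conj.
Qed.

Lemma conjVK e t : isotropy e -> rng t = rng e -> src t = rng e ->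
  gmul t (gmul (gmul (ginv t) (gmul e t)) (ginv t)) = e.
Proof.
move=> ie rt st; have et : src e = rng t by grpd.
by rewrite -gmulA ?gmulgK ?gmulVKg //; grpd.
Qed.

Lemma Ad_sym e f : isotropy e -> Ad S e f -> Ad S f e.
Proof.
move=> ie Af; have [t [St rt st fE]] := Af.
exists (ginv t); rewrite (Ad_rng ie Af) rng_ginv src_ginv ginvK; split => //.
  exact: restr_ginv.
by rewrite fE conjVK.
Qed.

Lemma Ad_eq e f : isotropy e -> Ad S e f -> Ad S f = Ad S e.
Proof.
move=> ie Af; apply/seteqP; split=> k; first exact: Ad_trans.
by apply: Ad_trans; [exact: Ad_isotropy Af|exact: Ad_sym].
Qed.

Lemma Omega_one_trivial e t : Omega S e = Some 1%N -> isotropy e ->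
  restr E S t -> rng t = rng e -> src t = rng e ->
  gmul (ginv t) (gmul e t) = e.
Proof.
move=> /Omega_seqP [[|a [|b s]] [//= _ _ AE]] ie St rt st.
have : Ad S e (gmul (ginv t) (gmul e t)) by exists t.
have : Ad S e e by apply: Ad_self => //; rewrite -rt; exact: restr_rng.
by rewrite AE /= !inE => /eqP -> /eqP ->.
Qed.

Lemma Omega_one_commute e t : Omega S e = Some 1%N -> isotropy e ->
  restr E S t -> rng t = rng e -> src t = rng e -> gmul e t = gmul t e.
Proof.
move=> O1 ie St rt st; have := Omega_one_trivial O1 ie St rt st.
move/(congr1 (gmul t)); rewrite gmulVKg // rng_gmul //; by rewrite -ie.
Qed.

Lemma Omega_one e : isotropy e -> restr E S (rng e) ->
  (forall t, restr E S t -> rng t = rng e -> src t = rng e ->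
     gmul e t = gmul t e) -> Omega S e = Some 1%N.
Proof.
move=> ie Se h; apply/Omega_seqP; exists [:: e]; split => //.
apply/seteqP; split=> [_ [t [St rt st ->]]|f].
  by rewrite h // gmulKg ?st //= inE.
by rewrite /= inE => /eqP ->; exact: Ad_self.
Qed.

Local Notation OmegaOne := (Omega_preimage E S [set 1%N]).

Lemma Omega_oneP e : OmegaOne e <-> isotropy e /\ Omega S e = Some 1%N.
Proof.
by split=> [[ie [n -> On]]|[ie O1]]; split => //; exists 1%N.
Qed.

Lemma abelian_Omega_one e : abelian_subset (restr E S) -> restr E S e -> OmegaOne e.
Proof.
move=> [iS cS] Se; have ie := iS _ Se; apply/Omega_oneP; split => //.
apply: Omega_one => //; first exact: restr_rng.
by move=> t St rt st; apply: cS => //; grpd.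
Qed.

Lemma abelian_interior : abelian_subset (restr E S) ->
  restr E S `<=` interior OmegaOne.
Proof.
move=> aS e Se; by have := restr_nbhs oS Se; apply: filterS => f; exact: abelian_Omega_one.
Qed.

Definition condition_two :=
  [/\ @units E `<=` interior OmegaOne, interior OmegaOne = restr E S &
      interior (Omega_preimage E S [set n | (1 < n)%N]) = set0].

Definition condition_three :=
  [/\ open_isotropy_subgroupoid S, abelian_subset (restr E S),
      (forall S' : set G, open_isotropy_subgroupoid S' ->
        abelian_subset (restr E S') -> S `<=` S' -> S' = S) &
      interior (Omega_preimage E S [set n | (1 < n)%N]) = set0].

Lemma two_imp_three : condition_two -> condition_three.
Proof.
move=> [uS iS i1]; have SO e : restr E S e -> isotropy e /\ Omega S e = Some 1%N.
  by rewrite -iS => /interior_subset /Omega_oneP.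
split => //.
- split => // g Sg; have [e eg] := proj_surj E g.
  by rewrite -eg; apply/isotropy_proj; apply: (SO _ _).1; rewrite /restr /= eg.
- split=> [e /SO []//|e f Se Sf ef].
  have [ie O1] := SO _ Se; have [iff _] := SO _ Sf.
  by apply: (Omega_one_commute) => //; grpd.
(* Elements of the abelian [restr E S'] commute with all conjugators from [S], so Omega_S is 1 on
   this open set and (ii) places it in [restr E S]. *)
- move=> S' [sS' iS' oS'] [iE' cE'] SS'; apply/seteqP; split => // g S'g.
  have [e eg] := proj_surj E g; have S'e : restr E S' e by rewrite /restr /= eg.
  suff : interior OmegaOne e by rewrite iS /restr /= eg.
  have := restr_nbhs oS' S'e; apply: filterS => f S'f; have iff := iE' _ S'f.
  apply/Omega_oneP; split => //; apply: Omega_one => //.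
    by rewrite -iS; apply: uS; exact: units_rngE.
  by move=> t St rt st; apply: cE' => //; [exact: SS'|grpd].
Qed.

Inductive generated (V : set G) : G -> Prop :=
| gen_base g : (S `|` V) g -> generated V g
| gen_mul g h : generated V g -> generated V h -> src g = rng h ->
    generated V (gmul g h)
| gen_inv g : generated V g -> generated V (ginv g).

Lemma generated_open V : open V -> open (generated V).
Proof.
move=> oV; rewrite openE => g; elim=> {g} [g SVg|g h _ ng _ nh gh|g _ ng].
- have : nbhs g (S `|` V) by apply: open_nbhs_nbhs; split => //; exact: openU.
  by apply: filterS => h; exact: gen_base.
(* An element k near gh is the product of k h'^-1 and h', where h' is near h and has the source of
   k; then k h'^-1 is near g, and both factors are generated. *)
- have e : src (gmul g h) = rng (ginv h) by grpd.
  have ng' : nbhs (gmul (gmul g h) (ginv h)) (generated V) by rewrite gmulgK.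
  have [B [D [nB nD BD]]] := gmul_near e ng'.
  have nD' : nbhs h (@ginv G @^-1` D `&` generated V).
    by apply: filterI => //; exact: ginv_continuous.
  have := near_src etG nD'; rewrite -(src_gmul gh) => hs.
  apply: filterS (filterI nB (@src_continuous _ _ _ hs)) => k [Bk /=].
  move=> []; first exact: units_srcE.
  move=> h' [Dh' gh'] hk; rewrite -[k](gmulgVK (h := h')) //.
  by apply: gen_mul => //; [apply: BD => //; grpd|grpd].
- have : nbhs (ginv g) (@ginv G @^-1` generated V).
    by apply: preimage_nbhs; [exact: ginv_continuous|rewrite ginvK].
  by apply: filterS => h /= /gen_inv; rewrite ginvK.
Qed.

(** Commutation takes place in [E] but generation in [G]; quantifying over all lifts allows
    induction over [generated]. *)
Definition lifts_commute g h := forall e f, pi e = g -> pi f = h ->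
  src e = src f -> gmul e f = gmul f e.

Lemma lifts_commute_sym g h : lifts_commute g h -> lifts_commute h g.
Proof. by move=> c e f eh fg ef; rewrite (c f e). Qed.

Lemma lifts_commuteM g h k : isotropy g -> isotropy h -> isotropy k -> src h = rng k ->
  lifts_commute g h -> lifts_commute g k -> lifts_commute g (gmul h k).
Proof.
move=> ig ih ik hk cgh cgk e f eg fhk ef.
have [a ah] := proj_surj E h.
have ie : isotropy e by apply/isotropy_proj; rewrite eg.
have ia : isotropy a by apply/isotropy_proj; rewrite ah.
have iff : isotropy f by apply/isotropy_proj; rewrite fhk; grpd.
have af : src a = src f by apply/src_proj; rewrite ah fhk; grpd.
have fE : f = gmul a (gmul (ginv a) f) by rewrite gmulVKg //; grpd.
have bk : pi (gmul (ginv a) f) = k.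
  by rewrite proj_mul ?proj_ginv ?fhk ?ah ?gmulKg //; grpd.
move: bk fE; set b := gmul (ginv a) f => bk fE.
have rb : rng b = src f by rewrite /b; grpd.
have sb : src b = src f by rewrite /b; grpd.
rewrite fE gmulA; [|grpd|grpd]; rewrite (cgh e a) //; last by grpd.
rewrite -gmulA; [|grpd|grpd]; rewrite (cgk e b) //; last by grpd.
by rewrite gmulA; grpd.
Qed.

Lemma lifts_commuteV g h : isotropy g -> isotropy h ->
  lifts_commute g h -> lifts_commute g (ginv h).
Proof.
move=> ig ih cgh e f eg fh ef.
have ie : isotropy e by apply/isotropy_proj; rewrite eg.
have iff : isotropy f by apply/isotropy_proj; rewrite fh; grpd.
have h1 : pi (ginv f) = h by rewrite proj_ginv fh ginvK.
have := cgh e (ginv f) eg h1; rewrite src_ginv => /(_ (etrans ef (esym iff))) c.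
apply: (@gmul_injl _ _ _ (ginv f)); [by grpd|by grpd|].
rewrite gmulKg; last by grpd.
rewrite gmulA; [|grpd|grpd]; rewrite -c -gmulA; [|grpd|grpd].
by rewrite gmulVg -ef gmul_src.
Qed.

(** It suffices to compare generators. Two from [S] commute by hypothesis, a mixed pair because
    Omega_S is 1, and two from [V] with a common source coincide in [G], so that their lifts differ
    by a central phase. *)
Lemma generated_abelian V : V `<=` @isotropy G ->
  abelian_subset (restr E S) ->
  (forall e, restr E V e -> Omega S e = Some 1%N) ->
  (forall g h, V g -> V h -> src g = src h -> g = h) ->
  generated V `<=` @isotropy G /\ abelian_subset (restr E (generated V)).
Proof.
move=> iV [iS cS] OV injV.
have iso : generated V `<=` @isotropy G.
  move=> g; elim=> {g} [g [Sg|/iV //]|g h _ ig _ ih gh|g _ ig].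
  - have [e eg] := proj_surj E g; rewrite -eg; apply/isotropy_proj/iS.
    by rewrite /restr /= eg.
  - by rewrite /isotropy /=; grpd.
  - by rewrite /isotropy /=; grpd.
have base g h : (S `|` V) g -> (S `|` V) h -> lifts_commute g h.
  have mixed g' h' : S g' -> V h' -> lifts_commute g' h'.
    move=> Sg Vh e f eg fh ef.
    have Vf : restr E V f by rewrite /restr /= fh.
    have Se : restr E S e by rewrite /restr /= eg.
    have iff : isotropy f by apply/isotropy_proj; rewrite fh; exact: iV.
    have ie : isotropy e by exact: iS.
    by rewrite (Omega_one_commute (OV _ Vf) iff Se) //; grpd.
  move=> [Sg|Vg] [Sh|Vh]; [|exact: mixed|by apply: lifts_commute_sym; exact: mixed|].
  - move=> e f eg fh ef.
    have Se : restr E S e by rewrite /restr /= eg.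
    have Sf : restr E S f by rewrite /restr /= fh.
    by apply: cS => //; rewrite ef -(iS _ Sf).
  - move=> e f eg fh ef.
    have iff : isotropy f by apply/isotropy_proj; rewrite fh; exact: iV.
    have gh : g = h by apply: injV => //; rewrite -eg -fh; apply/src_proj.
    have [z hz fz] : exists2 z, circle z & e = tact z f by apply: phase; rewrite eg fh.
    by rewrite fz -tact_gmull // -?tact_gmulr //; grpd.
have gbase g h : generated V g -> (S `|` V) h -> lifts_commute h g.
  move=> + SVh; have ih := iso _ (gen_base SVh).
  elim=> {g} [g SVg|g k Vg cg Vk ck gk|g Vg cg]; first exact: base.
    by apply: lifts_commuteM => //; exact: iso.
  by apply: lifts_commuteV => //; exact: iso.
have gg g h : generated V g -> generated V h -> lifts_commute g h.
  move=> Vg; have ig := iso _ Vg.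
  elim=> {h} [h SVh|h k Vh ch Vk ck hk|h Vh ch].
  - by apply: lifts_commute_sym; exact: gbase.
  - by apply: lifts_commuteM => //; exact: iso.
  - by apply: lifts_commuteV => //; exact: iso.
split => //; split=> [e Ve|e f Ve Vf ef].
  by apply/isotropy_proj; exact: iso.
apply: (gg _ _ Ve Vf) => //; rewrite ef.
by have /isotropy_proj := iso _ Vf.
Qed.

Lemma generated_subgroupoid V : subgroupoid (generated V).
Proof. by split=> [g h Vg Vh gh|g]; [exact: gen_mul|exact: gen_inv]. Qed.

Lemma three_imp_two : condition_three -> condition_two.
Proof.
move=> [_ aS maxS i1]; have abI := abelian_interior aS.
(* The union of [S] with all units is again admissible, because elements over units are phases and
   commute with isotropy; maximality absorbs it. *)
have uS : @units G `<=` S.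
  pose S' := S `|` @units G.
  have iG g : S g -> isotropy g.
    have [e eg] := proj_surj E g; rewrite -eg => Sg.
    by apply/isotropy_proj; exact: aS.1.
  have iu g : units g -> isotropy g by move=> ug; rewrite /isotropy /= units_src.
  suff <- : S' = S by move=> g; right.
  apply: maxS; last by move=> g; left.
    split; last by apply: openU => //; exact: units_open.
      split=> [g h [Sg|ug] [Sh|uh] gh|g [Sg|ug]].
      - by left; exact: subS.1.
      - left; have -> : h = src g by rewrite gh (uh : rng h = h).
        by rewrite gmul_src.
      - left; have -> : g = rng h by rewrite -gh units_src.
        by rewrite gmul_rng.
      - right; have -> : h = src g by rewrite gh (uh : rng h = h).
        by rewrite gmul_src.
      - by left; exact: subS.2.
      - by right; rewrite ginv_unit.
    by move=> g [/iG|/iu].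
  have i' e : restr E S' e -> isotropy e.
    by move=> [Se|ue]; apply/isotropy_proj; [exact: iG|exact: iu].
  split=> // e f S'e S'f ef; have ie := i' _ S'e; have iff := i' _ S'f.
  have scal a b : units (pi a) -> isotropy a -> isotropy b -> src a = src b ->
      gmul a b = gmul b a.
    move=> ua ia ib ab; have : pi (rng a) = pi a by rewrite proj_rng (ua : rng _ = _).
    move=> /phase [z hz ->]; rewrite -tact_gmull //; last by grpd.
    rewrite -tact_gmulr; [|done|by grpd].
    have -> : rng a = rng b by grpd.
    by rewrite gmul_rng ib gmul_src.
  case: (S'e) => [Se|ue]; last by apply: scal => //; grpd.
  case: (S'f) => [Sf|uf]; last by apply/esym/scal => //; grpd.
  exact: aS.2.
have uSE : @units E `<=` restr E S.
  by move=> u hu; apply: uS; exact: units_proj.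
split => //; first by move=> u /uSE; exact: abI.
apply/seteqP; split => // e Ie.
have oI : open (interior OmegaOne) by exact: open_interior.
pose W := pi @` interior OmegaOne.
have oW : open W by exact: proj_open.
have We : W (pi e) by exists e.
have [U [oU Ue injU]] := src_inj_nbhs etG (pi e).
(* The factor [U] makes the source injective on [V], as [generated_abelian] requires. *)
pose V := U `&` W; have oV : open V by exact: openI.
(* Elements over [W] are phases times elements of the interior, and phases do not affect
   commutation. *)
have OV f : restr E V f -> isotropy f /\ Omega S f = Some 1%N.
  move=> [_ [f' If' ff']]; have /Omega_oneP [if' O1] := interior_subset If'.
  have iff : isotropy f by apply/isotropy_proj; rewrite -ff'; apply/isotropy_proj.
  split => //; apply: Omega_one => //; first by apply: uSE; exact: units_rngE.
  move=> t St rt st; have [z hz ->] := phase ff'.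
  have rff' : rng f = rng f' by apply/rng_proj; rewrite ff'.
  rewrite -tact_gmull //; last by grpd.
  rewrite -tact_gmulr //; last by grpd.
  by rewrite (Omega_one_commute O1) //; grpd.
have [] := @generated_abelian V.
- move=> g Vg; have [f fg] := proj_surj E g; rewrite -fg; apply/isotropy_proj.
  by apply: (OV _ _).1; rewrite /restr /= fg.
- exact: aS.
- by move=> f /OV [].
- by move=> g h [Ug _] [Uh _]; exact: injU.
move=> iVG aVG; have <- : generated V = S.
  apply: maxS => //.
    by split => //; [exact: generated_subgroupoid|exact: generated_open].
  by move=> g Sg; apply: gen_base; left.
by apply: gen_base; right.
Qed.

End ConditionsTwoThree.

(** The cover is given by a property of sets, not by an indexed family. Finite lists, filtered by
    inclusion, form the parameter space for the near-covering form of compactness. *)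
Lemma compact_finite_cover (T : topologicalType) (K : set T) (P : set T -> Prop) :
  compact K -> (forall x, K x -> exists U, [/\ nbhs x U & P U]) ->
  exists s : seq (set T), (forall U, List.In U s -> P U) /\
    forall x, K x -> exists2 U, List.In U s & U x.
Proof.
move=> /compact_near_coveringP cK cov.
pose D := [set s : seq (set T) | forall U, List.In U s -> P U].
pose F : set_system (seq (set T)) :=
  filter_from D (fun s => [set s' | forall U, List.In U s -> List.In U s']).
have FF : Filter F.
  apply: filter_from_filter; first by exists [::].
  move=> s1 s2 D1 D2; exists (s1 ++ s2).
    by move=> U /List.in_app_iff [/D1|/D2].
  by move=> s h; split=> U hU; apply: h; apply/List.in_app_iff; [left|right].
have [x Kx|s Ds h] := cK _ F (fun s x => exists2 U, List.In U s & U x) FF.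
  have [U [nU PU]] := cov x Kx.
  exists (U, [set s' | List.In U s']).
    split => //=; exists [:: U]; first by move=> V [<-|].
    by move=> s' /= h; apply: h; left.
  by move=> [y s] /= [Uy Us]; exists U.
by exists s; split => // x Kx; apply: (h s).
Qed.

Lemma disjoint_nbhs (T : topologicalType) n (p : 'I_n -> T) :
  hausdorff_space T -> injective p ->
  exists N : 'I_n -> set T, (forall i, nbhs (p i) (N i)) /\
    forall i j x, N i x -> N j x -> i = j.
Proof.
move=> hT injp; have sep (ij : 'I_n * 'I_n) : exists AB : set T * set T,
    ij.1 <> ij.2 -> [/\ nbhs (p ij.1) AB.1, nbhs (p ij.2) AB.2 & AB.1 `&` AB.2 = set0].
  have [e|ne] := pselect (ij.1 = ij.2); first by exists (setT, setT).
  have [A [B [oA oB Ax By AB]]] := hausdorff_separate hT (fun e => ne (injp _ _ e)).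
  by exists (A, B) => _; split => //; exact: open_nbhs_nbhs.
have {sep} [f fP] := choice sep.
exists (fun i => [set x | forall j, i <> j -> (f (i, j)).1 x /\ (f (j, i)).2 x]).
split=> [i|i j x Ni Nj].
  apply: (@filter_forall _ _ (fun j x => i <> j -> (f (i, j)).1 x /\ (f (j, i)).2 x)) => j.
  have [e|ne] := pselect (i = j); first by apply: filterE => x.
  have [h1 _ _] := fP (i, j) ne; have [_ h2 _] := fP (j, i) (fun e => ne (esym e)).
  by apply: filterS (filterI h1 h2) => x [].
apply: contrapT => ne; have [h1 _] := Ni _ ne.
have [_ h2] := Nj _ (fun e => ne (esym e)); have [_ _ h] := fP (i, j) ne.
by suff : ((f (i, j)).1 `&` (f (i, j)).2) x by rewrite h.
Qed.

(** * Functions of compact support and continuity of convolution *)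

Section CompactlySupported.
Variables (R : realType) (G : groupoid) (E : twist R G).
Hypothesis etG : etale G.
Local Notation C := R[i]^o.
Local Notation pi := (@proj R G E).
Implicit Types (e x y w : E) (z : C) (g : G) (f : E -> C).

Lemma vanishes_off_neq0 (A : set E) f e : vanishes_off A f -> f e != 0 -> A e.
Proof. by move=> vf; apply: contraPP => /vf ->; rewrite eqxx. Qed.

Lemma vanishes_off_continuous (A : set E) f e : closed A -> vanishes_off A f ->
  ~ A e -> {for e, continuous f}.
Proof.
move=> cA vf nAe; apply/continuous_cabs => eps eps0.
have : nbhs e (~` A) by apply: open_nbhs_nbhs; split => //; exact: closed_openC.
by apply: filterS => x nAx; rewrite !vf // subrr cabs0.
Qed.

Lemma CcP f : Cc setT f <-> [/\ continuous f, equivariant f &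
  exists2 K : set E, compact K & forall e, f e != 0 -> K e].
Proof.
split=> [[_ cf kf ef]|[cf ef [K cK fK]]].
  split => //; first by apply/continuous_subspace_setT.
  exists (closure [set e | f e != 0]); last by move=> e fe; exact: subset_closure.
  by move: kf; rewrite (_ : restr E setT = setT) ?setIT.
split => //; first by move=> e /(_ I).
  exact: continuous_subspaceT.
rewrite (_ : restr E setT = setT) // setIT.
apply: (subclosed_compact _ cK); first exact: closed_closure.
have /closure_id -> : closed K by exact: compact_closed_groupoid.
exact: closureS.
Qed.

Section Clopen.
Variable S : set G.
Hypotheses (oS : open S) (cS : closed S).

(** Since [S] is clopen, a function that is continuous on [restr E S] and vanishes off it is
    continuous at the points of the open complement as well. *)
Lemma CcSP f : Cc S f <-> Cc setT f /\ vanishes_off (restr E S) f.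
Proof.
split=> [[vf cf kf ef]|[/CcP[cf ef [K cK fK]] vf]].
  split => //; apply/CcP; split => //.
    move=> e; have [Se|nSe] := pselect (restr E S e).
      move: cf; rewrite continuous_open_subspace; last exact: restr_open.
      by apply; rewrite inE.
    exact: (vanishes_off_continuous (restr_closed cS) vf).
  exists (closure [set e | f e != 0] `&` restr E S) => // e fe; split.
    exact: subset_closure.
  exact: (vanishes_off_neq0 vf fe).
split => //; first exact: continuous_subspaceT.
apply: compact_closedI; last exact: restr_closed.
apply: (subclosed_compact _ cK); first exact: closed_closure.
have /closure_id -> : closed K by exact: compact_closed_groupoid.
exact: closureS.
Qed.

Definition cut f e : C := if `[< restr E S e >] then f e else 0.

Lemma cutE f e : restr E S e -> cut f e = f e.
Proof. by rewrite /cut => Se; case: asboolP. Qed.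

Lemma cut_out f e : ~ restr E S e -> cut f e = 0.
Proof. by rewrite /cut => Se; case: asboolP. Qed.

Lemma cut_Cc f : Cc setT f -> Cc S (cut f).
Proof.
move=> /CcP[cf ef [K cK fK]]; apply/CcSP; split; last exact: cut_out.
apply/CcP; split.
- move=> e; have [Se|nSe] := pselect (restr E S e).
    apply/continuous_cabs => eps eps0; rewrite cutE //.
    have nS := restr_nbhs oS Se.
    have /continuous_cabs/(_ _ eps0) h := cf e.
    by apply: filterS (filterI nS h) => x [Sx hx]; rewrite cutE.
  by apply: (vanishes_off_continuous (restr_closed cS) _ nSe) => x; exact: cut_out.
- move=> z e hz; have [Se|nSe] := pselect (restr E S e).
    by rewrite !cutE ?ef //; exact: restr_tact.
  by rewrite !cut_out ?mulr0 //; rewrite /restr /= proj_tact.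
- exists K => // e; have [Se|nSe] := pselect (restr E S e).
    by rewrite cutE //; exact: fK.
  by rewrite cut_out // eqxx.
Qed.

End Clopen.

Lemma Cc_equivariant f : Cc setT f -> equivariant f. Proof. by case. Qed.

Lemma Cc_add f1 f2 : Cc setT f1 -> Cc setT f2 -> Cc setT (fun e => f1 e + f2 e).
Proof.
move=> /CcP[c1 e1 [K1 k1 h1]] /CcP[c2 e2 [K2 k2 h2]]; apply/CcP; split.
- by move=> e; apply: cvgD; [exact: c1|exact: c2].
- by move=> z e hz; rewrite e1 // e2 // mulrDr.
- exists (K1 `|` K2); first exact: compactU.
  move=> e; have [->|/h1 ? _] := eqVneq (f1 e) 0; last by left.
  by rewrite add0r => /h2; right.
Qed.

Lemma Cc_scale k f : Cc setT f -> Cc setT (fun e => k * f e).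
Proof.
move=> /CcP[c1 e1 [K1 k1 h1]]; apply/CcP; split.
- by move=> e; apply: cvgMr; exact: c1.
- by move=> z e hz; rewrite e1 // mulrCA.
- exists K1 => // e; have [->|/h1 //] := eqVneq (f e) 0.
  by rewrite mulr0 eqxx.
Qed.

Lemma Cc_sub f1 f2 : Cc setT f1 -> Cc setT f2 -> Cc setT (fun e => f1 e - f2 e).
Proof.
move=> h1 h2; have := Cc_add h1 (Cc_scale (-1) h2).
by under [X in Cc setT X]eq_fun do rewrite mulN1r.
Qed.

Lemma Cc0 : Cc setT (fun _ : E => 0 : C).
Proof.
apply/CcP; split; [by move=> e; exact: cvg_cst|by move=> z e _; rewrite mulr0|].
by exists set0; [exact: compact0|move=> e; rewrite eqxx].
Qed.

Lemma starf_equivariant f : equivariant f -> equivariant (starf f).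
Proof.
move=> ef z e hz; rewrite /starf tact_ginv // ef; last exact: circle_inv.
by rewrite rmorphM /= (circleV hz) conjcK.
Qed.

Lemma Cc_star f : Cc setT f -> Cc setT (starf f).
Proof.
move=> /CcP[c1 e1 [K1 k1 h1]]; apply/CcP; split.
- move=> e; apply/continuous_cabs => eps eps0.
  have /continuous_cabs/(_ _ eps0) h := c1 (ginv e).
  have := preimage_nbhs (@ginv_continuous E e) h; apply: filterS => x /=.
  by rewrite /starf -(rmorphB (@conjc R)) cabs_conj.
- exact: starf_equivariant.
- exists (@ginv E @` K1); first exact: ginv_compact.
  move=> e; rewrite /starf conjc_eq0 => /h1 K1e; exists (ginv e) => //.
  by rewrite ginvK.
Qed.

Lemma Cc_bounded f : Cc setT f -> exists2 M : R, 0 < M & forall e, cabs (f e) <= M.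
Proof.
move=> /CcP[cf ef [K cK fK]].
have [|s [sP Ks]] := @compact_finite_cover _ K
  (fun U => exists2 M : R, 0 < M & forall e, U e -> cabs (f e) <= M) cK.
  move=> e Ke; exists [set x | cabs (f e - f x) < 1]; split.
    by have /continuous_cabs := cf e; apply.
  exists (1 + cabs (f e)); first by rewrite ltr_pwDl ?cabs_ge0.
  by move=> x /= /ltW; have := cabs_tri (f x) 0 (f e); rewrite !subr0 cabsB; lra.
have [M M0 hM] : exists2 M : R, 0 < M &
    forall U e, List.In U s -> U e -> cabs (f e) <= M.
  elim: s sP {Ks} => [|U s IH] sP; first by exists 1.
  have [|M M0 hM] := IH; first by move=> V Vs; apply: sP; right.
  have [M' M'0 hM'] := sP U (or_introl erefl).
  exists (M + M'); first exact: addr_gt0.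
  move=> V e [<- /hM'|/hM h /h]; lra.
exists M => // e; have [->|/fK /Ks [U Us Ue]] := eqVneq (f e) 0.
  by rewrite cabs0 ltW.
exact: (hM U).
Qed.

(** The source is not injective on any neighbourhood in [E], as whole circle orbits share it;
    equality is asked in [G] instead. *)
Definition src_separated (U : set E) :=
  forall w w', U w -> U w' -> src w = src w' -> pi w = pi w'.

Lemma src_separated_nbhs e : exists U : set G,
  nbhs (pi e) U /\ src_separated (pi @^-1` U).
Proof.
have [U [oU Ue injU]] := src_inj_nbhs etG (pi e).
exists U; split; first exact: open_nbhs_nbhs.
by move=> w w' Uw Uw' ww'; apply: injU => //; apply/src_proj.
Qed.

Definition lists_fibre (K : set E) (u : E) (W : seq E) :=
  [/\ forall w, w \in W -> src w = u, uniq (map pi W) &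
      forall w, src w = u -> K w -> pi w \in map pi W].

(** Each set of a finite cover by source-separated sets contributes at most one class to a fibre, so
    the length of the cover bounds all fibres at once. *)
Lemma fibre_finite (K : set E) : compact K ->
  exists N, forall u, exists W, (size W <= N)%N /\ lists_fibre K u W.
Proof.
move=> cK; have [|s [sP Ks]] := @compact_finite_cover _ K src_separated cK.
  move=> e Ke; have [U [nU sU]] := src_separated_nbhs e.
  exists (pi @^-1` U); split => //.
  by apply: preimage_nbhs => //; exact: proj_continuous.
exists (size s) => u.
suff [W [sW [W1 W2 W3]]] : exists W, (size W <= size s)%N /\
    lists_fibre (fun w => exists2 U, List.In U s & U w) u W.
  by exists W; split => //; split => // w wu /Ks; exact: W3.
elim: s sP {Ks} => [|U s IH] sP.
  by exists [::]; split => //; split => // w _ [].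
have [|W [sW [W1 W2 W3]]] := IH; first by move=> V Vs; apply: sP; right.
have [[w [wu Uw wW]]|h] :=
    pselect (exists w, [/\ src w = u, U w & pi w \notin map pi W]).
  exists (w :: W); split => //; split=> [w'||w' w'u [V [<-|Vs] Vw']].
  - by rewrite inE => /orP[/eqP ->|/W1].
  - by rewrite /= wW.
  - have -> : pi w' = pi w by apply: (sP U) => //; [left|rewrite w'u wu].
    by rewrite /= inE eqxx.
  - by rewrite /= inE W3 ?orbT //; exists V.
exists W; split; first by rewrite (leq_trans sW) //=.
split => // w wu [V [<-|Vs] Vw]; last by apply: W3 => //; exists V.
by apply: contrapT => /negP nW; apply: h; exists w.
Qed.

Lemma Cc_fibre f u : Cc setT f ->
  exists W, lists_fibre [set e | f e != 0] u W.
Proof.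
move=> /CcP[_ _ [K cK fK]]; have [N /(_ u) [W [_ [W1 W2 W3]]]] := fibre_finite cK.
by exists W; split => // w wu /fK; exact: W3.
Qed.

Lemma conv_src f1 f2 e W : equivariant f1 -> equivariant f2 ->
  (forall w, w \in W -> src w = src e) -> uniq (map pi W) ->
  (forall w, src w = src e -> f1 (gmul e (ginv w)) * f2 w != 0 ->
     pi w \in map pi W) ->
  conv f1 f2 e = \sum_(w <- W) f1 (gmul e (ginv w)) * f2 w.
Proof.
move=> h1 h2 W1 W2 W3; pose u := src e.
have uu : units u := units_srcE e.
have E1 w : src w = u -> gmul w (ginv u) = w.
  by move=> wu; rewrite (ginv_unit uu) -wu gmul_src.
rewrite -[in LHS](E1 e) // (@convE _ _ _ _ _ _ _ W) ?(units_src uu) //.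
  apply: eq_big_seq => w /W1 wu; rewrite E1 //.
by move=> w wu; rewrite E1 // => h; apply: W3.
Qed.

Lemma conv_Cc_src f1 f2 e W : equivariant f1 -> equivariant f2 ->
  lists_fibre [set w | f2 w != 0] (src e) W ->
  conv f1 f2 e = \sum_(w <- W) f1 (gmul e (ginv w)) * f2 w.
Proof.
move=> h1 h2 [W1 W2 W3]; apply: conv_src => // w wu ne; apply: W3 => //=.
by apply: contra_neq ne => ->; rewrite mulr0.
Qed.

Lemma conv_neq0 f1 f2 e : equivariant f1 -> Cc setT f2 -> conv f1 f2 e != 0 ->
  exists x y, [/\ src x = rng y, e = gmul x y, f1 x != 0 & f2 y != 0].
Proof.
move=> h1 c2; have [W hW] := Cc_fibre (src e) c2.
rewrite (conv_Cc_src h1 (Cc_equivariant c2) hW) => /eqP ne.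
apply: contrapT => h; apply: ne; rewrite big_seq big1 // => w.
move=> /(let: And3 a _ _ := hW in a) we; apply/eqP/negPn/negP.
rewrite mulf_eq0 negb_or => /andP[n1 n2]; apply: h.
by exists (gmul e (ginv w)), w; rewrite gmulgVK //; split => //; grpd.
Qed.

(** Disjoint neighbourhoods in [G] keep the lifted points in distinct circle orbits. *)
Lemma near_lift_family e0 n (w : 'I_n -> E) (B : 'I_n -> set E) :
  (forall i, src (w i) = src e0) -> injective (pi \o w) ->
  (forall i, nbhs (w i) (B i)) ->
  \forall x \near e0, exists w' : 'I_n -> E, injective (pi \o w') /\
    forall i, B i (w' i) /\ src (w' i) = src x.
Proof.
move=> sw injw nB.
have [N [nN dN]] := disjoint_nbhs (@groupoid_hausdorff G) injw.
have : \forall x \near e0, forall i, exists2 y, (B i `&` pi @^-1` N i) y & src y = src x.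
  apply: filter_forall => i; apply: (near_lift_src etG (e := w i)) => //.
  by apply: filterI => //; exact: (preimage_nbhs (@proj_continuous R G E (w i)) (nN i)).
apply: filterS => x h.
have h' i : exists y, [/\ B i y, N i (pi y) & src y = src x].
  by have [y [By Ny] ys] := h i; exists y.
have {h'} [w' hw'] := choice h'; exists w'; split=> [i j /= wij|i].
  by apply: (dN i j (pi (w' i))); [case: (hw' i)|rewrite wij; case: (hw' j)].
by case: (hw' i).
Qed.

Lemma conv_family f1 f2 e n (w : 'I_n -> E) :
  equivariant f1 -> equivariant f2 -> injective (pi \o w) ->
  (forall i, src (w i) = src e) ->
  (forall v, src v = src e -> f2 v != 0 -> exists i, pi v = pi (w i)) ->
  conv f1 f2 e = \sum_(i < n) f1 (gmul e (ginv (w i))) * f2 (w i).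
Proof.
move=> h1 h2 injw sw cov.
rewrite (@conv_src _ _ _ [seq w i | i <- enum 'I_n]) //.
- by rewrite big_map big_enum.
- by move=> _ /mapP[i _ ->].
- by rewrite -map_comp map_inj_uniq ?enum_uniq.
- move=> v ve ne; have [|i ->] := cov v ve.
    by apply: contra_neq ne => ->; rewrite mulr0.
  by rewrite -map_comp; apply/mapP; exists i; rewrite ?mem_enum.
Qed.

(** Upper semicontinuity of the fibres of a compact set. Points of [K] with a source other than that
    of [e0] are kept away by separating the two sources. *)
Lemma near_fibre_covered (K : set E) e0 n (U : 'I_n -> set G) (w : 'I_n -> E) :
  compact K -> (forall v, src v = src e0 -> K v -> exists i, pi v = pi (w i)) ->
  (forall i, nbhs (pi (w i)) (U i)) ->
  \forall x \near e0, forall v, K v -> src v = src x -> exists i, U i (pi v).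
Proof.
move=> /compact_near_coveringP cK cov nU.
have := cK _ (nbhs e0) (fun x v => src v = src x -> exists i, U i (pi v)).
apply=> v Kv; have [ve|ve] := pselect (src v = src e0).
  have [i vi] := cov v ve Kv; exists (pi @^-1` U i, setT).
    split; last exact: filterT.
    by apply: preimage_nbhs; [exact: proj_continuous|rewrite vi].
  by move=> [y x] /= [Uy _] _; exists i.
have [A [B [oA oB Av Be AB]]] := hausdorff_separate (@groupoid_hausdorff E) ve.
exists (@src E @^-1` A, @src E @^-1` B).
  split; first exact: (preimage_nbhs (@src_continuous E v) (open_nbhs_nbhs (conj oA Av))).
  exact: (preimage_nbhs (@src_continuous E e0) (open_nbhs_nbhs (conj oB Be))).
move=> [y x] /= [Ay Bx] yx; suff : (A `&` B) (src y) by rewrite AB.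
by split => //; rewrite yx.
Qed.

(** Near [e0] the sum keeps its number of terms: the representatives [w] move to representatives in
    the nearby fibre, and [near_fibre_covered] excludes further contributions. *)
Lemma conv_continuous f1 f2 : Cc setT f1 -> Cc setT f2 -> continuous (conv f1 f2).
Proof.
move=> c1 c2 e0; have /CcP[cf1 h1 _] := c1; have /CcP[cf2 h2 [K cK fK]] := c2.
have [N /(_ (src e0)) [W [_ [W1 W2 W3]]]] := fibre_finite cK.
pose n := size W; pose w (i : 'I_n) := tnth (in_tuple W) i.
have wW i : w i \in W by exact: mem_tnth.
have sw i : src (w i) = src e0 by exact: W1.
have enumW : W = [seq w i | i <- enum 'I_n].
  by rewrite /w map_tnth_enum.
have injw : injective (pi \o w) := uniq_map_tnth_inj W2.
have cov v : src v = src e0 -> K v -> exists i, pi v = pi (w i).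
  by move=> ve /(W3 _ ve); rewrite enumW -map_comp => /mapP[i _ ->]; exists i.
have /choice[U hU] : forall i, exists U, nbhs (pi (w i)) U /\ src_separated (pi @^-1` U).
  by move=> i; exact: src_separated_nbhs.
have nearcov := near_fibre_covered cK cov (fun i => (hU i).1).
apply/continuous_cabs => eps eps0.
pose d := eps / n.+1%:R; have d0 : 0 < d by rewrite divr_gt0 // ltr0n.
pose T x v := f1 (gmul x (ginv v)) * f2 v.
have /choice[AB hAB] : forall i, exists AB : set E * set E, [/\ nbhs e0 AB.1,
    nbhs (w i) AB.2 & forall x v, AB.1 x -> AB.2 v -> src x = src v ->
      cabs (T e0 (w i) - T x v) < d].
  move=> i; have cT : {for (gmul e0 (ginv (w i)), w i),
      continuous (fun p : E * E => f1 p.1 * f2 p.2)}.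
    apply: cvgM; apply: continuous_comp.
    - exact: cvg_fst.
    - exact: cf1.
    - exact: cvg_snd.
    - exact: cf2.
  have /continuous_cabs/(_ _ d0) [[A B] /= [nA nB] hAB] := cT.
  have e0w : src e0 = rng (ginv (w i)) by grpd.
  have [A' [B' [nA' nB' hAB']]] := gmul_near e0w nA.
  exists (A', @ginv E @^-1` B' `&` B); split => //=.
    by apply: filterI => //; apply: preimage_nbhs => //; exact: ginv_continuous.
  move=> x v A'x [B'v Bv] xv; apply: (hAB (gmul x (ginv v), v)); split => //=.
  by apply: hAB' => //; grpd.
have n1 : \forall x \near e0, forall i, (AB i).1 x.
  by apply: filter_forall => i; case: (hAB i).
have n2 : \forall x \near e0, exists w' : 'I_n -> E, injective (pi \o w') /\
    forall i, ((AB i).2 `&` pi @^-1` U i) (w' i) /\ src (w' i) = src x.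
  apply: (near_lift_family (B := fun i => (AB i).2 `&` pi @^-1` U i) sw injw).
  move=> i; have [_ nAB _] := hAB i.
  by apply: filterI => //; exact: (preimage_nbhs (@proj_continuous R G E (w i)) (hU i).1).
apply: filterS (filterI n1 (filterI n2 nearcov)) => x [hA [[w' [injw' hw']] hcov]].
rewrite (conv_family h1 h2 injw sw) => [|v ve /fK]; last exact: cov.
rewrite (@conv_family _ _ _ _ w') // => [|i|v vx /fK Kv].
- rewrite -sumrB; apply: cabs_sum_lt => // i; have [_ _] := hAB i.
  by apply=> //; case: (hw' i) => [[]].
- by case: (hw' i).
- have [i Ui] := hcov v Kv vx; exists i; have [[_ Uw'] sw'] := hw' i.
  by apply: (hU i).2 => //; rewrite vx sw'.
Qed.

Lemma Cc_conv f1 f2 : Cc setT f1 -> Cc setT f2 -> Cc setT (conv f1 f2).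
Proof.
move=> c1 c2; have /CcP[_ h1 [K1 k1 f1K]] := c1; have /CcP[_ h2 [K2 k2 f2K]] := c2.
apply/CcP; split; [exact: conv_continuous|exact: conv_equivariant|].
exists (setprod K1 K2); first exact: setprod_compact.
move=> e /(conv_neq0 h1 c2) [x [y [xy eE /f1K K1x /f2K K2y]]].
by exists x, y.
Qed.

End CompactlySupported.

(** * Equivariant bump functions *)

Lemma urysohn_bump (R : realType) (T : topologicalType) (x : T) (A : set T) :
  locally_compact [set: T] -> hausdorff_space T -> nbhs x A ->
  exists k : T -> R, [/\ continuous k, forall y, 0 <= k y <= 1, k x = 1 &
    forall y, k y != 0 -> A y].
Proof.
move=> lcT hT nA; have clB : closed (~` interior A) by apply: open_closedC; exact: open_interior.
have xB : ~ (~` interior A) x by apply.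
have := @locally_compact_completely_regular _ R lcT hT x _ clB xB.
move=> /(@uniform_separatorP _ R) [f [cf f01 f0 f1]].
exists (fun y => 1 - f y); split.
- by move=> y; apply: cvgB; [exact: cvg_cst|exact: cf].
- move=> y; have := f01 (f y) (ex_intro2 _ _ y I erefl).
  by rewrite /= in_itv /=; lra.
- by rewrite (f0 (f x)) ?subr0 //; exists x.
- move=> y; have [/interior_subset //|nA'] := pselect (interior A y).
  by rewrite (f1 (f y)) ?subrr ?eqxx //; exists y.
Qed.

Section Bump.
Variables (R : realType) (G : groupoid) (E : twist R G).
Local Notation C := R[i]^o.
Local Notation pi := (@proj R G E).
Implicit Types (e x y w : E) (z : C) (f : E -> C).

(* Replacing averaging over the circle, an equivariant function is obtained from
   a bump function k by taking the centre of the smallest disc that contains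
   all the numbers k(z e) / z with |z| = 1. *)
Definition equivariant_center (k : E -> R) (e : E) : C :=
  center [set z^-1 * (k (tact z e))%:C%C | z in @circle R].

Section Center.
Variable k : E -> R.
Hypotheses (ck : continuous k) (k01 : forall e, 0 <= k e <= 1).

Let orb e : set C := [set z^-1 * (k (tact z e))%:C%C | z in @circle R].

Lemma cabs_real (r : R) : 0 <= r -> cabs (r%:C%C : C) = r.
Proof. by move=> r0; rewrite /cabs /= expr0n addr0 sqrtr_sqr ger0_norm. Qed.

Let orb0 e : orb e !=set0.
Proof. by exists (1^-1 * (k (tact 1 e))%:C%C), 1 => //; exact: circle1. Qed.

Let orb1 e : orb e `<=` @cdisc R.
Proof.
move=> _ [z hz <-]; rewrite /cdisc /= cabsM.
move/circle_inv/circleP: hz => ->; have /andP[h1 h2] := k01 (tact z e).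
by rewrite mul1r cabs_real.
Qed.

(** Moving [e] by the phase [t] rotates the set of values by [t], and centres rotate along. *)
Lemma equivariant_centerZ : equivariant (equivariant_center k).
Proof.
move=> t e ht; apply: (center_rot ht (orb0 e) (@orb1 e)) => a.
have t0 := circle_neq0 ht; split.
  move=> [z hz <-]; exists (z * t); first exact: circleM.
  by rewrite -tactA // invfM mulrA [t^-1 * _]mulrC.
move=> [z hz ha]; exists (z * t^-1); first by apply: circleM => //; exact: circle_inv.
rewrite tactA; [|by apply: circleM => //; exact: circle_inv|done].
by rewrite mulfVK // invfM invrK mulrAC ha mulrC mulVKf.
Qed.

Lemma equivariant_center_supp e :
  (forall z, circle z -> k (tact z e) = 0) -> equivariant_center k e = 0.
Proof.
move=> h; rewrite -(center_set0 R) /equivariant_center; congr center.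
apply/seteqP; split=> [_ [z hz <-]|_ ->]; first by rewrite h // mulr0.
by exists 1; [exact: circle1|rewrite h ?mulr0 //; exact: circle1].
Qed.

Lemma equivariant_center_continuous : continuous (equivariant_center k).
Proof.
move=> e; apply/continuous_cabs => eps eps0.
(* [center_perturb] bounds the squared distance of the centres by 16 d, which is half of eps^2. *)
pose d := eps ^+ 2 / 32; have d0 : 0 < d by rewrite divr_gt0 // exprn_gt0.
have : \forall x \near e, @circle R `<=` (fun z => `|k (tact z e) - k (tact z x)| <= d).
  have /compact_near_coveringP/near_covering_withinP cc := @circle_compact R.
  apply: (cc _ (nbhs e) (fun x z => `|k (tact z e) - k (tact z x)| <= d)) => z hz.
  have nA : nbhs (tact z e) [set y | `|k (tact z e) - k y| < d / 2].
    by have /cvgrPdist_lt := @ck (tact z e); apply; exact: divr_gt0.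
  have [B [D [nB nD BD]]] := tact_near hz nA.
  exists (B, D) => // -[z' x] /= [Bz' Dx] hz'.
  have /= h1 := BD z' x hz' Bz' Dx.
  have /= h2 := BD z' e hz' Bz' (nbhs_singleton nD).
  rewrite (le_trans (ler_distD (k (tact z e)) _ _)) // distrC; lra.
apply: filterS => x hx.
have kdist z : circle z -> forall y y' : E, `|k (tact z y) - k (tact z y')| <= d ->
    cabs (z^-1 * (k (tact z y))%:C%C - z^-1 * (k (tact z y'))%:C%C) <= d.
  move=> hz y y' h; rewrite -mulrBr cabsM; move/circle_inv/circleP: hz => ->.
  by rewrite mul1r -rmorphB /cabs /= expr0n addr0 sqrtr_sqr.
have := @center_perturb _ (orb e) (orb x) d (orb0 e) (@orb1 e) (orb0 x) (@orb1 x).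
have h1 a : orb e a -> exists2 b, orb x b & cabs (a - b) <= d.
  move=> [z hz <-]; exists (z^-1 * (k (tact z x))%:C%C); first by exists z.
  by apply: kdist => //; exact: hx.
have h2 b : orb x b -> exists2 a, orb e a & cabs (b - a) <= d.
  move=> [z hz <-]; exists (z^-1 * (k (tact z e))%:C%C); first by exists z.
  by apply: kdist => //; rewrite distrC; exact: hx.
move=> /(_ h1 h2); rewrite -/(equivariant_center k e) -/(equivariant_center k x).
move=> h; rewrite -(@ltr_pXn2r _ 2) ?nnegrE ?cabs_ge0 ?(ltW eps0) //.
apply: (le_lt_trans h); rewrite /d; have := exprn_gt0 2 eps0; lra.
Qed.

(** The disc of radius 3/4 about 1/2 contains all values: each is 0 or differs by at most 1/4 from a
    point of [0, 1]. It has radius less than 1, so [center_neq0] applies. *)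
Lemma equivariant_center_neq0 e : k e = 1 ->
  (forall z, circle z -> k (tact z e) != 0 -> cabs (z - 1) < 4^-1) ->
  equivariant_center k e != 0.
Proof.
move=> ke h; apply: (@center_neq0 _ _ ((2^-1 : R)%:C%C)).
- exact: orb1.
- by exists 1; [exact: circle1|rewrite tact1 ke invr1 mul1r].
- change (cabs ((2^-1 : R)%:C%C : C) <= 1).
  by rewrite cabs_real ?invr_ge0 // invf_le1 // ler1n.
apply: (@le_lt_trans _ _ ((3 / 4) ^+ 2)); last by lra.
apply: radius2_le; first exact: orb0.
move=> _ [z hz <-]; rewrite /csq lerXn2r ?nnegrE ?cabs_ge0 //.
have /andP[k0 k1] := k01 (tact z e).
have [->|/(h _ hz) hz1] := eqVneq (k (tact z e)) 0.
  by rewrite mulr0 sub0r cabsN cabs_real ?invr_ge0 //; lra.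
apply: (le_trans (cabs_tri _ _ ((k (tact z e))%:C%C))).
have -> : z^-1 * (k (tact z e))%:C%C - (k (tact z e))%:C%C =
    z^-1 * (k (tact z e))%:C%C * (1 - z).
  by rewrite mulrBr mulr1 mulrAC mulVf ?mul1r // circle_neq0.
rewrite !cabsM (circleP _).1 ?mul1r ?cabs_real // ?(cabsB 1) //; last exact: circle_inv.
rewrite -rmorphB {2}/cabs /= expr0n addr0 sqrtr_sqr.
have : `|k (tact z e) - 2^-1| <= 2^-1 by rewrite ler_norml; lra.
have := cabs_ge0 (z - 1); nra.
Qed.

End Center.

Lemma bump (O : set G) e0 : open O -> O (pi e0) -> exists h : E -> C,
  [/\ Cc setT h, h e0 != 0 & exists K : set E,
    [/\ compact K, K `<=` restr E O & forall e, h e != 0 -> K e]].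
Proof.
move=> oO Oe.
(* Phases far from 1 move [e0] into a compact set [A] that does not contain [e0]; a bump supported
   off [A] only sees phases close to 1, as [equivariant_center_neq0] demands. *)
pose far := circle `&` [set z : C | 4^-1 <= cabs (z - 1)].
have cfar : compact far.
  apply: compact_closedI; first exact: circle_compact.
  move=> z hz; rewrite /= leNgt; apply/negP => h.
  have [|w [/= w1 zw]] := hz [set w | cabs (z - w) < 4^-1 - cabs (z - 1)].
    by apply/nbhs_cabs; exists (4^-1 - cabs (z - 1)) => //; rewrite subr_gt0.
  by have := cabs_tri w 1 z; rewrite (cabsB w z); lra.
pose A := [set tact z e0 | z in far].
have cA : compact A.
  apply: continuous_compact => //; apply/subspace_continuousP => z [hz _] B nB.
  have [B1 [D [nB1 nD BD]]] := tact_near hz nB.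
  apply: filterS nB1 => w B1w [hw _] /=; apply: BD => //; exact: nbhs_singleton.
have nA : ~ A e0.
  move=> [z [hz /= zfar] /esym]; rewrite -[e0 in LHS]tact1.
  move=> /(tact_inj (circle1 R) hz) z1; move: zfar; rewrite -z1 subrr cabs0.
  by rewrite invr_le0 lern0.
have nN : nbhs e0 (~` A `&` restr E O).
  apply: open_nbhs_nbhs; split; last by split.
  by apply: openI; [exact: closed_openC (compact_closed_groupoid cA)|exact: restr_open].
have [K [nK cK KN]] := compact_nbhs_in nN.
have [k [ck k01 ke kK]] := @urysohn_bump R _ _ _ (@groupoid_locally_compact E)
  (@groupoid_hausdorff E) nK.
have supp e : equivariant_center k e != 0 -> saturation K e.
  move=> ne; apply: contrapT => nsat; move/eqP: ne; apply.
  apply: equivariant_center_supp => // z hz; apply/eqP/negPn/negP => /kK Kz.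
  apply: nsat; exists z^-1, (tact z e); split => //; first exact: circle_inv.
  by rewrite tactA ?mulVf ?tact1 ?circle_neq0 //; exact: circle_inv.
exists (equivariant_center k); split.
- apply/CcP; split; [exact: equivariant_center_continuous|exact: equivariant_centerZ|].
  by exists (saturation K) => //; exact: saturation_compact.
- apply: equivariant_center_neq0 => // z hz /kK /KN [nAz _].
  by rewrite ltNge; apply/negP => far_z; apply: nAz; exists z.
- exists (saturation K); split => //; first exact: saturation_compact.
  by move=> _ [z [e [hz /KN [_ Oe'] ->]]]; exact: restr_tact.
Qed.

End Bump.

(** * The reduced norm through finite sesquilinear forms *)

Section ReducedAlgebra.
Variables (R : realType) (G : groupoid) (E : twist R G).
Hypothesis etG : etale G.
Local Notation C := R[i]^o.
Local Notation pi := (@proj R G E).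
Implicit Types (e x y w u : E) (z : C) (f g h eta xi : E -> C) (s t : seq E) (H : set G).

Definition fibre_seq H u s :=
  (forall x, x \in s -> src x = u /\ H (pi x)) /\ uniq (map pi s).

(** The inner product of [eta] with theta_u(f) [xi], for vectors carried by finitely many points of
    the fibre, one for each element of [G] involved. *)
Definition form f s t eta xi : C :=
  \sum_(x <- s) \sum_(y <- t) conjc (eta x) * (f (gmul x (ginv y)) * xi y).

Definition sqnorm s eta : R := \sum_(x <- s) csq (eta x).

Lemma sqnorm_ge0 s eta : 0 <= sqnorm s eta.
Proof. by apply: sumr_ge0 => x _; exact: csq_ge0. Qed.

(* The operator norm bounds in terms of the sesquilinear forms on finitely
   supported vectors; sums of squares instead of products of norms make the
   bound additive over orthogonal decompositions. *)
Definition bnd H f (c : R) := forall u s t eta xi, fibre_seq H u s -> fibre_seq H u t ->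
  2 * cre (form f s t eta xi) <= c * (sqnorm s eta + sqnorm t xi).

Lemma formD f g s t eta xi :
  form (fun e => f e + g e) s t eta xi = form f s t eta xi + form g s t eta xi.
Proof.
rewrite -big_split; apply: eq_bigr => x _; rewrite -big_split; apply: eq_bigr => y _.
by rewrite /= mulrDl mulrDr.
Qed.

Lemma form_row f s t eta xi : form f s t eta xi =
  \sum_(x <- s) conjc (eta x) * \sum_(y <- t) f (gmul x (ginv y)) * xi y.
Proof. by apply: eq_bigr => x _; rewrite mulr_sumr. Qed.

Lemma bnd_add H f g c d : bnd H f c -> bnd H g d ->
  bnd H (fun e => f e + g e) (c + d).
Proof.
move=> hf hg u s t eta xi hs ht; rewrite formD creD.
have := hf u s t eta xi hs ht; have := hg u s t eta xi hs ht; lra.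
Qed.

Lemma bnd_mono H f c d : c <= d -> bnd H f c -> bnd H f d.
Proof.
move=> cd hf u s t eta xi hs ht; apply: (le_trans (hf u s t eta xi hs ht)).
by apply: ler_wpM2r => //; rewrite addr_ge0 ?sqnorm_ge0.
Qed.

Lemma bnd0 H c : 0 <= c -> bnd H (fun=> 0) c.
Proof.
move=> c0 u s t eta xi hs ht; rewrite form_row big1 ?mulr0; last first.
  by move=> x _; rewrite big1 ?mulr0 // => y _; rewrite mul0r.
by rewrite mulr_ge0 // addr_ge0 ?sqnorm_ge0.
Qed.

Lemma cre_real (r : R) z : cre (r%:C%C * z) = r * cre z.
Proof. by case: z => x y; rewrite /cre /= mul0r subr0. Qed.

Lemma csq_real (r : R) : csq (r%:C%C : C) = r ^+ 2.
Proof. by rewrite csqE /= expr0n addr0. Qed.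

Lemma bnd_scale H f c k : bnd H f c -> bnd H (fun e => k * f e) (cabs k * c).
Proof.
move=> hf; have [->|k0] := eqVneq k 0.
  move=> u s t eta xi hs ht; rewrite cabs0 !mul0r form_row big1 ?mulr0 //.
  by move=> x _; rewrite big1 ?mulr0 // => y _; rewrite !mul0r.
have a0 : cabs k != 0 by apply: contra_neq k0; exact: cabs0_eq0.
(* The phase of [k] is absorbed by the vector [xi], whose norm it does not change. *)
pose p := (cabs k)%:C%C^-1 * k.
have ap : (cabs k)%:C%C * p = k.
  by rewrite /p mulVKf //; apply: contra_neq a0 => -[].
have sp : csq p = 1.
  have : csq k = csq ((cabs k)%:C%C * p) by rewrite ap.
  rewrite csqM csq_real /csq => /eqP; rewrite -subr_eq0 -[X in X - _]mulr1 -mulrBr.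
  by rewrite mulf_eq0 sqrf_eq0 (negbTE a0) /= subr_eq0 => /eqP.
move=> u s t eta xi hs ht.
have -> : form (fun e => k * f e) s t eta xi =
    (cabs k)%:C%C * form f s t eta (fun y => p * xi y).
  rewrite /form mulr_sumr; apply: eq_bigr => x _; rewrite mulr_sumr.
  by apply: eq_bigr => y _; rewrite -[in LHS]ap; ring.
rewrite cre_real mulrCA -[leRHS]mulrA ler_wpM2l ?cabs_ge0 //.
have := hf u s t eta (fun y => p * xi y) hs ht.
suff -> : sqnorm t (fun y => p * xi y) = sqnorm t xi by [].
by apply: eq_bigr => y _; rewrite csqM sp mul1r.
Qed.

Lemma bnd_sub H f g c d : bnd H f c -> bnd H g d ->
  bnd H (fun e => f e - g e) (c + d).
Proof.
move=> hf hg; have := bnd_add hf (bnd_scale (-1) hg).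
rewrite cabsN (circleP _).1 ?mul1r //; last exact: circle1.
by under [X in bnd H X]eq_fun do rewrite mulN1r.
Qed.

(** The kernel of [starf f] is the conjugate transpose of that of [f]. *)
Lemma bnd_star H f c : bnd H f c -> bnd H (starf f) c.
Proof.
move=> hf u s t eta xi hs ht.
have -> : cre (form (starf f) s t eta xi) = cre (form f t s xi eta).
  rewrite !cre_sum; under eq_bigr do rewrite cre_sum.
  under [RHS]eq_bigr do rewrite cre_sum.
  rewrite exchange_big /=; apply: eq_big_seq => y /ht.1 [yu _].
  apply: eq_big_seq => x /hs.1 [xu _].
  rewrite /starf ginvMV ?xu // -cre_conj !rmorphM /= !conjcK; congr cre; ring.
by rewrite addrC; exact: hf ht hs.
Qed.

(** Multiplying [eta] by the square root of [b] and dividing [xi] by it preserves the form; this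
    freedom recovers product bounds from sums of squares. *)
Lemma bnd_scaled H f c u s t eta xi (b : R) : 0 < b -> bnd H f c ->
  fibre_seq H u s -> fibre_seq H u t ->
  2 * cre (form f s t eta xi) <= c * (b * sqnorm s eta + b^-1 * sqnorm t xi).
Proof.
move=> b0 hf hs ht; pose a := Num.sqrt b.
have a0 : 0 < a by rewrite sqrtr_gt0.
have an0 : a%:C%C != 0 :> C by apply: contra_neq (lt0r_neq0 a0) => -[].
have := hf u s t (fun x => a%:C%C * eta x) (fun y => (a^-1)%:C%C * xi y) hs ht.
have -> : form f s t (fun x => a%:C%C * eta x) (fun y => (a^-1)%:C%C * xi y) =
    form f s t eta xi.
  apply: eq_bigr => x _; apply: eq_bigr => y _.
  have -> : conjc (a%:C%C * eta x) = a%:C%C * conjc (eta x).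
    by rewrite conjM (conjc_real a).
  by rewrite fmorphV; field; exact: an0.
have -> : sqnorm s (fun x => a%:C%C * eta x) = b * sqnorm s eta.
  rewrite /sqnorm mulr_sumr; apply: eq_bigr => x _.
  by rewrite csqM csq_real sqr_sqrtr ?ltW.
have -> // : sqnorm t (fun x => (a^-1)%:C%C * xi x) = b^-1 * sqnorm t xi.
rewrite /sqnorm mulr_sumr; apply: eq_bigr => x _.
by rewrite csqM csq_real exprVn sqr_sqrtr ?ltW.
Qed.

(** The value f(e) is the matrix entry between [e] and the unit [src e]. With a = |f(e)|, the test
    values f(e) and a yield a^3 <= c a^2; if a = 0, the values 1 and 0 yield 0 <= c. *)
Lemma bnd_entry f c e : bnd setT f c -> cabs (f e) <= c.
Proof.
move=> hf; have hs (x : E) : src x = src e -> fibre_seq setT (src e) [:: x].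
  by move=> xe; split => // y; rewrite inE => /eqP ->.
have := hf (src e) [:: e] [:: src e] (fun _ => f e) (fun _ => (cabs (f e))%:C%C).
move=> /(_ (hs e erefl) (hs (src e) _)); rewrite src_src => /(_ erefl).
rewrite /form /sqnorm !big_seq1 (ginv_unit (units_srcE e)) gmul_src csq_real.
rewrite mulrA mul_conj cre_real /cre /= -/(csq (f e)) /csq.
have := cabs_ge0 (f e); set a := cabs (f e) => a0 h.
have [a00|an0] := eqVneq a 0.
  have := hf (src e) [:: e] [:: src e] (fun _ => 1) (fun _ => 0).
  move=> /(_ (hs e erefl) (hs (src e) _)); rewrite src_src => /(_ erefl).
  rewrite /form /sqnorm !big_seq1 !mulr0 csq0 addr0 /csq (circleP _).1; last exact: circle1.
  by rewrite expr1n mulr1 a00.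
have ap : 0 < a by rewrite lt_neqAle eq_sym an0.
have : a * (a * a) <= c * (a * a) by nra.
by rewrite ler_pM2r // mulr_gt0.
Qed.

(** One form involves only the values of [f] at the finitely many points x y^-1, so norm bounds are
    closed under pointwise limits. *)
Lemma bnd_limit H f c :
  (forall (l : seq E) (eps : R), 0 < eps -> exists g, bnd H g c /\
     forall e, e \in l -> cabs (f e - g e) <= eps) ->
  bnd H f c.
Proof.
move=> hlim u s t eta xi hs ht.
pose M := \sum_(x <- s) \sum_(y <- t) cabs (eta x) * cabs (xi y).
have M0 : 0 <= M.
  by apply: sumr_ge0 => x _; apply: sumr_ge0 => y _; rewrite mulr_ge0 ?cabs_ge0.
apply/ler_addgt0Pr => eps eps0.
(* The error in twice the form is at most 2 M d; the added 1 avoids division by 0. *)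
pose d := eps / (2 * (M + 1)); have d0 : 0 < d by rewrite divr_gt0 // mulr_gt0 // ltr_wpDl.
have [g [hg fg]] := hlim [seq gmul x (ginv y) | x <- s, y <- t] d d0.
have := hg u s t eta xi hs ht.
have -> : form f s t eta xi = form g s t eta xi + form (fun e => f e - g e) s t eta xi.
  rewrite -formD; apply: eq_bigr => x _; apply: eq_bigr => y _.
  by congr (_ * (_ * _)); rewrite addrC subrK.
have : cre (form (fun e => f e - g e) s t eta xi) <= M * d.
  apply: (le_trans (cre_le _)); apply: (le_trans (cabs_sum _ _)).
  rewrite /M mulr_suml big_seq [leRHS]big_seq; apply: ler_sum => x xs.
  apply: (le_trans (cabs_sum _ _)).
  rewrite mulr_suml big_seq [leRHS]big_seq; apply: ler_sum => y yt.
  rewrite !cabsM cabs_conj -mulrA ler_wpM2l ?cabs_ge0 // mulrC ler_wpM2l ?cabs_ge0 //.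
  by apply: fg; apply/allpairsP; exists (x, y).
have dE : 2 * (M * d) + 2 * d = eps.
  by rewrite /d; field; apply/lt0r_neq0/ltr_wpDl.
rewrite creD mulrDr => h1 h2; lra.
Qed.

Lemma dedup_fibre (L : seq E) : exists W : seq E,
  [/\ {subset W <= L}, uniq (map pi W) & {subset map pi L <= map pi W}].
Proof.
elim: L => [|x L [W [WL uW LW]]]; first by exists [::].
have [xW|xW] := boolP (pi x \in map pi W).
  exists W; split => // [w /WL|g]; first by rewrite inE orbC => ->.
  by rewrite inE => /orP[/eqP ->|/LW].
exists (x :: W); split => [w||g] /=; rewrite ?xW //.
  by rewrite !inE => /orP[->|/WL ->] //; rewrite orbT.
by rewrite !inE => /orP[->|/LW ->] //; rewrite orbT.
Qed.

(** The points sought are products v y, where v represents the support of [g] in the source fibre at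
    [rng y]. *)
Lemma conv_support_list g u t : Cc setT g -> (forall y, y \in t -> src y = u) ->
  exists W, fibre_seq setT u W /\ forall w y, src w = u -> y \in t ->
    g (gmul w (ginv y)) != 0 -> pi w \in map pi W.
Proof.
move=> cg tu; have /choice[V hV] := fun y => Cc_fibre etG (rng y) cg.
pose L := flatten [seq [seq gmul v y | v <- V y] | y <- t].
have Lu w : w \in L -> src w = u.
  move=> /flatten_mapP[y yt /mapP[v vV ->]].
  by have [V1 _ _] := hV y; rewrite src_gmul ?(tu _ yt) ?(V1 _ vV).
have [W [WL uW LW]] := dedup_fibre L; exists W; split.
  by split => // w /WL /Lu.
move=> w y wu yt ne; apply: LW; have [V1 V2 V3] := hV y.
have yu := tu _ yt; have wy : src w = src y by rewrite wu yu.
have := V3 (gmul w (ginv y)); rewrite src_gmul ?rng_ginv ?src_ginv // => /(_ erefl ne).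
move=> /mapP[v vV wv]; have vy : src v = rng y by exact: V1.
have -> : pi w = pi (gmul v y).
  rewrite -[w](gmulgVK wy) proj_mul; last by grpd.
  by rewrite wv -proj_mul.
by apply: map_f; apply/flatten_mapP; exists y => //; exact: map_f.
Qed.

Lemma sqnorm_form g s t eta xi :
  (forall x, x \in s -> eta x = \sum_(y <- t) g (gmul x (ginv y)) * xi y) ->
  cre (form g s t eta xi) = sqnorm s eta.
Proof.
move=> h; rewrite form_row cre_sum /sqnorm big_seq [RHS]big_seq.
by apply: eq_bigr => x xs; rewrite -(h _ xs) mul_conj.
Qed.

(** Testing the form with the image vector [eta] itself and weight 1/c gives 2 |eta|^2 <= |eta|^2 +
    c^2 |xi|^2. *)
Lemma bnd_sqnorm H g c u s t eta xi : 0 < c -> bnd H g c ->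
  fibre_seq H u s -> fibre_seq H u t ->
  (forall x, x \in s -> eta x = \sum_(y <- t) g (gmul x (ginv y)) * xi y) ->
  sqnorm s eta <= c ^+ 2 * sqnorm t xi.
Proof.
move=> c0 hg hs ht h; have ci0 : 0 < c^-1 by rewrite invr_gt0.
have := bnd_scaled eta xi ci0 hg hs ht; rewrite (sqnorm_form h) invrK.
rewrite mulrDr mulrA mulfV ?lt0r_neq0 // mul1r mulrA -expr2; lra.
Qed.

Lemma bnd_conv f g c d : 0 < c -> 0 < d -> equivariant f -> Cc setT g ->
  bnd setT f c -> bnd setT g d -> bnd setT (conv f g) (c * d).
Proof.
move=> c0 d0 ef cg hf hg u s t eta xi hs ht.
have tu y : y \in t -> src y = u by move=> /ht.1 [].
have [W [hW cov]] := conv_support_list cg tu.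
pose zeta w := \sum_(y <- t) g (gmul w (ginv y)) * xi y.
have -> : form (conv f g) s t eta xi = form f s W eta zeta.
  rewrite !form_row; apply: eq_big_seq => x /hs.1 [xu _].
  congr (_ * _); under [RHS]eq_bigr do rewrite mulr_sumr.
  rewrite exchange_big /=; apply: eq_big_seq => y yt.
  rewrite (convE (W := W) ef (Cc_equivariant cg)) ?xu ?(tu _ yt) //.
  - by rewrite mulr_suml; apply: eq_bigr => w _; rewrite mulrA.
  - by move=> w /hW.1 [].
  - by case: hW.
  - move=> w wu ne; apply: (cov w y) => //.
    by apply: contra_neq ne => ->; rewrite mulr0.
(* The weight [d] compensates the factor d^2 of [h2], so that both squares receive the coefficient c
   d. *)
have h1 := bnd_scaled eta zeta d0 hf hs hW.
have h2 : sqnorm W zeta <= d ^+ 2 * sqnorm t xi by apply: (bnd_sqnorm d0 hg hW ht).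
apply: (le_trans h1); rewrite -mulrA ler_wpM2l ?(ltW c0) // mulrDr lerD2l.
by rewrite ler_pdivrMl // mulrA -expr2.
Qed.

Lemma proj_divr_inj x y w : src x = src w -> src y = src w ->
  pi (gmul x (ginv w)) = pi (gmul y (ginv w)) -> pi x = pi y.
Proof.
move=> xw yw /(congr1 (fun k => gmul k (pi w))).
by rewrite -!proj_mul ?src_gmul ?rng_ginv ?src_ginv // !gmulgVK.
Qed.

(** Right translation by x^-1 injects the points counted into the circle orbits that meet [K] over
    the source [rng x]. *)
Lemma count_fibre (K : set E) : compact K -> exists N, forall u x t,
  src x = u -> fibre_seq setT u t ->
  (size [seq y <- t | `[< K (gmul y (ginv x)) >]] <= N)%N.
Proof.
move=> cK; have [N hN] := fibre_finite etG cK; exists N => u x t xu [tu ut].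
have [W [sW [W1 W2 W3]]] := hN (rng x); apply: leq_trans sW.
rewrite -(size_map pi W) -(size_map (fun y => pi (gmul y (ginv x)))).
apply: uniq_leq_size.
  rewrite map_inj_in_uniq; first by apply: filter_uniq; exact: map_uniq ut.
  move=> y y'; rewrite !mem_filter => /andP[_ yt] /andP[_ y't] e.
  have [yu _] := tu _ yt; have [y'u _] := tu _ y't.
  by apply: (uniq_map_inj ut) => //; apply: proj_divr_inj e; rewrite ?yu ?y'u.
move=> _ /mapP[y + ->]; rewrite mem_filter => /andP[/asboolP Ky /tu [yu _]].
by apply: W3 => //; rewrite src_gmul ?src_ginv ?rng_ginv ?yu.
Qed.

Lemma sum_le_count (I : eqType) (r : seq I) (P : pred I) (F : I -> R) (M : R) :
  0 <= M -> (forall i, F i <= M) -> (forall i, i \in r -> ~~ P i -> F i = 0) ->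
  \sum_(i <- r) F i <= M * (size [seq i <- r | P i])%:R.
Proof.
move=> M0 FM; elim: r => [|i r IH] F0; first by rewrite big_nil mulr0.
have {}IH := IH (fun j jr => F0 j (mem_behead (s := i :: r) jr)).
rewrite big_cons /=; case: ifPn => [Pi|/(F0 _ (mem_head _ _)) ->]; last by rewrite add0r.
by rewrite /= -addn1 natrD mulrDr mulr1 addrC lerD.
Qed.

(** Schur test: 2 |ab| <= |a|^2 + |b|^2 reduces the form to row and column sums of |f(x y^-1)|,
    which have boundedly many non-zero terms. *)
Lemma Cc_bnd f : Cc setT f -> exists2 c : R, 0 < c & bnd setT f c.
Proof.
move=> cf; have [M M0 fM] := Cc_bounded cf; have /CcP[_ _ [K cK fK]] := cf.
have [N1 hN1] := count_fibre cK; have [N2 hN2] := count_fibre (ginv_compact cK).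
(* [N1] bounds the columns and [N2] the rows; the added 1 makes the constant positive. *)
have cpos : 0 < M * (N1 + N2 + 1)%:R by rewrite mulr_gt0 // ltr0n addn1.
exists (M * (N1 + N2 + 1)%:R) => // u s t eta xi hs ht.
pose F x y := cabs (f (gmul x (ginv y))).
have le1 : 2 * cre (form f s t eta xi) <=
    \sum_(x <- s) \sum_(y <- t) (csq (eta x) * F x y + csq (xi y) * F x y).
  rewrite cre_sum mulr_sumr; apply: ler_sum => x _.
  rewrite cre_sum mulr_sumr; apply: ler_sum => y _.
  have := cre_le (conjc (eta x) * (f (gmul x (ginv y)) * xi y)).
  rewrite !cabsM cabs_conj -/(F x y) /csq; have : 0 <= F x y by exact: cabs_ge0.
  have := sqr_ge0 (cabs (eta x) - cabs (xi y)); nra.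
apply: (le_trans le1); under eq_bigr do rewrite big_split -mulr_sumr.
rewrite big_split /= [X in _ + X]exchange_big /=.
under [X in _ + X]eq_bigr do rewrite -mulr_sumr.
rewrite mulrDr /sqnorm !mulr_sumr; apply: lerD.
- rewrite big_seq [leRHS]big_seq; apply: ler_sum => x /hs.1 [xu _].
  rewrite mulrC ler_wpM2r ?csq_ge0 //.
  apply: (le_trans (@sum_le_count _ t (fun y => `[< (@ginv E @` K) (gmul y (ginv x)) >]) _ M _ _ _)).
  + exact: ltW.
  + by move=> y; exact: fM.
  + move=> y /ht.1 [yu _] /asboolPn nK; apply/eqP/negPn/negP => Fne.
    apply: nK; exists (gmul x (ginv y)); last by rewrite ginvMV ?xu ?yu.
    by apply: fK; apply: contra_neq Fne => h; rewrite /F h cabs0.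
  + rewrite ler_pM2l // ler_nat (leq_trans (hN2 _ _ _ xu ht)) //.
    by rewrite addnAC leq_addl.
- rewrite big_seq [leRHS]big_seq; apply: ler_sum => y /ht.1 [yu _].
  rewrite mulrC ler_wpM2r ?csq_ge0 //.
  apply: (le_trans (@sum_le_count _ s (fun x => `[< K (gmul x (ginv y)) >]) _ M _ _ _)).
  + exact: ltW.
  + by move=> x; exact: fM.
  + move=> x /hs.1 [xu _] /asboolPn nK; apply/eqP/negPn/negP => Fne.
    by apply: nK; apply: fK; apply: contra_neq Fne => h; rewrite /F h cabs0.
  + rewrite ler_pM2l // ler_nat (leq_trans (hN1 _ _ _ yu hs)) //.
    by rewrite -addnA leq_addr.
Qed.

Lemma fibre_seq_filter H u s (P : pred E) : fibre_seq H u s ->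
  fibre_seq H u [seq x <- s | P x].
Proof.
move=> [su us]; split=> [x|]; first by rewrite mem_filter => /andP[_ /su].
by apply: subseq_uniq us; apply: map_subseq; exact: filter_subseq.
Qed.

Lemma sqnorm_split s eta (P : pred E) : sqnorm s eta =
  sqnorm [seq x <- s | P x] eta + sqnorm [seq x <- s | ~~ P x] eta.
Proof. by rewrite /sqnorm !big_filter (bigID P). Qed.

Section Subgroupoid.
Variable S : set G.
Hypothesis subS : subgroupoid S.

Lemma bnd_weaken f c : bnd setT f c -> bnd S f c.
Proof.
move=> hf u s t eta xi [hs us] [ht ut].
by apply: (hf u) => //; split=> // x; [case/hs|case/ht].
Qed.

(* The S-orbits in a source fibre of G decompose the regular representation of
   a function supported on S into copies of those of S. *)
Lemma bnd_extend f c : 0 <= c -> vanishes_off (restr E S) f -> bnd S f c ->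
  bnd setT f c.
Proof.
move=> c0 vf hf u s t eta xi.
elim: {s}(size s) {-2}s (leqnn (size s)) t => [|n IH] s sn t hs ht.
  move: sn; rewrite leqn0 => /nilP ->; rewrite /form big_nil mulr0.
  by rewrite mulr_ge0 // addr_ge0 ?sqnorm_ge0.
case: s sn hs => [|x0 s] sn hs; first exact: IH.
have x0u : src x0 = u by apply: (hs.1 x0 (mem_head _ _)).1.
(* If the range of [x0] is not in [S], the row of [x0] vanishes, since a non-zero f(x0 y^-1) would
   put [rng x0] in [restr E S]. *)
have [Sx0|nSx0] := pselect (restr E S (rng x0)); last first.
  have hs' : fibre_seq setT u s.
    split; last by case: hs => _ /= /andP[].
    by move=> x xs; apply: hs.1; rewrite inE xs orbT.
  have row0 : \sum_(y <- t) f (gmul x0 (ginv y)) * xi y = 0.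
    apply: big1_seq => y /andP[_ /ht.1 [yu _]].
    rewrite vf ?mul0r // => Sxy; apply: nSx0.
    by have := restr_rng subS Sxy; rewrite rng_gmul // rng_ginv x0u yu.
  have := IH s sn t hs' ht; rewrite !form_row big_cons row0 mulr0 add0r.
  move=> h; apply: (le_trans h); rewrite ler_wpM2l // lerD2r /sqnorm big_cons.
  by rewrite lerDr csq_ge0.
(* [P] selects the S-orbit of [x0]. The kernel vanishes between different orbits, so the form
   splits, and the induction hypothesis covers the rest. *)
pose P x := `[< restr E S (gmul x (ginv x0)) >].
have Pcross x y : src x = u -> src y = u -> P x != P y -> f (gmul x (ginv y)) = 0.
  move=> xu yu Pxy; apply: vf => Sxy.
  have Syx : restr E S (gmul y (ginv x)).
    by rewrite -ginvMV ?xu ?yu //; exact: restr_ginv.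
  move/negP: Pxy; apply; apply/eqP; apply: asbool_equiv_eq; split=> h.
  - rewrite -(@gmulVM _ y x x0) ?xu ?yu ?x0u //; apply: restr_gmul => //.
    by grpd.
  - rewrite -(@gmulVM _ x y x0) ?xu ?yu ?x0u //; apply: restr_gmul => //.
    by grpd.
have formS : form f (x0 :: s) t eta xi =
    form f [seq x <- x0 :: s | P x] [seq y <- t | P y] eta xi +
    form f [seq x <- x0 :: s | ~~ P x] [seq y <- t | ~~ P y] eta xi.
  rewrite {1}/form (bigID P); congr (_ + _).
  - rewrite /form big_filter big_seq_cond [RHS]big_seq_cond.
    apply: eq_bigr => x /andP[/hs.1 [xu _] /= Px].
    rewrite (bigID P) /= big_filter [X in _ + X]big1_seq ?addr0 // => y /andP[nPy /ht.1 [yu _]].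
    by rewrite (Pcross x y) ?mul0r ?mulr0 // Px (negbTE nPy).
  - rewrite /form big_filter big_seq_cond [RHS]big_seq_cond.
    apply: eq_bigr => x /andP[/hs.1 [xu _] /= nPx].
    rewrite (bigID P) /= big_filter big1_seq ?add0r // => y /andP[Py /ht.1 [yu _]].
    by rewrite (Pcross x y) ?mul0r ?mulr0 // Py (negbTE nPx).
have Px0 : P x0 by apply/asboolP; rewrite gmulV.
have sz : (size [seq x <- x0 :: s | ~~ P x] <= n)%N.
  by rewrite /= Px0 /= size_filter (leq_trans (count_size _ _)).
have h2 := IH _ sz _ (fibre_seq_filter (fun x => ~~ P x) hs)
  (fibre_seq_filter (fun x => ~~ P x) ht).
suff h1 : 2 * cre (form f [seq x <- x0 :: s | P x] [seq y <- t | P y] eta xi) <=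
    c * (sqnorm [seq x <- x0 :: s | P x] eta + sqnorm [seq y <- t | P y] xi).
  rewrite formS creD (sqnorm_split (x0 :: s) eta P) (sqnorm_split t xi P); lra.
(* Right translation by x0^-1 carries the orbit into the source fibre of [S] at [rng x0] and leaves
   the products x y^-1 unchanged. *)
pose T x := gmul x (ginv x0).
have TS r : fibre_seq setT u r -> fibre_seq S (rng x0) [seq T x | x <- r & P x].
  move=> hr; split=> [_ /mapP[x + ->]|].
    rewrite mem_filter => /andP[/asboolP Sx /hr.1 [xu _]]; split => //.
    by rewrite /T; grpd.
  rewrite -map_comp map_inj_in_uniq.
    by have [_ /map_uniq] := fibre_seq_filter P hr.
  move=> x y xs ys /= Txy; apply: (uniq_map_inj (fibre_seq_filter P hr).2 xs ys).
  have [xu _] := (fibre_seq_filter P hr).1 _ xs.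
  have [yu _] := (fibre_seq_filter P hr).1 _ ys.
  by apply: proj_divr_inj Txy; rewrite ?xu ?yu x0u.
have := hf (rng x0) _ _ (fun x => eta (gmul x x0)) (fun x => xi (gmul x x0)) (TS _ hs) (TS _ ht).
have TK x : src x = u -> gmul (T x) x0 = x by move=> xu; rewrite gmulgVK ?xu.
have sqT r g : fibre_seq setT u r ->
    sqnorm [seq T x | x <- r & P x] (fun x => g (gmul x x0)) = sqnorm [seq x <- r | P x] g.
  move=> hr; rewrite /sqnorm big_map; apply: eq_big_seq => x.
  by move=> /(fibre_seq_filter P hr).1 [xu _]; rewrite TK.
rewrite !sqT // => h; congr (_ * cre _ <= _): h.
rewrite /form big_map; apply: eq_big_seq => x.
move=> /(fibre_seq_filter P hs).1 [xu _]; rewrite TK //.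
rewrite big_map; apply: eq_big_seq => y.
move=> /(fibre_seq_filter P ht).1 [yu _]; rewrite TK //.
by rewrite /T ginvMV ?yu // gmulVM // ?xu ?yu.
Qed.

(** On source fibres of [S] the functions [f] and [cut S f] have the same forms; [bnd_extend]
    carries the bound back to [G]. *)
Lemma bnd_cut f c : 0 <= c -> bnd setT f c -> bnd setT (cut S f) c.
Proof.
move=> c0 hf; apply: bnd_extend => //; first by move=> e; exact: cut_out.
move=> u s t eta xi hs ht; have := bnd_weaken hf eta xi hs ht.
have -> // : form (cut S f) s t eta xi = form f s t eta xi.
apply: eq_big_seq => x /hs.1 [xu Sx]; apply: eq_big_seq => y /ht.1 [yu Sy].
rewrite cutE //; apply: restr_gmul => //; first by grpd.
exact: restr_ginv.
Qed.

End Subgroupoid.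

(** * Comparison of [bnd] with the operator norm [rnorm] *)

Lemma csq_proj f x y : equivariant f -> pi x = pi y -> csq (f x) = csq (f y).
Proof.
move=> ef /phase [z hz ->]; rewrite ef // csqM /csq.
by rewrite (circleP z).1 // expr1n mul1r.
Qed.

Lemma l2norm_leP H u xi (r : R) : 0 <= r -> units u -> equivariant xi ->
  (l2norm H (pi u) xi <= r%:E)%E <->
  forall s, fibre_seq H u s -> sqnorm s xi <= r ^+ 2.
Proof.
move=> r0 hu exi; pose F (g : G) := csq (xi (rep E g)).
have FE : (fun g : G => (Normc.normc (xi (rep E g)) ^+ 2)%:E) = (fun g : G => (F g)%:E).
  by apply/funext.
rewrite /l2norm FE; set A := [set g : G | _]; set S := esum _ _.
have S0 : (0 <= S)%E by apply: esum_ge0 => g _; rewrite lee_fin csq_ge0.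
have -> : (sqrte S <= r%:E)%E <-> (S <= (r ^+ 2)%:E)%E.
  move: S0; case: S => [a| |] //; rewrite !lee_fin => a0.
  rewrite -(@ler_pXn2r _ 2) ?nnegrE ?sqrtr_ge0 //.
  by rewrite sqr_sqrtr.
split=> [Sr s [hs us]|hs].
  rewrite -lee_fin; apply: le_trans Sr; apply: esum_ge.
  exists [set` map pi s].
    split; first exact: finite_seq.
    by move=> _ /mapP[x /hs [xu Hx] ->]; split => //; rewrite -xu proj_src.
  rewrite -fsbig_seq // big_map sumEFin lee_fin; apply: ler_sum => x _.
  by rewrite /F (@csq_proj xi _ x) // rep_proj.
apply: ge_ereal_sup => _ [X [fX XA] <-].
rewrite fsbig_finite // sumEFin lee_fin.
have := hs [seq rep E v | v <- fset_set X]; rewrite /sqnorm big_map; apply.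
split=> [_ /mapP[v + ->]|].
  rewrite in_fset_set // inE => /XA [Hg gu]; rewrite rep_proj; split => //.
  by apply: proj_unit_inj => //; [exact: units_srcE|rewrite proj_src rep_proj].
rewrite -map_comp (eq_map (g := id)) ?map_id ?fset_uniq // => g.
by rewrite /= rep_proj.
Qed.

Lemma conv_left_list f u s : Cc setT f -> (forall x, x \in s -> src x = u) ->
  exists W, fibre_seq setT u W /\ forall w x, src w = u -> x \in s ->
    f (gmul x (ginv w)) != 0 -> pi w \in map pi W.
Proof.
move=> cf su; have [W [hW cov]] := conv_support_list (Cc_star cf) su.
exists W; split => // w x wu xs ne; apply: (cov w x) => //.
by rewrite /starf ginvMV ?wu ?(su _ xs) // conjc_eq0.
Qed.

(** The basis vector at [y]: the equivariant function carried by the circle orbit of [y] with value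
    1 at [y]. *)
Definition orbit_delta y e : C :=
  if pselect (exists z, circle z /\ e = tact z y) is left h then sval (cid h) else 0.

Lemma orbit_deltaE y z : circle z -> orbit_delta y (tact z y) = z.
Proof.
move=> hz; rewrite /orbit_delta; case: pselect => [h|[]]; last by exists z.
by case: cid => w /= [hw /(tact_inj hz hw)].
Qed.

Lemma orbit_delta0 y e : pi e <> pi y -> orbit_delta y e = 0.
Proof.
move=> ne; rewrite /orbit_delta; case: pselect => // -[z [hz ez]].
by case: ne; rewrite ez proj_tact.
Qed.

Lemma orbit_delta_equivariant y : equivariant (orbit_delta y).
Proof.
move=> z e hz; have [|ne] := pselect (pi y = pi e).
  by move=> /phase [w hw ->]; rewrite tactA // !orbit_deltaE //; exact: circleM.
by rewrite !orbit_delta0 ?mulr0 // ?proj_tact // => h; apply: ne.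
Qed.

Definition extension t xi e : C := \sum_(y <- t) xi y * orbit_delta y e.

Lemma extension_equivariant t xi : equivariant (extension t xi).
Proof.
move=> z e hz; rewrite /extension mulr_sumr; apply: eq_bigr => y _.
by rewrite orbit_delta_equivariant // mulrCA.
Qed.

Lemma extension0 t xi e : pi e \notin map pi t -> extension t xi e = 0.
Proof.
move=> et; apply: big1_seq => y /andP[_ yt]; rewrite orbit_delta0 ?mulr0 // => h.
by move/negP: et; apply; rewrite h; exact: map_f.
Qed.

Lemma extensionE t xi y : uniq (map pi t) -> y \in t -> extension t xi y = xi y.
Proof.
move=> ut yt; rewrite /extension (bigD1_seq y) //=; last exact: map_uniq ut.
have -> : orbit_delta y y = 1.
  by rewrite -[X in orbit_delta y X]tact1 orbit_deltaE //; exact: circle1.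
rewrite mulr1.
rewrite big1_seq ?addr0 // => x /andP[xy xt]; rewrite orbit_delta0 ?mulr0 // => h.
by move/eqP: xy; apply; apply: (uniq_map_inj ut).
Qed.

Lemma sqnorm_extension t xi s u : fibre_seq setT u t -> fibre_seq setT u s ->
  sqnorm s (extension t xi) <= sqnorm t xi.
Proof.
move=> [tu ut] [su us]; pose F (g : G) := csq (extension t xi (rep E g)).
have sqF r : sqnorm r (extension t xi) = \sum_(v <- map pi r) F v.
  rewrite big_map; apply: eq_bigr => x _; apply: csq_proj.
    exact: extension_equivariant.
  by rewrite rep_proj.
have -> : sqnorm t xi = sqnorm t (extension t xi).
  by apply: eq_big_seq => y yt; rewrite extensionE.
rewrite !sqF (bigID (fun v => v \in map pi t)) /= [X in _ + X]big1 ?addr0; last first.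
  by move=> g gt; rewrite /F extension0 ?csq0 // rep_proj.
rewrite -big_filter (perm_big [seq v <- map pi t | v \in map pi s]); last first.
  apply: uniq_perm; rewrite ?filter_uniq // => g.
  by rewrite !mem_filter andbC.
rewrite big_filter [leRHS](bigID (fun v => v \in map pi s)) /= lerDl.
by apply: sumr_ge0 => g _; exact: csq_ge0.
Qed.

(** On a finite list, [conv f xi] depends on finitely many values of [xi], so [bnd_sqnorm] bounds
    every partial sum of its norm. *)
Lemma bnd_rnorm H f c : 0 < c -> Cc setT f -> bnd H f c -> (rnorm H f <= c%:E)%E.
Proof.
move=> c0 cf hf; have ef := Cc_equivariant cf.
apply: ge_ereal_sup => _ [->|[v [Hv uv] <-]]; first by rewrite lee_fin ltW.
pose u := src (rep E v); have uu : units u := units_srcE _.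
have uE : pi u = v by rewrite /u proj_src rep_proj units_src.
apply: ge_ereal_sup => _ [xi [[vxi exi _] xi1] <-].
move: xi1; rewrite -uE => /(l2norm_leP _ ler01 uu exi) xi1.
apply/(l2norm_leP _ (ltW c0) uu (conv_equivariant f exi)) => s hs.
have su x : x \in s -> src x = u by move=> /hs.1 [].
have [W [[W1 W2] cov]] := conv_left_list cf su.
pose W' := [seq w <- W | `[< H (pi w) >]].
have hW' : fibre_seq H u W'.
  split=> [w|]; first by rewrite mem_filter => /andP[/asboolP Hw /W1 [wu _]].
  by apply: subseq_uniq W2; apply: map_subseq; exact: filter_subseq.
have := @bnd_sqnorm H f c u s W' (conv f xi) xi c0 hf hs hW'.
have := xi1 _ hW'; rewrite expr1n => h1 h2.
apply: (le_trans (h2 _)); last by rewrite ler_piMr // sqr_ge0.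
move=> x xs; have xu := su _ xs.
rewrite (@conv_src _ _ _ f xi x W) // => [|w /W1 [wu _]|w wx ne]; last 2 first.
- by rewrite wu.
- apply: (cov w x) => //; first by rewrite wx.
  by apply: contra_neq ne => ->; rewrite mul0r.
rewrite /W' big_filter [LHS](bigID (fun w => `[< H (pi w) >])) /=.
rewrite [X in _ + X]big1 ?addr0 // => w /asboolPn nH.
by rewrite vxi ?mulr0 // => -[].
Qed.

(** Finite data extend to an equivariant vector, which is normalised to lie in the unit ball of
    [opnorm]. A non-zero vector makes [t] non-empty, and this puts the unit of the fibre in [H]. *)
Lemma rnorm_bnd H f c : 0 < c -> subgroupoid H -> Cc setT f ->
  (rnorm H f <= c%:E)%E -> bnd H f c.
Proof.
move=> c0 sH cf hf u s t eta xi hs ht; have ef := Cc_equivariant cf.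
pose X := sqnorm t xi; have X0 : 0 <= X := sqnorm_ge0 t xi.
have tT : fibre_seq setT u t by case: ht => h1 h2; split => // x /h1 [].
pose zeta x := \sum_(y <- t) f (gmul x (ginv y)) * xi y.
suff zb : sqnorm s zeta <= c ^+ 2 * X.
  have : 2 * cre (form f s t eta xi) <= c * sqnorm s eta + c^-1 * sqnorm s zeta.
    rewrite form_row cre_sum /sqnorm !mulr_sumr -big_split; apply: ler_sum => x _ /=.
    have := cre_le (conjc (eta x) * zeta x); rewrite cabsM cabs_conj /csq.
    set a := cabs (eta x); set b := cabs (zeta x).
    have : 0 <= (c * a - b) ^+ 2 / c by rewrite divr_ge0 ?sqr_ge0 ?ltW.
    have -> : (c * a - b) ^+ 2 / c = c * a ^+ 2 + c^-1 * b ^+ 2 - 2 * (a * b).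
      by field; exact: lt0r_neq0.
    by rewrite -/(zeta x); lra.
  move=> h; apply: (le_trans h); rewrite mulrDr lerD2l.
  by rewrite ler_pdivrMl // mulrA -expr2.
have [X00|Xn0] := eqVneq X 0.
  rewrite X00 mulr0 /sqnorm big1_seq // => x _; rewrite /zeta big1_seq ?csq0 //.
  move=> y /andP[_ yt]; suff -> : xi y = 0 by rewrite mulr0.
  apply: csq_eq0; apply/eqP; rewrite eq_le csq_ge0 andbT -X00 /X /sqnorm.
  rewrite (bigD1_seq y) //=; last by have [_ /map_uniq] := ht.
  by rewrite lerDl; apply: sumr_ge0 => w _; exact: csq_ge0.
have Xp : 0 < X by rewrite lt_neqAle eq_sym Xn0.
have /hasP[y0 y0t _] : has predT t.
  by rewrite has_predT lt0n; apply: contra_neq Xn0 => /size0nil t0; rewrite /X t0 /sqnorm big_nil.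
have [y0u Hy0] := ht.1 _ y0t.
have uu : units u by rewrite -y0u; exact: units_srcE.
have Hu : H (pi u).
  by rewrite -y0u proj_src -gmulVg; apply: sH.1 => //; [exact: sH.2|rewrite src_ginv].
pose a : R := (Num.sqrt X)^-1.
have aX : a ^+ 2 * X = 1 by rewrite /a exprVn sqr_sqrtr // mulVf.
pose xi1 e := (a%:C%C : C) * extension t xi e.
have exi1 : equivariant xi1.
  by move=> z e hz; rewrite /xi1 extension_equivariant // mulrCA.
have sq1 r : sqnorm r xi1 = a ^+ 2 * sqnorm r (extension t xi).
  by rewrite /sqnorm mulr_sumr; apply: eq_bigr => w _; rewrite csqM csq_real.
have n1 : (l2norm H (pi u) xi1 <= 1%:E)%E.
  apply/(l2norm_leP _ ler01 uu exi1) => r [hr ur].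
  rewrite sq1 expr1n -aX ler_wpM2l ?sqr_ge0 //.
  by apply: (@sqnorm_extension _ _ _ u) => //; split => // w /hr [].
have xi1_0 e : xi1 e != 0 -> pi e \in map pi t.
  by move=> ne; apply: contraT => /extension0 h; rewrite /xi1 h mulr0 eqxx in ne.
have ell1 : ell2 H (pi u) xi1.
  split => //; last by apply: le_lt_trans n1 _; rewrite ltry.
  move=> e he; apply/eqP/negPn/negP => /xi1_0 /mapP[y yt ey]; apply: he.
  by have [yu Hy] := ht.1 _ yt; rewrite /restr /= proj_src ey -proj_src yu.
have le1 : (l2norm H (pi u) (conv f xi1) <= c%:E)%E.
  apply: le_trans hf; apply: le_trans (ereal_sup_ubound _); last first.
    by right; exists (pi u); [split => //; exact: units_proj|reflexivity].
  by apply: ereal_sup_ubound; exists xi1.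
have := (l2norm_leP _ (ltW c0) uu (conv_equivariant f exi1)).1 le1 s hs.
have -> : sqnorm s (conv f xi1) = a ^+ 2 * sqnorm s zeta.
  rewrite /sqnorm mulr_sumr; apply: eq_big_seq => x /hs.1 [xu _].
  rewrite -csq_real -csqM; congr csq; rewrite (@conv_src _ _ _ f xi1 x t) //.
  - rewrite /zeta mulr_sumr; apply: eq_big_seq => y yt.
    by rewrite /xi1 extensionE //; [ring|case: ht].
  - by move=> w /ht.1 [wu _]; rewrite wu.
  - by case: ht.
  - move=> w wx ne; apply: xi1_0; apply: contra_neq ne => ->.
    by rewrite mulr0.
by rewrite -(ler_pM2l Xp) mulrA [X * _]mulrC aX mul1r mulrC.
Qed.

(** * Algebraic laws of convolution and involution *)

Lemma conv_list_r g u : Cc setT g ->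
  exists W : seq E, forall f e, equivariant f -> src e = u ->
    conv f g e = \sum_(w <- W) f (gmul e (ginv w)) * g w.
Proof.
move=> cg; have [W hW] := Cc_fibre etG u cg; exists W => f e ef eu.
by apply: conv_Cc_src => //; [exact: Cc_equivariant|rewrite eu].
Qed.

(** Here the sum is finite because of the left factor, so [g] may be any equivariant function. *)
Lemma conv_list_l f e : Cc setT f ->
  exists W : seq E, forall g, equivariant g ->
    conv f g e = \sum_(w <- W) f (gmul e (ginv w)) * g w.
Proof.
move=> cf; have [|W [[W1 W2] cov]] := conv_left_list (u := src e) (s := [:: e]) cf.
  by move=> x; rewrite inE => /eqP ->.
exists W => g eg; apply: conv_src => // [|w /W1 [] //|w we ne].
  exact: Cc_equivariant.
apply: (cov w e) => //; first by rewrite mem_head.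
by apply: contra_neq ne => ->; rewrite mul0r.
Qed.

Lemma convDl f1 f2 g : equivariant f1 -> equivariant f2 -> Cc setT g ->
  conv (fun e => f1 e + f2 e) g = (fun e => conv f1 g e + conv f2 g e).
Proof.
move=> e1 e2 cg; apply/funext => e; have [W hW] := conv_list_r (src e) cg.
rewrite !hW // -?big_split => [|z x hz]; last by rewrite e1 // e2 // mulrDr.
by apply: eq_bigr => w _; rewrite mulrDl.
Qed.

Lemma convDr f g1 g2 : Cc setT f -> equivariant g1 -> equivariant g2 ->
  conv f (fun e => g1 e + g2 e) = (fun e => conv f g1 e + conv f g2 e).
Proof.
move=> cf e1 e2; apply/funext => e; have [W hW] := conv_list_l e cf.
rewrite !hW // -?big_split => [|z x hz]; last by rewrite e1 // e2 // mulrDr.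
by apply: eq_bigr => w _; rewrite mulrDr.
Qed.

Lemma convZl k f g : equivariant f -> Cc setT g ->
  conv (fun e => k * f e) g = (fun e => k * conv f g e).
Proof.
move=> ef cg; apply/funext => e; have [W hW] := conv_list_r (src e) cg.
rewrite !hW // ?mulr_sumr => [|z x hz]; last by rewrite ef // mulrCA.
by apply: eq_bigr => w _; rewrite mulrA.
Qed.

Lemma convZr k f g : Cc setT f -> equivariant g ->
  conv f (fun e => k * g e) = (fun e => k * conv f g e).
Proof.
move=> cf eg; apply/funext => e; have [W hW] := conv_list_l e cf.
rewrite !hW // ?mulr_sumr => [|z x hz]; last by rewrite eg // mulrCA.
by apply: eq_bigr => w _; rewrite mulrCA.
Qed.

Lemma equivariantZ k f : equivariant f -> equivariant (fun e => k * f e).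
Proof. by move=> ef z e hz; rewrite ef // mulrCA. Qed.

Lemma fun_sub_add f g : (fun e => f e - g e) = (fun e => f e + (-1) * g e).
Proof. by apply/funext => e; rewrite mulN1r. Qed.

Lemma convBl f1 f2 g : equivariant f1 -> equivariant f2 -> Cc setT g ->
  conv (fun e => f1 e - f2 e) g = (fun e => conv f1 g e - conv f2 g e).
Proof.
move=> e1 e2 cg; rewrite fun_sub_add convDl //; last exact: equivariantZ.
by rewrite convZl // fun_sub_add.
Qed.

Lemma convBr f g1 g2 : Cc setT f -> equivariant g1 -> equivariant g2 ->
  conv f (fun e => g1 e - g2 e) = (fun e => conv f g1 e - conv f g2 e).
Proof.
move=> cf e1 e2; rewrite fun_sub_add convDr //; last exact: equivariantZ.
by rewrite convZr // fun_sub_add.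
Qed.

Lemma conv0l g : Cc setT g -> conv (fun=> 0) g = (fun=> 0).
Proof.
move=> cg; apply/funext => e; have [W hW] := conv_list_r (src e) cg.
by rewrite hW // => [|z x _]; [rewrite big1 // => w _; rewrite mul0r|rewrite mulr0].
Qed.

Lemma conv0r f : Cc setT f -> conv f (fun=> 0) = (fun=> 0).
Proof.
move=> cf; apply/funext => e; have [W hW] := conv_list_l e cf.
by rewrite hW // => [|z x _]; [rewrite big1 // => w _; rewrite mulr0|rewrite mulr0].
Qed.

(** Both sides equal the double sum of f(e v^-1) g(v w^-1) h(w), where [W] covers the support of [h]
    and [V] the points reached from [W] through [g]. *)
Lemma convA f g h : equivariant f -> Cc setT g -> Cc setT h ->
  conv (conv f g) h = conv f (conv g h).
Proof.
move=> ef cg ch; apply/funext => e.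
have eg := Cc_equivariant cg; have eh := Cc_equivariant ch.
have [W hW] := Cc_fibre etG (src e) ch; have [W1 W2 W3] := hW.
have [V [[V1 V2] cov]] := conv_support_list cg W1.
rewrite (@conv_Cc_src _ _ _ _ h e W) //; last exact: conv_equivariant.
rewrite (@conv_src _ _ _ f (conv g h) e V) //.
- transitivity (\sum_(w <- W) \sum_(v <- V)
      f (gmul e (ginv v)) * (g (gmul v (ginv w)) * h w)).
    apply: eq_big_seq => w wW; have we := W1 _ wW.
    rewrite (@convE _ _ _ _ _ _ _ V) //.
    + by rewrite mulr_suml; apply: eq_bigr => v _; rewrite mulrA.
    + by move=> v /V1 [ve _]; rewrite ve.
    + move=> v ve ne; apply: (cov v w) => //; first by rewrite ve.
      by apply: contra_neq ne => ->; rewrite mulr0.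
  rewrite exchange_big; apply: eq_big_seq => v /V1 [ve _] /=.
  by rewrite -mulr_sumr (@conv_Cc_src _ _ _ g h v W) ?ve.
- exact: conv_equivariant.
- by move=> v /V1 [].
- move=> v ve ne; have ghv : conv g h v != 0.
    by apply: contra_neq ne => ->; rewrite mulr0.
  move: ghv; rewrite (@conv_Cc_src _ _ _ g h v W) ?ve // => ghv.
  have [w wW gw] : exists2 w, w \in W & g (gmul v (ginv w)) != 0.
    apply: contrapT => nw; move/eqP: ghv; apply; apply: big1_seq => w /andP[_ wW].
    have [->|gn] := eqVneq (g (gmul v (ginv w))) 0; first by rewrite mul0r.
    by case: nw; exists w.
  exact: (cov v w).
Qed.

Lemma starfK f : starf (starf f) = f.
Proof. by apply/funext => e; rewrite /starf ginvK conjcK. Qed.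

Lemma starfB f g : starf (fun e => f e - g e) = (fun e => starf f e - starf g e).
Proof. by apply/funext => e; rewrite /starf (rmorphB (@conjc R)). Qed.

Lemma starfD f g : starf (fun e => f e + g e) = (fun e => starf f e + starf g e).
Proof. by apply/funext => e; rewrite /starf (rmorphD (@conjc R)). Qed.

Lemma starf_conv f g : Cc setT f -> Cc setT g ->
  starf (conv f g) = conv (starf g) (starf f).
Proof.
move=> cf cg; apply/funext => e; rewrite /starf.
have ef := Cc_equivariant cf; have eg := Cc_equivariant cg.
pose u := rng e; have uu : units u := units_rngE e.
have rE w : src w = u -> gmul w (ginv u) = w.
  by move=> wu; rewrite (ginv_unit uu) -wu gmul_src.
have [W hW] := Cc_fibre etG u cg; have [W1 W2 W3] := hW.
rewrite (@conv_Cc_src _ _ _ f g (ginv e) W) // ?src_ginv //.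
have -> : e = gmul u (ginv (ginv e)) by rewrite ginvK gmul_rng.
rewrite (@convE _ _ _ (starf g) (starf f) u (ginv e) W) ?src_ginv //.
- rewrite (rmorph_sum (@conjc R)) /=; apply: eq_big_seq => w wW.
  have wu := W1 _ wW; rewrite conjM mulrC /starf ginvK gmul_rng.
  have -> : ginv (gmul u (ginv w)) = w by rewrite ginvMV ?rE // units_src.
  by rewrite ginvM // ?ginvK.
- exact: starf_equivariant.
- exact: starf_equivariant.
- exact: units_src.
- move=> w wu ne; apply: W3 => //=.
  apply: contra_neq ne => gw; rewrite /starf.
  have -> : ginv (gmul u (ginv w)) = w by rewrite ginvMV ?rE // units_src.
  by rewrite gw conjc0 mul0r.
Qed.

(** * Classes of Cauchy sequences and their operations *)

Local Notation bndT := (bnd setT).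
Local Notation CcT := (@Cc R G E setT).
Local Notation cauT := (@cauchy_Cc R G E setT).
Local Notation clsT := (@cls R G E setT).
Implicit Types (a b : nat -> E -> C) (X Y : set (nat -> E -> C)).

Definition nullseq a := forall eps : R, 0 < eps -> exists N, forall n, (N <= n)%N ->
  bndT (a n) eps.

Definition bddseq a := exists2 c : R, 0 < c & exists N, forall n, (N <= n)%N -> bndT (a n) c.

Lemma subgroupoidT : subgroupoid [set: G]. Proof. by []. Qed.

Lemma rnorm_ge0 (H : set G) f : (0 <= rnorm H f)%E.
Proof. by apply: ereal_sup_ubound; left. Qed.

Lemma null_distP (H : set G) a b : subgroupoid H -> (forall n, CcT (fun e => a n e - b n e)) ->
  null_dist H a b <-> forall eps : R, 0 < eps -> exists N, forall n, (N <= n)%N ->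
    bnd H (fun e => a n e - b n e) eps.
Proof.
move=> sH cab; split=> [h eps eps0|h A].
  have nA : nbhs (0%:E : \bar R) [set x | (x < eps%:E)%E].
    exists eps => //= r; rewrite /= sub0r normrN lte_fin; exact: ltr_normlW.
  have [N _ hN] := h _ nA; exists N => n Nn; apply: rnorm_bnd => //.
  exact: (ltW (hN n Nn)).
(* Halving turns the weak inequality of [bnd_rnorm] into the strict one of a ball. *)
move=> [eps /= eps0 hA]; have e2 : 0 < eps / 2 by rewrite divr_gt0.
have [N hN] := h _ e2; exists N => // n /= Nn.
have := bnd_rnorm e2 (cab n) (hN n Nn).
have := rnorm_ge0 H (fun e => a n e - b n e).
rewrite -[(a n \- b n)%R]/(fun e => a n e - b n e).
case: (rnorm _ _) => [r| |] //; rewrite !lee_fin => r0 re.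
apply: hA => /=; rewrite sub0r normrN ger0_norm //.
by apply: (le_lt_trans re); rewrite ltr_pdivrMr // ltr_pMr // ltr1n.
Qed.

Lemma cauchyP (H : set G) a : subgroupoid H -> (forall f, Cc H f -> CcT f) ->
  cauchy_Cc H a <-> (forall n, Cc H (a n)) /\
  forall eps : R, 0 < eps -> exists N, forall m n, (N <= m)%N -> (N <= n)%N ->
    bnd H (fun e => a m e - a n e) eps.
Proof.
move=> sH HT; split=> -[ca h]; split => // eps eps0.
  have [N hN] := h _ eps0; exists N => m n Nm Nn; apply: rnorm_bnd => //.
    by apply: Cc_sub; exact: HT.
  exact: (ltW (hN _ _ Nm Nn)).
have e2 : 0 < eps / 2 by rewrite divr_gt0.
have [N hN] := h _ e2; exists N => m n Nm Nn.
apply: (@le_lt_trans _ _ ((eps / 2)%:E)).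
  by apply: bnd_rnorm => //; [apply: Cc_sub; exact: HT|exact: hN].
by rewrite lte_fin ltr_pdivrMr // ltr_pMr // ltr1n.
Qed.

Lemma cauTP a : cauT a <-> (forall n, CcT (a n)) /\
  forall eps : R, 0 < eps -> exists N, forall m n, (N <= m)%N -> (N <= n)%N ->
    bndT (fun e => a m e - a n e) eps.
Proof. exact: (cauchyP _ subgroupoidT). Qed.

Lemma cau_Cc a : cauT a -> forall n, CcT (a n). Proof. by case. Qed.

Lemma cau_bdd a : cauT a -> bddseq a.
Proof.
move=> ca; have /cauTP [cc h] := ca.
have [N hN] := h 1 ltr01; have [c c0 hc] := Cc_bnd (cc N).
exists (1 + c); first exact: addr_gt0.
exists N => n Nn; have := bnd_add (hN n N Nn (leqnn N)) hc.
by under [X in bnd setT X]eq_fun do rewrite subrK.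
Qed.

Lemma nullD a b : nullseq a -> nullseq b -> nullseq (fun n e => a n e + b n e).
Proof.
move=> ha hb eps eps0; have e2 : 0 < eps / 2 by rewrite divr_gt0.
have [N1 h1] := ha _ e2; have [N2 h2] := hb _ e2.
exists (maxn N1 N2) => n; rewrite geq_max => /andP[/h1 {}h1 /h2 {}h2].
by rewrite (splitr eps); exact: bnd_add.
Qed.

Lemma nullZ k a : nullseq a -> nullseq (fun n e => k * a n e).
Proof.
move=> ha eps eps0; have c0 : 0 < cabs k + 1 by rewrite ltr_wpDl ?cabs_ge0.
have [|N hN] := ha (eps / (cabs k + 1)); first exact: divr_gt0.
exists N => n /hN /(bnd_scale k); apply: bnd_mono.
rewrite mulrCA ger_pMr // ler_pdivrMr // mul1r lerDl //.
Qed.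

Lemma null_star a : nullseq a -> nullseq (fun n => starf (a n)).
Proof.
by move=> ha eps eps0; have [N hN] := ha _ eps0; exists N => n /hN; exact: bnd_star.
Qed.

Lemma null_mulr a b : (forall n, CcT (a n)) -> (forall n, CcT (b n)) ->
  nullseq a -> bddseq b -> nullseq (fun n => conv (a n) (b n)).
Proof.
move=> ca cb ha [c c0 [N1 h1]] eps eps0.
have d0 : 0 < eps / c by exact: divr_gt0.
have [N2 h2] := ha _ d0; exists (maxn N1 N2) => n.
rewrite geq_max => /andP[/h1 {}h1 /h2 {}h2].
have := bnd_conv d0 c0 (Cc_equivariant (ca n)) (cb n) h2 h1.
by rewrite divfK // lt0r_neq0.
Qed.

Lemma null_mull a b : (forall n, CcT (a n)) -> (forall n, CcT (b n)) ->
  bddseq a -> nullseq b -> nullseq (fun n => conv (a n) (b n)).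
Proof.
move=> ca cb [c c0 [N1 h1]] hb eps eps0.
have d0 : 0 < eps / c by exact: divr_gt0.
have [N2 h2] := hb _ d0; exists (maxn N1 N2) => n.
rewrite geq_max => /andP[/h1 {}h1 /h2 {}h2].
have := bnd_conv c0 d0 (Cc_equivariant (ca n)) (cb n) h1 h2.
by rewrite mulrC divfK // lt0r_neq0.
Qed.

Lemma cauD a b : cauT a -> cauT b -> cauT (fun n e => a n e + b n e).
Proof.
move=> /cauTP [ca ha].
move=> /cauTP [cb hb].
apply/cauTP; split; first by move=> n; exact: Cc_add.
move=> eps eps0; have e2 : 0 < eps / 2 by rewrite divr_gt0.
have [N1 h1] := ha _ e2; have [N2 h2] := hb _ e2.
exists (maxn N1 N2) => m n; rewrite !geq_max => /andP[m1 m2] /andP[n1 n2].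
rewrite (splitr eps); have := bnd_add (h1 _ _ m1 n1) (h2 _ _ m2 n2).
by congr bnd; apply/funext => e; ring.
Qed.

Lemma cauZ k a : cauT a -> cauT (fun n e => k * a n e).
Proof.
move=> /cauTP [ca ha].
apply/cauTP; split; first by move=> n; exact: Cc_scale.
move=> eps eps0; have c0 : 0 < cabs k + 1 by rewrite ltr_wpDl ?cabs_ge0.
have [|N hN] := ha (eps / (cabs k + 1)); first exact: divr_gt0.
exists N => m n Nm Nn; have := bnd_scale k (hN _ _ Nm Nn).
under [X in bnd setT X]eq_fun do rewrite mulrBr.
apply: bnd_mono; rewrite mulrCA ger_pMr // ler_pdivrMr // mul1r lerDl //.
Qed.

Lemma cau_star a : cauT a -> cauT (fun n => starf (a n)).
Proof.
move=> /cauTP [ca ha].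
apply/cauTP; split; first by move=> n; exact: Cc_star.
move=> eps /ha [N hN]; exists N => m n Nm Nn.
by have := bnd_star (hN _ _ Nm Nn); rewrite starfB.
Qed.

Lemma cau_conv a b : cauT a -> cauT b -> cauT (fun n => conv (a n) (b n)).
Proof.
move=> ha hb; have [c c0 [N1 h1]] := cau_bdd ha; have [d d0 [N2 h2]] := cau_bdd hb.
move: ha => /cauTP [ca ha].
move: hb => /cauTP [cb hb].
apply/cauTP; split; first by move=> n; exact: Cc_conv.
move=> eps eps0.
have d1 : 0 < eps / 2 / d by rewrite !divr_gt0.
have d2 : 0 < eps / 2 / c by rewrite !divr_gt0.
have [N3 h3] := ha _ d1; have [N4 h4] := hb _ d2.
exists (maxn (maxn N1 N2) (maxn N3 N4)) => m n.
rewrite !geq_max => /andP[/andP[m1 m2] /andP[m3 m4]] /andP[/andP[n1 n2] /andP[n3 n4]].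
have eA := fun k => Cc_equivariant (ca k); have eB := fun k => Cc_equivariant (cb k).
have k1 := bnd_conv d1 d0 (Cc_equivariant (Cc_sub (ca m) (ca n))) (cb m) (h3 _ _ m3 n3) (h2 _ m2).
have k2 := bnd_conv c0 d2 (eA n) (Cc_sub (cb m) (cb n)) (h1 _ n1) (h4 _ _ m4 n4).
have := bnd_add k1 k2; rewrite convBl // convBr //.
rewrite divfK ?lt0r_neq0 // [c * _]mulrC divfK ?lt0r_neq0 // -splitr.
by congr bnd; apply/funext => e; ring.
Qed.

Lemma cau_cst f : CcT f -> cauT (fun=> f).
Proof.
move=> cf; apply/cauTP; split => // eps eps0.
by exists 0%N => m n _ _; under eq_fun do rewrite subrr; apply: bnd0; exact: ltW.
Qed.

Definition eqv a b := nullseq (fun n e => a n e - b n e).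

Lemma eqv_refl a : eqv a a.
Proof.
by move=> eps eps0; exists 0%N => n _; under eq_fun do rewrite subrr; apply: bnd0; exact: ltW.
Qed.

Lemma eqv_sym a b : eqv a b -> eqv b a.
Proof.
move=> /(nullZ (-1)); rewrite /eqv.
by under eq_fun do under eq_fun do rewrite mulN1r opprB.
Qed.

Lemma eqv_trans b a c : eqv a b -> eqv b c -> eqv a c.
Proof.
move=> h1 h2; have := nullD h1 h2; rewrite /eqv.
by under eq_fun do under eq_fun do rewrite addrA subrK.
Qed.

Lemma null_dist_eqv a b : cauT a -> cauT b -> null_dist setT a b <-> eqv a b.
Proof.
move=> ca cb; apply: (null_distP subgroupoidT) => n.
by apply: Cc_sub; exact: cau_Cc.
Qed.

Lemma mem_cls a b : cauT a -> clsT a b <-> cauT b /\ eqv a b.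
Proof.
by move=> ca; split=> -[cb]; [move/(null_dist_eqv ca cb)|move=> h; split => //; apply/null_dist_eqv].
Qed.

Lemma cls_self a : cauT a -> clsT a a.
Proof. by move=> ca; apply/mem_cls => //; split => //; exact: eqv_refl. Qed.

Lemma cls_eqv a b : cauT a -> cauT b -> clsT a = clsT b <-> eqv a b.
Proof.
move=> ca cb; split=> [h|ab].
  by have := cls_self cb; rewrite -h => /(mem_cls _ ca) [].
apply/seteqP; split=> c.
  move=> /(mem_cls _ ca) [cc ac]; apply/(mem_cls _ cb); split; first exact: cc.
  exact: eqv_trans (eqv_sym ab) ac.
move=> /(mem_cls _ cb) [cc bc]; apply/(mem_cls _ ca); split; first exact: cc.
exact: eqv_trans ab bc.
Qed.

Lemma Cstar_cls X a : Cstar E setT X -> X a -> cauT a /\ X = clsT a.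
Proof.
move=> [b cb <-] /(mem_cls _ cb) [ca ba]; split; first exact: ca.
exact: (cls_eqv cb ca).2 ba.
Qed.

Lemma Cstar_cls_intro a : cauT a -> Cstar E setT (clsT a).
Proof. by move=> ca; exists a. Qed.

(** The operations are unions over representatives; one that respects [eqv] collapses to the class
    of a single representative. *)
Lemma bigcup_cls (F : (nat -> E -> C) -> nat -> E -> C) a :
  cauT a -> (forall b, cauT b -> cauT (F b)) ->
  (forall b, cauT b -> eqv a b -> eqv (F a) (F b)) ->
  \bigcup_(b in clsT a) clsT (F b) = clsT (F a).
Proof.
move=> ca cF eF; apply/seteqP; split=> [c [b /(mem_cls _ ca) [cb ab]]|c h].
  by rewrite -(cls_eqv (cF _ ca) (cF _ cb)).2 //; exact: eF.
by exists a; [exact: cls_self|exact: h].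
Qed.

Lemma bigcup2_cls (F : (nat -> E -> C) -> (nat -> E -> C) -> nat -> E -> C) a b :
  cauT a -> cauT b -> (forall a' b', cauT a' -> cauT b' -> cauT (F a' b')) ->
  (forall a' b', cauT a' -> cauT b' -> eqv a a' -> eqv b b' -> eqv (F a b) (F a' b')) ->
  \bigcup_(a' in clsT a) \bigcup_(b' in clsT b) clsT (F a' b') = clsT (F a b).
Proof.
move=> ca cb cF eF; apply/seteqP; split.
  move=> c [a' /(mem_cls _ ca) [ca' aa'] [b' /(mem_cls _ cb) [cb' bb']]].
  by rewrite -(cls_eqv (cF _ _ ca cb) (cF _ _ ca' cb')).2 //; exact: eF.
by move=> c h; exists a; [exact: cls_self|exists b; [exact: cls_self|exact: h]].
Qed.

Lemma cadd_cls a b : cauT a -> cauT b ->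
  cadd setT (clsT a) (clsT b) = clsT (fun n e => a n e + b n e).
Proof.
move=> ca cb.
apply: (@bigcup2_cls (fun a b n e => a n e + b n e) a b ca cb).
  by move=> a' b'; exact: cauD.
move=> a' b' ca' cb' aa' bb'.
have := nullD aa' bb'; congr nullseq; apply/funext => n; apply/funext => e; ring.
Qed.

Lemma cscale_cls k a : cauT a -> cscale setT k (clsT a) = clsT (fun n e => k * a n e).
Proof.
move=> ca; apply: (@bigcup_cls (fun b n e => k * b n e) a ca).
  by move=> b; exact: cauZ.
move=> b cb ab.
by have := nullZ k ab; rewrite /eqv; under eq_fun do under eq_fun do rewrite mulrBr.
Qed.

Lemma cstar_cls a : cauT a -> cstar setT (clsT a) = clsT (fun n => starf (a n)).
Proof.
move=> ca; apply: (@bigcup_cls (fun b n => starf (b n)) a ca).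
  by move=> b; exact: cau_star.
move=> b cb ab.
by have := null_star ab; rewrite /eqv; under eq_fun do rewrite starfB.
Qed.

Lemma eqv_conv a a' b b' : cauT a -> cauT a' -> cauT b -> cauT b' ->
  eqv a a' -> eqv b b' ->
  eqv (fun n => conv (a n) (b n)) (fun n => conv (a' n) (b' n)).
Proof.
move=> ha ha' hb hb' aa' bb'.
have ca := cau_Cc ha; have ca' := cau_Cc ha'; have cb := cau_Cc hb; have cb' := cau_Cc hb'.
have n1 := null_mulr (fun n => Cc_sub (ca n) (ca' n)) cb aa' (cau_bdd hb).
have n2 := null_mull ca' (fun n => Cc_sub (cb n) (cb' n)) (cau_bdd ha') bb'.
have := nullD n1 n2; congr nullseq; apply/funext => n; apply/funext => e.
rewrite convBl // ?convBr //; try exact: Cc_equivariant.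
by ring.
Qed.

Lemma cmul_cls a b : cauT a -> cauT b ->
  cmul setT (clsT a) (clsT b) = clsT (fun n => conv (a n) (b n)).
Proof.
move=> ca cb; apply: (@bigcup2_cls (fun a b n => conv (a n) (b n)) a b ca cb).
  by move=> a' b'; exact: cau_conv.
by move=> a' b' ca' cb' aa' bb'; exact: eqv_conv.
Qed.

(** * Commutants and bicommutants *)

Definition commutant (M : set (set (nat -> E -> C))) :=
  [set X | Cstar E setT X /\ forall Y, M Y -> cmul setT X Y = cmul setT Y X].

Definition commseq a b := eqv (fun n => conv (a n) (b n)) (fun n => conv (b n) (a n)).

Lemma cmul_comm a b : cauT a -> cauT b ->
  cmul setT (clsT a) (clsT b) = cmul setT (clsT b) (clsT a) <-> commseq a b.
Proof.
move=> ca cb; have e := cls_eqv (cau_conv ca cb) (cau_conv cb ca).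
have subst2 (T : Type) (x x' y y' : T) P :
    x = x' -> y = y' -> (x' = y' <-> P) -> (x = y <-> P) by move=> -> ->.
have h1 := cmul_cls ca cb; have h2 := cmul_cls cb ca.
have t := subst2 _ _ _ _ _ _ h1 h2 e.
exact: t.
Qed.

Lemma commseqD a a' b : cauT a -> cauT a' -> cauT b ->
  commseq a b -> commseq a' b -> commseq (fun n e => a n e + a' n e) b.
Proof.
move=> ca ca' cb h h'; have := nullD h h'; congr nullseq; apply/funext => n.
have eA := Cc_equivariant (cau_Cc ca n); have eA' := Cc_equivariant (cau_Cc ca' n).
rewrite convDl //; last exact: cau_Cc.
by rewrite convDr //; [apply/funext => e; ring|exact: cau_Cc].
Qed.

Lemma commseqZ k a b : cauT a -> cauT b ->
  commseq a b -> commseq (fun n e => k * a n e) b.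
Proof.
move=> ca cb h; have := nullZ k h; congr nullseq; apply/funext => n.
have eA := Cc_equivariant (cau_Cc ca n).
rewrite convZl //; last exact: cau_Cc.
by rewrite convZr //; [apply/funext => e; ring|exact: cau_Cc].
Qed.

Lemma commseqM a a' b : cauT a -> cauT a' -> cauT b ->
  commseq a b -> commseq a' b -> commseq (fun n => conv (a n) (a' n)) b.
Proof.
move=> ha ha' hb h h'.
have ca := cau_Cc ha; have ca' := cau_Cc ha'; have cb := cau_Cc hb.
have eA n := Cc_equivariant (ca n).
have k1 : eqv (fun n => conv (conv (a n) (a' n)) (b n))
    (fun n => conv (a n) (conv (b n) (a' n))).
  have -> : (fun n => conv (conv (a n) (a' n)) (b n)) =
      (fun n => conv (a n) (conv (a' n) (b n))).
    by apply/funext => n; rewrite convA.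
  exact: (eqv_conv ha ha (cau_conv ha' hb) (cau_conv hb ha') (@eqv_refl a) h').
apply: (eqv_trans k1).
have -> : (fun n => conv (a n) (conv (b n) (a' n))) =
    (fun n => conv (conv (a n) (b n)) (a' n)).
  by apply/funext => n; rewrite convA.
have -> : (fun n => conv (b n) (conv (a n) (a' n))) =
    (fun n => conv (conv (b n) (a n)) (a' n)).
  by apply/funext => n; rewrite convA //; exact: Cc_equivariant.
exact: (eqv_conv (cau_conv ha hb) (cau_conv hb ha) ha' ha' h (@eqv_refl a')).
Qed.

Lemma commseq_star a b : cauT a -> cauT b ->
  commseq a (fun n => starf (b n)) -> commseq (fun n => starf (a n)) b.
Proof.
move=> ha hb h; have ca := cau_Cc ha; have cb := cau_Cc hb.
apply: eqv_sym; have := null_star h; congr nullseq; apply/funext => n.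
rewrite starfB; have cs := Cc_star (cb n).
by rewrite (starf_conv (ca n) cs) (starf_conv cs (ca n)) starfK.
Qed.

Lemma commseq_limit a b : cauT a -> cauT b ->
  (forall eps : R, 0 < eps -> exists a', [/\ cauT a', commseq a' b &
     exists N, forall n, (N <= n)%N -> bndT (fun e => a n e - a' n e) eps]) ->
  commseq a b.
Proof.
move=> ha hb h eps eps0; have [c c0 [N1 hN1]] := cau_bdd hb.
(* The commutator of [a] with [b] is (a - a') b, plus the commutator of [a'], minus b (a - a'), each
   bounded by eps / 3. *)
have d0 : 0 < eps / 3 / c by rewrite !divr_gt0.
have e3 : 0 < eps / 3 by rewrite divr_gt0.
have [a' [ha' ab' [N2 hN2]]] := h _ d0; have [N3 hN3] := ab' _ e3.
have ca := cau_Cc ha; have ca' := cau_Cc ha'; have cb := cau_Cc hb.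
exists (maxn N1 (maxn N2 N3)) => n; rewrite !geq_max => /and3P[n1 n2 n3].
have cd := Cc_sub (ca n) (ca' n).
have eA := Cc_equivariant (ca n); have eA' := Cc_equivariant (ca' n).
have k1 := bnd_conv d0 c0 (Cc_equivariant cd) (cb n) (hN2 _ n2) (hN1 _ n1).
have k2 := bnd_conv c0 d0 (Cc_equivariant (cb n)) cd (hN1 _ n1) (hN2 _ n2).
have := bnd_sub (bnd_add k1 (hN3 _ n3)) k2.
rewrite [c * _]mulrC divfK ?lt0r_neq0 //; rewrite convBl // convBr //.
have -> : eps / 3 + eps / 3 + eps / 3 = eps by field.
by congr bnd; apply/funext => e; ring.
Qed.

Definition star_closed (M : set (set (nat -> E -> C))) :=
  forall X, M X -> M (cstar setT X).

Lemma commutant_subalgebra M : M `<=` Cstar E setT -> star_closed M ->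
  cstar_subalgebra setT (commutant M).
Proof.
move=> MC Ms.
have rep_ X : Cstar E setT X -> exists2 a, cauT a & X = clsT a.
  by move=> [a ca <-]; exists a.
have comP a : cauT a -> commutant M (clsT a) <->
    forall b, cauT b -> M (clsT b) -> commseq a b.
  move=> ca; split=> [[_ h] b cb Mb|h]; first exact/(cmul_comm ca cb)/h.
  split; first exact: Cstar_cls_intro.
  by move=> Y MY; have [b cb YE] := rep_ _ (MC _ MY); rewrite YE; apply/(cmul_comm ca cb)/h; rewrite -?YE.
have c0 : cauT (fun _ => fun=> 0) by apply: cau_cst; exact: Cc0.
split.
- split; first by move=> X [].
  apply/(comP _ c0) => b cb _; rewrite /commseq.
  have -> : (fun n => conv (fun=> 0) (b n)) = (fun n => conv (b n) (fun=> 0)).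
    by apply/funext => n; rewrite conv0l ?conv0r //; exact: cau_Cc.
  exact: eqv_refl.
- split=> [X X' hX hX'|k X hX].
    have [a ca XE] := rep_ _ hX.1; have [a' ca' XE'] := rep_ _ hX'.1.
    rewrite XE XE' cadd_cls //; rewrite XE in hX; rewrite XE' in hX'.
    apply/(comP _ (cauD ca ca')) => b cb Mb.
    by apply: commseqD => //; [exact/(comP _ ca).1|exact/(comP _ ca').1].
  have [a ca XE] := rep_ _ hX.1; rewrite XE cscale_cls //; rewrite XE in hX.
  apply/(comP _ (cauZ k ca)) => b cb Mb.
  by apply: commseqZ => //; exact/(comP _ ca).1.
- move=> X X' hX hX'.
  have [a ca XE] := rep_ _ hX.1; have [a' ca' XE'] := rep_ _ hX'.1.
  rewrite XE XE' cmul_cls //; rewrite XE in hX; rewrite XE' in hX'.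
  apply/(comP _ (cau_conv ca ca')) => b cb Mb.
  by apply: commseqM => //; [exact/(comP _ ca).1|exact/(comP _ ca').1].
- move=> X hX; have [a ca XE] := rep_ _ hX.1; rewrite XE cstar_cls //; rewrite XE in hX.
  apply/(comP _ (cau_star ca)) => b cb Mb; apply: commseq_star => //.
  apply: ((comP _ ca).1 hX); first exact: cau_star.
  by rewrite -cstar_cls //; exact: Ms.
- move=> X hX hlim; have [a ca XE] := rep_ _ hX; rewrite XE; rewrite XE in hlim.
  apply/(comP _ ca) => b cb Mb; apply: commseq_limit => // eps eps0.
  have e2 : 0 < eps / 2 by rewrite divr_gt0.
  have [Y hY [a1 [a2 [h1 h2 near12]]]] := hlim _ e2.
  have [ca1 aa1] := (mem_cls _ ca).1 h1; have [ca2 YE] := Cstar_cls hY.1 h2.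
  have [N1 hN1] := aa1 _ e2; have [N2 _ hN2] := near12.
  exists a2; split => //; first by apply/(comP _ ca2).1 => //; rewrite -YE.
  exists (maxn N1 N2) => n; rewrite geq_max => /andP[/hN1 k1 /hN2 /ltW k2].
  have {}k2 := rnorm_bnd e2 subgroupoidT (Cc_sub (cau_Cc ca1 n) (cau_Cc ca2 n)) k2.
  have := bnd_add k1 k2; rewrite -splitr.
  by congr bnd; apply/funext => e; rewrite addrA subrK.
Qed.

(** A commuting family lies in its commutant. Hence its bicommutant also lies in the commutant, with
    all of which it commutes. *)
Lemma bicommutant_abelian M : M `<=` Cstar E setT -> star_closed M ->
  (forall X Y, M X -> M Y -> cmul setT X Y = cmul setT Y X) ->
  abelian_cstar_subalgebra setT (commutant (commutant M)) /\
  M `<=` commutant (commutant M).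
Proof.
move=> MC Ms Mc; have c1 := commutant_subalgebra MC Ms.
have c1C : commutant M `<=` Cstar E setT by move=> X [].
have c1s : star_closed (commutant M) by case: c1.
have MM : M `<=` commutant M.
  by move=> X MX; split; [exact: MC|move=> Y MY; exact: Mc].
split; first split.
- exact: commutant_subalgebra.
- move=> X Y [XC hX] [YC hY]; apply: hX; split => // Z MZ.
  by apply: hY; exact: MM.
- move=> X MX; split; first exact: MC.
  by move=> Y [_ hY]; apply/esym/hY.
Qed.

End ReducedAlgebra.

(** * The image of the algebra of S, and functions that commute with it *)

Section Subalgebra.
Variables (R : realType) (G : groupoid) (E : twist R G) (S : set G).
Hypotheses (etG : etale G) (subS : subgroupoid S) (oS : open S) (cS : closed S).
Local Notation C := R[i]^o.
Local Notation pi := (@proj R G E).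
Local Notation bndT := (@bnd R G E setT).
Local Notation CcT := (@Cc R G E setT).
Local Notation cauT := (@cauchy_Cc R G E setT).
Local Notation clsT := (@cls R G E setT).
Local Notation B := (incl E S @` Cstar E S).
Implicit Types (e x y w u t : E) (z : C) (f g h k : E -> C) (a b : nat -> E -> C).
Implicit Types X Y : set (nat -> E -> C).

Lemma CcS_T f : Cc S f -> CcT f. Proof. by move/(CcSP oS cS) => []. Qed.

Lemma CcS_vanish f : Cc S f -> vanishes_off (restr E S) f.
Proof. by move/(CcSP oS cS) => []. Qed.

Lemma bndS_T f c : 0 < c -> Cc S f -> bnd S f c -> bndT f c.
Proof.
by move=> c0 cf; apply: bnd_extend => //; [exact: ltW|exact: CcS_vanish].
Qed.

Lemma CcS_sub f g : Cc S f -> Cc S g -> Cc S (fun e => f e - g e).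
Proof.
move=> /(CcSP oS cS) [cf vf] /(CcSP oS cS) [cg vg]; apply/(CcSP oS cS).
by split; [exact: Cc_sub|move=> e ne; rewrite vf // vg // subrr].
Qed.

Lemma cauS_T a : cauchy_Cc S a -> cauT a.
Proof.
move=> /(cauchyP etG a subS CcS_T) [ca ha]; apply/(cauTP etG).
split=> [n|eps eps0]; first exact: CcS_T.
have [N hN] := ha _ eps0; exists N => m n Nm Nn.
by apply: bndS_T => //; [exact: CcS_sub|exact: hN].
Qed.

Lemma null_distS a b : cauchy_Cc S a -> cauchy_Cc S b -> null_dist S a b -> eqv a b.
Proof.
move=> ca cb; have cab n : Cc S (fun e => a n e - b n e).
  by apply: CcS_sub; [case: ca|case: cb].
move=> /(null_distP etG subS (fun n => CcS_T (cab n))) h eps eps0.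
by have [N hN] := h _ eps0; exists N => n /hN; exact: bndS_T.
Qed.

Lemma cls_selfS a : cauchy_Cc S a -> cls S a a.
Proof.
move=> ca; split => //; have cc n : Cc S (a n) by case: ca.
apply/(null_distP etG subS) => [n|eps eps0].
  by apply: Cc_sub; exact: CcS_T.
by exists 0%N => n _; under eq_fun do rewrite subrr; apply: bnd0; exact: ltW.
Qed.

(** Sequences that are null for the norm over [S] are null over [G], by [bnd_extend], so the union
    over representatives is one class. *)
Lemma inclE a : cauchy_Cc S a -> incl E S (cls S a) = clsT a.
Proof.
move=> ca; apply/seteqP; split=> [c [b [cb ab] bc]|c ac]; last first.
  by exists a; [exact: cls_selfS|exact: ac].
have e := (cls_eqv etG (cauS_T ca) (cauS_T cb)).2 (null_distS ca cb ab).
by rewrite e.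
Qed.

Lemma mem_B X : B X <-> exists2 a, cauchy_Cc S a & X = clsT a.
Proof.
split=> [[_ [a ca <-] <-]|[a ca ->]]; first by exists a => //; rewrite inclE.
by exists (cls S a); [exists a|rewrite inclE].
Qed.

Lemma null_pointwise a e : nullseq a -> forall eps : R, 0 < eps ->
  exists N, forall n, (N <= n)%N -> cabs (a n e) <= eps.
Proof.
by move=> na eps /na [N hN]; exists N => n /hN; exact: bnd_entry.
Qed.

(** Some representative of the class vanishes off E_S, and norms dominate values by [bnd_entry]. *)
Lemma B_vanish a e : cauT a -> B (clsT a) -> ~ restr E S e ->
  forall eps : R, 0 < eps -> exists N, forall n, (N <= n)%N -> cabs (a n e) <= eps.
Proof.
move=> ca /mem_B [b cb ab] ne eps eps0.
have /(null_pointwise e) /(_ eps eps0) [N hN] := (cls_eqv etG ca (cauS_T cb)).1 ab.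
exists N => n /hN; have [cbn _] := cb.
by rewrite (CcS_vanish (cbn n) ne) subr0.
Qed.

Lemma B_cst f : CcT f -> B (clsT (fun=> f)) -> vanishes_off (restr E S) f.
Proof.
move=> cf Bf e ne; apply: cabs_le_eps => eps eps0.
by have [N /(_ N (leqnn N))] := B_vanish (cau_cst etG cf) Bf ne eps0.
Qed.

Lemma B_cst_intro f : Cc S f -> B (clsT (fun=> f)).
Proof.
move=> cf; apply/mem_B; exists (fun=> f) => //.
apply/(cauchyP etG _ subS CcS_T); split => // eps eps0.
by exists 0%N => m n _ _; under eq_fun do rewrite subrr; apply: bnd0; exact: ltW.
Qed.

Section MaximalAbelian.
Hypothesis maxB : maximal_abelian setT B.

Let BC : B `<=` Cstar E setT.
Proof. by case: maxB => [[[[]]]]. Qed.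

Let abelian_maximal_vanish g : CcT g -> starf g = g ->
  (forall k, Cc S k -> conv g k = conv k g) -> vanishes_off (restr E S) g.
Proof.
move=> cg sg hg; have [[[_ _ _ Bs _] Bcomm] Bmax] := maxB.
have cag := cau_cst etG cg.
pose M := B `|` [set clsT (fun=> g)].
have MC : M `<=` Cstar E setT.
  by move=> X [/BC //|->]; exact: Cstar_cls_intro.
have Ms : star_closed M.
  move=> X [/Bs BX|->]; first by left.
  by right; rewrite /= (cstar_cls etG cag) sg.
have Bg X : B X -> cmul setT X (clsT (fun=> g)) = cmul setT (clsT (fun=> g)) X.
  move=> /mem_B [a ca ->]; apply/(cmul_comm etG (cauS_T ca) cag).
  rewrite /commseq; have [cc _] := ca.
  have -> : (fun n => conv (a n) g) = (fun n => conv g (a n)).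
    by apply/funext => n; rewrite hg.
  exact: eqv_refl.
have Mc X Y : M X -> M Y -> cmul setT X Y = cmul setT Y X.
  move=> [BX|->] [BY|->]; [exact: Bcomm|exact: Bg|exact/esym/Bg|by []].
have [abD MD] := bicommutant_abelian etG MC Ms Mc.
have DB := Bmax _ abD (fun X BX => MD X (or_introl BX)).
by apply: B_cst => //; rewrite -DB; apply: MD; right.
Qed.

(** [abelian_maximal_vanish] admits self-adjoint functions only; it is applied to the sum of f and
    [starf f], and to i times their difference. *)
Lemma maximal_commuting_vanish f : CcT f ->
  (forall k, Cc S k -> conv f k = conv k f) -> vanishes_off (restr E S) f.
Proof.
move=> cf hf; have csf := Cc_star cf.
have hsf k : Cc S k -> conv (starf f) k = conv k (starf f).
  move=> ck; have csk : Cc S (starf k).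
    apply/(CcSP oS cS); split; first exact/Cc_star/CcS_T.
    move=> e ne; rewrite /starf (CcS_vanish ck) ?conjc0 // => Se.
    by apply: ne; rewrite -[e]ginvK; exact: restr_ginv.
  have := congr1 (@starf R G E) (hf _ csk).
  rewrite (starf_conv etG cf (CcS_T csk)) (starf_conv etG (CcS_T csk) cf) starfK.
  by move=> ->.
have ef := Cc_equivariant cf; have esf := Cc_equivariant csf.
have v1 : vanishes_off (restr E S) (fun e => f e + starf f e).
  apply: abelian_maximal_vanish; first exact: Cc_add.
    by rewrite starfD starfK; apply/funext => e; rewrite addrC.
  move=> k ck; have cTk := CcS_T ck; have ek := Cc_equivariant cTk.
  by rewrite convDl // convDr // hf // hsf.
have v2 : vanishes_off (restr E S) (fun e => ('i%C : C) * (f e - starf f e)).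
  have cd := Cc_sub cf csf.
  apply: abelian_maximal_vanish; first exact: Cc_scale.
    apply/funext => e.
    change (conjc (('i%C : C) * (f (ginv e) - starf f (ginv e))) = 'i%C * (f e - starf f e)).
    rewrite conjM conjB.
    have -> : conjc (starf f (ginv e)) = f e by rewrite /starf ginvK conjcK.
    have -> : conjc (f (ginv e)) = starf f e by [].
    have -> : conjc 'i%C = - 'i%C :> C.
      by apply/eqP; rewrite eq_complex /= oppr0 !eqxx.
    by rewrite mulNr -mulrN opprB.
  move=> k ck; have cTk := CcS_T ck; have ek := Cc_equivariant cTk.
  rewrite convZl //; last exact: Cc_equivariant.
  rewrite convZr //; last exact: Cc_equivariant.
  by rewrite convBl // convBr // hf // hsf.
move=> e ne; have := v1 e ne; have := v2 e ne.
move=> /eqP; rewrite mulf_eq0 => /orP[/eqP i0|].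
  by have := congr1 (@complex.Im R) i0 => /eqP; rewrite /= oner_eq0.
rewrite subr_eq0 => /eqP <- /eqP; rewrite -mulr2n mulrn_eq0 /= => /eqP //.
Qed.

End MaximalAbelian.

Lemma conv_eval_r f k e t : equivariant f -> CcT k -> src e = rng t ->
  (forall w, k w != 0 -> src w = src t -> pi w = pi t) ->
  conv f k (gmul e t) = f e * k t.
Proof.
move=> ef ck et kt; rewrite (@conv_Cc_src _ _ _ f k _ [:: t]) ?src_gmul //.
- by rewrite big_seq1 gmulgK.
- exact: Cc_equivariant.
- split=> [w||w wt /= kw]; [by rewrite inE => /eqP ->|by []|].
  by rewrite (kt w) // inE.
Qed.

Lemma conv_eval_l k f t e : equivariant k -> equivariant f -> src t = rng e ->
  (forall w, k w != 0 -> rng w = rng t -> pi w = pi t) ->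
  conv k f (gmul t e) = k t * f e.
Proof.
move=> ek ef te kt; pose u := src t; have uu : units u := units_srcE t.
have -> : gmul t e = gmul t (ginv (ginv e)) by rewrite ginvK.
rewrite (@convE _ _ _ k f t (ginv e) [:: u]) //.
- by rewrite big_seq1 ginvK (ginv_unit uu) gmul_src /u te gmul_rng.
- by rewrite src_ginv.
- by move=> w; rewrite inE => /eqP ->; rewrite /u src_ginv src_src.
move=> w; rewrite src_ginv -te => wt ne.
have : k (gmul t (ginv w)) != 0 by apply: contra_neq ne => ->; rewrite mul0r.
move=> /kt; rewrite rng_gmul ?rng_ginv // => /(_ erefl) h.
have hw : pi (ginv w) = pi (src t).
  apply: (@gmul_injl _ _ _ (pi t)).
  - by apply/src_rng_proj; rewrite rng_ginv.
  - by apply/src_rng_proj; rewrite rng_src.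
  - by rewrite -!proj_mul ?rng_ginv ?rng_src // h gmul_src.
by rewrite inE -[w]ginvK proj_ginv hw -proj_ginv ginv_unit //; exact: units_srcE.
Qed.

(** Convolution with a function supported in an open bisection has a single term, so such functions
    turn commutation into pointwise identities. *)
Lemma bump_bisection t (O : set G) : restr E S t -> open O -> O (pi t) ->
  exists k, [/\ Cc S k, k t != 0, forall w, k w != 0 -> restr E O w,
    forall w, k w != 0 -> src w = src t -> pi w = pi t &
    forall w, k w != 0 -> rng w = rng t -> pi w = pi t].
Proof.
move=> St oO Ot; have [U [oU Ut injU]] := src_inj_nbhs etG (pi t).
have [V [oV Vt injV]] := src_inj_nbhs etG (ginv (pi t)).
pose O' := O `&` S `&` U `&` (@ginv G @^-1` V).
have oO' : open O'.
  apply: openI; last by apply: open_comp => // g _; exact: ginv_continuous.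
  by apply: openI => //; exact: openI.
have O't : O' (pi t) by [].
have [k [ck kt [K [cK KO kK]]]] := bump oO' O't.
have kO w : k w != 0 -> O' (pi w) by move=> /kK /KO.
exists k; split => //.
- apply/(CcSP oS cS); split => // w nSw; apply/eqP/negPn/negP.
  by move=> /kO [[[_ Sw] _] _]; apply: nSw.
- by move=> w /kO [[[]]].
- by move=> w /kO [[_ Uw] _] wt; apply: injU => //; exact/src_proj.
- move=> w /kO [_ Vw] wt; have : ginv (pi w) = ginv (pi t).
    by apply: injV => //; rewrite !src_ginv; exact/rng_proj.
  by move=> /(congr1 (@ginv G)); rewrite !ginvK.
Qed.

Definition commutes_with f := forall k, Cc S k -> conv f k = conv k f.

(** A bisection bump k at t is tested at et = t (t^-1 e t): one convolution is f(e) k(t), the other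
    is k(t) f(t^-1 e t). *)
Lemma commuting_conj f e t : equivariant f -> commutes_with f ->
  restr E S t -> isotropy e -> rng t = rng e -> src t = rng e ->
  f (gmul (ginv t) (gmul e t)) = f e.
Proof.
move=> ef cf St ie rt st.
have [k [ck kt _ k1 k2]] := @bump_bisection t setT St openT I.
have cTk := CcS_T ck; have ek := Cc_equivariant cTk.
have et : src e = rng t by grpd.
have := congr1 (fun F => F (gmul e t)) (cf k ck).
rewrite (conv_eval_r ef cTk et k1).
have tE : gmul e t = gmul t (gmul (ginv t) (gmul e t)).
  by rewrite gmulVKg //; grpd.
rewrite {1}tE.
rewrite (conv_eval_l ek ef _ k2); last by grpd.
by rewrite mulrC => /(mulfI kt).
Qed.

(** A bump k on the units that is non-zero at the range of e and 0 at its source gives k(r(e)) f(e)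
    = f(e) k(s(e)) = 0. *)
Lemma commuting_nonisotropic f e : equivariant f -> commutes_with f ->
  restr E S (rng e) -> rng e <> src e -> f e = 0.
Proof.
move=> ef cf Se ne; pose O := @units G `&` ~` [set pi (src e)].
have oO : open O.
  by apply: openI; [exact: units_open|apply: open_setC1; exact: groupoid_hausdorff].
have Oe : O (pi (rng e)).
  split; first by apply: units_proj; exact: units_rngE.
  move=> h; apply: ne; apply: proj_unit_inj h; [exact: units_rngE|exact: units_srcE].
have [k [ck kt kO _ k2]] := bump_bisection Se oO Oe.
have cTk := CcS_T ck; have ek := Cc_equivariant cTk.
have := congr1 (fun F => F e) (cf k ck).
rewrite (@conv_Cc_src _ _ _ f k e [::]) // ?big_nil; last first.
  split => // w we /= /kO [uw nw]; case: nw => /=.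
  by rewrite -we proj_src units_src.
have -> : conv k f e = k (rng e) * f e.
  by rewrite -[in LHS](gmul_rng e) (conv_eval_l ek ef) ?src_rng.
by move=> /esym/eqP; rewrite mulf_eq0 (negbTE kt) => /eqP.
Qed.

(** The sums agree term by term: f(e w^-1) k(w) = k(w) f(w^-1 e), since w^-1 e is the conjugate of e
    w^-1 by w. *)
Lemma commute_of_invariant f : restr E S `<=` @isotropy E -> CcT f ->
  (forall e, ~ isotropy e -> f e = 0) ->
  (forall e t, restr E S t -> isotropy e -> rng t = rng e -> src t = rng e ->
     f (gmul (ginv t) (gmul e t)) = f e) ->
  commutes_with f.
Proof.
move=> iS cf f0 fconj k ck; have cTk := CcS_T ck.
have ek := Cc_equivariant cTk; have ef := Cc_equivariant cf.
have kS w : k w != 0 -> restr E S w.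
  exact: vanishes_off_neq0 (CcS_vanish ck).
have f_iso x : f x != 0 -> isotropy x.
  exact: vanishes_off_neq0.
apply/funext => e; have [ie|nie] := pselect (isotropy e); last first.
  transitivity (0 : C).
    apply/eqP/negPn/negP => /(conv_neq0 etG ef cTk).
    move=> [x [y [xy eE /f_iso ix /kS /iS iy]]]; apply: nie; rewrite eE.
    by grpd.
  apply/esym/eqP; apply: contrapT => /negP /(conv_neq0 etG ek cf).
  move=> [x [y [xy eE /kS /iS ix /f_iso iy]]]; apply: nie; rewrite eE.
  by grpd.
have [W [W1 W2 W3]] := Cc_fibre etG (src e) cTk.
pose W' := [seq w <- W | k w != 0].
have W'P w : w \in W' -> [/\ restr E S w, isotropy w & src w = src e].
  rewrite mem_filter => /andP[kw /W1 we]; have Sw := kS _ kw; split => //.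
  exact: iS.
have uW' : uniq (map pi W').
  by apply: subseq_uniq W2; apply: map_subseq; exact: filter_subseq.
have covW' w : src w = src e -> k w != 0 -> pi w \in map pi W'.
  move=> we kw; have /mapP[w' w'W ww'] := W3 w we kw; rewrite ww'; apply: map_f.
  rewrite mem_filter w'W andbT; have [z hz ->] := phase ww'.
  by rewrite ek // mulf_neq0 // circle_neq0.
rewrite (@conv_src _ _ _ f k e W') //; last first.
- by move=> w we ne; apply: covW' => //; apply: contra_neq ne => ->; rewrite mulr0.
- by move=> w /W'P [].
have eE : e = gmul (rng e) (ginv (ginv e)) by rewrite ginvK gmul_rng.
have unit1 v : src v = rng e -> gmul (rng e) (ginv v) = ginv v.
  by move=> ve; rewrite -ve -(rng_ginv v) gmul_rng.
rewrite [in RHS]eE (@convE _ _ _ k f (rng e) (ginv e) [seq ginv w | w <- W']) //.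
- rewrite big_map; apply: eq_big_seq => w /W'P [Sw iw we].
  rewrite (unit1 (ginv w)); last by grpd.
  rewrite !ginvK.
  rewrite mulrC; congr (_ * _).
  have <- := @fconj (gmul e (ginv w)) w Sw.
  + by congr f; rewrite gmulgVK.
  + by grpd.
  + by grpd.
  + by grpd.
- by rewrite src_rng src_ginv.
- by move=> _ /mapP[w /W'P [Sw iw we] ->]; grpd.
- rewrite -map_comp; have -> : map (pi \o @ginv E) W' = map (@ginv G) (map pi W').
    by rewrite -map_comp; apply: eq_map => w /=; rewrite proj_ginv.
  by rewrite map_inj_uniq //; exact: (can_inj (@ginvK G)).
- move=> v; rewrite src_ginv => ve; rewrite unit1 // => ne.
  have kv : k (ginv v) != 0 by apply: contra_neq ne => ->; rewrite mul0r.
  have iv := iS _ (kS _ kv); have : pi (ginv v) \in map pi W'.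
    apply: covW' => //; rewrite -(iv : rng _ = src _) rng_ginv ve.
    exact: ie.
  move=> /mapP[w wW' vw]; apply/mapP; exists (ginv w); first exact: map_f.
  by rewrite proj_ginv -vw proj_ginv ginvK.
Qed.

(** * Orbit sums on the interiors of the level sets of Omega_S *)

Section OrbitSums.
Hypothesis isoS : restr E S `<=` @isotropy E.

Definition conjugate t e : E := gmul (ginv t) (gmul e t).

(** The conjugators on the two sides may differ, because in [U_conj] the isotropy of a nearby x is
    still to be proved. *)
Lemma conjugate_near t e (A : set E) : rng t = rng e -> src e = rng t ->
  nbhs (conjugate t e) A -> exists B N : set E, [/\ nbhs t B, nbhs e N &
    forall a b x : E, B a -> B b -> N x -> rng a = rng x -> src x = rng b ->
      A (gmul (ginv a) (gmul x b))].
Proof.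
move=> te et nA; have c1 : src (ginv t) = rng (gmul e t) by grpd.
have [B1 [D [nB1 nD BD]]] := gmul_near c1 nA.
have [N [B2 [nN nB2 NB]]] := gmul_near et nD.
exists (@ginv E @^-1` B1 `&` B2), N; split => //.
  by apply: filterI => //; apply: preimage_nbhs => //; exact: ginv_continuous.
move=> a b x [B1a _] [_ B2b] Nx ax xb; apply: BD => //; last by grpd.
exact: NB.
Qed.

(** A witness that the orbit of [e] has at least [m] points with distinct images in [G]. *)
Definition separating m e (t : 'I_m -> E) :=
  (forall i, [/\ restr E S (t i), rng (t i) = rng e & src (t i) = rng e]) /\
  injective (fun i => pi (conjugate (t i) e)).

(** Lower semicontinuity of Omega_S: conjugators lift to nearby fibres, and disjoint neighbourhoods
    of the images keep the conjugates distinct. *)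
Lemma separating_near m e (t : 'I_m -> E) (B : 'I_m -> set E) :
  isotropy e -> separating e t -> (forall i, nbhs (t i) (B i)) ->
  \forall x \near e, isotropy x -> exists2 t' : 'I_m -> E,
    separating x t' & forall i, B i (t' i).
Proof.
move=> ie [tP injt] nB.
have [N [nN dN]] := disjoint_nbhs (@groupoid_hausdorff G) injt.
have : \forall x \near e, forall i, isotropy x -> exists t',
    [/\ restr E S t', rng t' = rng x, src t' = rng x, B i t' & N i (pi (conjugate t' x))].
  apply: filter_forall => i; have [Si ri si] := tP i.
  have nA := preimage_nbhs (@proj_continuous R G E (conjugate (t i) e)) (nN i).
  have et : src e = rng (t i) by grpd.
  have [B1 [N1 [nB1 nN1 h]]] := conjugate_near ri et nA.
  have nS := restr_nbhs oS Si.
  have nBS : nbhs (t i) (B1 `&` (B i `&` restr E S)).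
    by apply: filterI => //; apply: filterI.
  have hl := near_lift_rng etG nBS et.
  apply: filterS (filterI nN1 hl) => x [N1x [t' [B1t [Bt St] rt]]] ix.
  have it := isoS St; exists t'; split => //; try by grpd.
  by apply: h => //; grpd.
apply: filterS => x hx ix.
have /choice[t' ht'] := fun i => hx i ix.
exists t'; last by move=> i; case: (ht' i).
split=> [i|i j /= ij]; first by case: (ht' i).
by apply: (dN i j (pi (conjugate (t' i) x))); [case: (ht' i)|rewrite ij; case: (ht' j)].
Qed.

Lemma separating_Ad m e (t : 'I_m -> E) i : separating e t -> Ad S e (conjugate (t i) e).
Proof. by move=> [tP _]; have [Si ri si] := tP i; exists (t i). Qed.

Definition conj_seq m e (t : 'I_m -> E) := [seq conjugate (t i) e | i <- enum 'I_m].

Lemma conj_seq_uniq m e (t : 'I_m -> E) : separating e t -> uniq (conj_seq e t).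
Proof.
move=> [_ injt]; rewrite map_inj_uniq ?enum_uniq // => i j ij.
by apply: injt => /=; rewrite ij.
Qed.

Lemma conj_seq_sub m e (t : 'I_m -> E) (s : seq E) : separating e t -> Ad S e = [set` s] ->
  {subset conj_seq e t <= s}.
Proof.
move=> st As _ /mapP[i _ ->]; have := separating_Ad i st.
by rewrite As.
Qed.

Lemma separating_exists e (s : seq E) : isotropy e -> uniq (map pi s) -> Ad S e = [set` s] ->
  exists t : 'I_(size s) -> E, separating e t.
Proof.
move=> ie us As; pose c (i : 'I_(size s)) := tnth (in_tuple s) i.
have cA i : Ad S e (c i) by rewrite As /=; exact: mem_tnth.
have /choice[t tP] := cA; exists t; split=> [i|i j].
  by have [Si ri si _] := tP i; split.
have tE l : conjugate (t l) e = c l by have [_ _ _] := tP l.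
by rewrite /= !tE => /(uniq_map_tnth_inj us).
Qed.

Lemma separating_size m e (t : 'I_m -> E) (s : seq E) : separating e t -> Ad S e = [set` s] ->
  (m <= size s)%N.
Proof.
move=> st As; have := uniq_leq_size (conj_seq_uniq st) (conj_seq_sub st As).
by rewrite size_map size_enum_ord.
Qed.

(** At level [n], a family of [n] distinct conjugates exhausts the orbit, so orbits vary
    continuously with their conjugators. *)
Lemma separating_Ad_eq n e (t : 'I_n -> E) : separating e t ->
  Omega_preimage E S [set n] e -> Ad S e = [set` conj_seq e t].
Proof.
move=> st /Omega_preimageP [ie [s [sn us As]]].
have [] := uniq_min_size (conj_seq_uniq st) (conj_seq_sub st As).
  by rewrite size_map size_enum_ord sn.
by move=> _ ss'; rewrite As; apply/seteqP; split=> x /=; rewrite ss'.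
Qed.

Definition orbit_sum h e : C :=
  if `[< isotropy e >] then \sum_(x \in Ad S e) h x else 0.

Lemma orbit_sumE h n e (t : 'I_n -> E) : separating e t ->
  Omega_preimage E S [set n] e -> orbit_sum h e = \sum_(i < n) h (conjugate (t i) e).
Proof.
move=> st On; have [ie _] := On; rewrite /orbit_sum asboolT //.
rewrite (separating_Ad_eq st On) -fsbig_seq; last exact: conj_seq_uniq st.
by rewrite big_map big_enum.
Qed.

Section Level.
Variable n : nat.
Let On := Omega_preimage E S [set n].
Let U := interior On.

Let oU : open U. Proof. exact: open_interior. Qed.

Let U_iso e : U e -> isotropy e. Proof. by move=> /interior_subset []. Qed.

Lemma Omega_level_tact z e : circle z -> On e -> On (tact z e).
Proof.
move=> hz /Omega_preimageP [ie [s [sn us As]]]; apply/Omega_preimageP.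
have it : isotropy (tact z e) by rewrite /isotropy /= rng_tact // src_tact.
split => //; exists (map (tact z) s); rewrite size_map; split => //.
  by rewrite -map_comp (eq_map (g := pi)) // => w; rewrite /= proj_tact.
apply/seteqP; split=> [x [t [St]]|x /mapP[y]].
  rewrite rng_tact // => rt st ->; rewrite -tact_gmull -?tact_gmulr //; try by grpd.
  apply: map_f; have : Ad S e (gmul (ginv t) (gmul e t)) by exists t.
  by rewrite As.
move=> ys ->; have : Ad S e y by rewrite As.
move=> [t [St rt st ->]]; exists t; rewrite rng_tact //; split => //.
by rewrite -tact_gmull -?tact_gmulr //; grpd.
Qed.

Lemma U_tact z e : circle z -> U e -> U (tact z e).
Proof.
move=> hz Ue; have hz' := circle_inv hz.
have : nbhs (tact z e) (tact z^-1 @^-1` On).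
  apply: preimage_nbhs; first exact: tact_cont.
  by rewrite tactA // mulVf ?tact1 //; exact: circle_neq0.
apply: filterS => x /= /(Omega_level_tact hz).
by rewrite tactA // mulfV ?tact1 //; exact: circle_neq0.
Qed.

Lemma U_saturated e : restr E (pi @` U) e -> U e.
Proof. by move=> [y Uy /phase [z hz ->]]; exact: U_tact. Qed.

Lemma Omega_level_conj e t : On e -> restr E S t -> rng t = rng e -> src t = rng e ->
  On (conjugate t e).
Proof.
move=> /Omega_preimageP [ie [s [sn us As]]] St rt st; apply/Omega_preimageP.
have Ae : Ad S e (conjugate t e) by exists t.
split; first exact: Ad_isotropy Ae.
by exists s; rewrite (Ad_eq subS ie Ae).
Qed.

Lemma U_conj e x : U e -> Ad S e x -> U x.
Proof.
move=> Ue [t [St rt st ->]]; have ie := U_iso Ue.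
have s1 : rng (ginv t) = rng (conjugate t e) by rewrite /conjugate; grpd.
have s2 : src (conjugate t e) = rng (ginv t) by rewrite /conjugate; grpd.
have cK : conjugate (ginv t) (conjugate t e) = e.
  by rewrite /conjugate ginvK conjVK.
have nU : nbhs (conjugate (ginv t) (conjugate t e)) U by rewrite cK; exact: open_nbhs_nbhs.
have [B [N [nB nN h]]] := conjugate_near s1 s2 nU.
have nS := restr_nbhs oS (restr_ginv subS St).
have nBS : nbhs (ginv t) (B `&` restr E S) by exact: filterI.
have h1 := near_lift_rng etG nBS s2.
have s3 : src (ginv (conjugate t e)) = rng (ginv t) by rewrite src_ginv s1.
have h2 := preimage_nbhs (@ginv_continuous E (conjugate t e))
  (near_lift_rng etG nBS s3).
apply: filterS (filterI nN (filterI h1 h2)) => {}x [Nx [[b [Bb Sb] rb] [a [Ba Sa]]]].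
(* The product with two conjugators lies in [U] and is therefore isotropic; this gives [a] and [b] a
   common source, makes x isotropic, and allows conjugation by [b] alone. *)
rewrite src_ginv => ra; have Ux := h a b x Ba Bb Nx ra (esym rb).
have ib := isoS Sb; have ia := isoS Sa.
have ix : isotropy x by have := U_iso Ux; rewrite /isotropy /=; grpd.
have Ux' := h b b x Bb Bb Nx (etrans rb (esym ix)) (esym rb).
have -> : x = conjugate (ginv b) (conjugate b x).
  by rewrite /conjugate ginvK conjVK //; grpd.
apply: Omega_level_conj; first exact: (interior_subset Ux').
- exact: restr_ginv.
- by rewrite /conjugate; grpd.
- by rewrite /conjugate; grpd.
Qed.

Lemma level_near e : U e -> exists2 t : 'I_n -> E, separating e t &
  forall B : 'I_n -> set E, (forall i, nbhs (t i) (B i)) ->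
    \forall x \near e, U x /\ exists2 t' : 'I_n -> E, separating x t' & forall i, B i (t' i).
Proof.
move=> Ue; have /Omega_preimageP [ie [s [sn us As]]] := interior_subset Ue.
have [t st] : exists t : 'I_n -> E, separating e t.
  by move: sn => /= <-; exact: separating_exists.
exists t => // B nB; have nU : nbhs e U by exact: open_nbhs_nbhs.
apply: filterS (filterI nU (separating_near ie st nB)) => x [Ux hx].
by split => //; apply: hx; exact: U_iso.
Qed.

Section Sum.
Variables (h : E -> C) (K : set E).
Hypotheses (ch : CcT h) (cK : compact K) (KU : K `<=` U) (hK : forall e, h e != 0 -> K e).

Lemma orbit_sum_neq0 e : orbit_sum h e != 0 ->
  isotropy e /\ exists x, [/\ Ad S e x, K x & U e].
Proof.
rewrite /orbit_sum; case: asboolP => [ie ne|]; last by rewrite eqxx.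
split => //; apply: contrapT => nx; move/eqP: ne; apply.
apply: fsbig1 => x Ax; apply/eqP/negPn/negP => /hK Kx; apply: nx.
exists x; split => //; apply: (U_conj (KU Kx)); exact: Ad_sym Ax.
Qed.

Lemma conjugates_compact (Q : set E) : compact Q ->
  compact [set conjugate p.1 p.2 | p in (Q `*` K) `&`
    ([set p : E * E | rng p.1 = rng p.2] `&` [set p : E * E | src p.2 = rng p.1])].
Proof.
move=> cQ; apply: continuous_compact.
  apply/subspace_continuousP => -[t x] [_ /= [tx xt]] A nA.
  have [B [N [nB nN BN]]] := conjugate_near tx xt nA.
  exists (B, N) => // -[b y] [/= Bb Ny] [_ /= [by_ yb]].
  exact: (BN b b y).
apply: compact_closedI; first exact: compact_setX.
have c1 : continuous (fun p : E * E => rng p.1).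
  by move=> p; apply: continuous_comp; [exact: cvg_fst|exact: rng_continuous].
have c2 : continuous (fun p : E * E => rng p.2).
  by move=> p; apply: continuous_comp; [exact: cvg_snd|exact: rng_continuous].
have c3 : continuous (fun p : E * E => src p.2).
  by move=> p; apply: continuous_comp; [exact: cvg_snd|exact: src_continuous].
by apply: closedI; apply: closed_coincidence => //; exact: groupoid_hausdorff.
Qed.

(** Over [K], conjugators from a compact set [Q] reach all orbit points: locally, compact
    neighbourhoods of the [n] conjugators of one point suffice. The conjugates of [K] by [Q] then
    contain the support of the sum. *)
Lemma orbit_sum_compact : exists L, [/\ compact L, L `<=` U &
  forall e, orbit_sum h e != 0 -> L e].
Proof.
pose P (V : set E) := exists Q : set E, [/\ compact Q, Q `<=` restr E S &
  forall x y, V x -> Ad S x y -> exists t, [/\ Q t, rng t = rng x, src t = rng x &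
    y = conjugate t x]].
have [|s [sP Ks]] := @compact_finite_cover E K P cK.
  move=> x Kx; have [t [tP tinj] ht] := level_near (KU Kx).
  have /choice[Q hQ] : forall i, exists Q : set E,
      [/\ nbhs (t i) Q, compact Q & Q `<=` restr E S].
    by move=> i; apply: compact_nbhs_in; apply: restr_nbhs => //; case: (tP i).
  pose V := [set y | U y /\ exists2 t' : 'I_n -> E, separating y t' & forall i, Q i (t' i)].
  exists V; split; first exact: (ht Q (fun i => let: And3 a _ _ := hQ i in a)).
  exists (\big[setU/set0]_(i <- enum 'I_n) Q i); split.
  - by apply: bigsetU_compact => i _; case: (hQ i).
  - by rewrite -bigcup_seq => y [i _ Qy]; case: (hQ i) => _ _; exact.
  - move=> y f [Uy [t' st' Qt']]; rewrite (separating_Ad_eq st' (interior_subset Uy)) /=.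
    move=> /mapP[i _ ->]; exists (t' i); have [_ ri si] := st'.1 i; split => //.
    by rewrite -bigcup_seq; exists i => //=; rewrite mem_enum.
have [Q [cQ QS hQ]] : exists Q : set E, [/\ compact Q, Q `<=` restr E S &
    forall V x y, List.In V s -> V x -> Ad S x y ->
      exists t, [/\ Q t, rng t = rng x, src t = rng x & y = conjugate t x]].
  elim: s sP {Ks} => [|V s IH] sP; first by exists set0; split => //; exact: compact0.
  have [|Q [cQ QS hQ]] := IH; first by move=> W Ws; apply: sP; right.
  have [Q' [cQ' QS' hQ']] := sP V (or_introl erefl).
  exists (Q `|` Q'); split; first exact: compactU.
    by move=> x [/QS|/QS'].
  move=> W x f [<- /hQ' hh /hh|Ws Wx Af].
    by move=> [t [Qt rt st fE]]; exists t; split => //; right.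
  by have [t [Qt rt st fE]] := hQ _ _ _ Ws Wx Af; exists t; split => //; left.
eexists; split; first exact: conjugates_compact cQ.
- move=> _ [[t x] [[/= Qt Kx] [/= tx xt]] <-]; apply: (U_conj (KU Kx)).
  exists t; split => //; first exact: QS.
  by have := isoS (QS _ Qt); rewrite /isotropy /= => <-.
- move=> e /orbit_sum_neq0 [ie [x [Ax Kx Ue]]].
  have [V Vs Vx] := Ks _ Kx; have ix := U_iso (KU Kx).
  have [t [Qt rt st eE]] := hQ _ _ _ Vs Vx (Ad_sym subS ie Ax).
  by exists (t, x) => //; split => //; split => //=; grpd.
Qed.

(** On [U] the sum has [n] terms that vary continuously; off [U] it vanishes nearby, its support
    being in a compact subset of [U]. *)
Lemma orbit_sum_continuous : continuous (orbit_sum h).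
Proof.
have [L [cL LU hL]] := orbit_sum_compact.
move=> e; have [Ue|nUe] := pselect (U e); last first.
  apply: (vanishes_off_continuous (compact_closed_groupoid cL)) => [x nLx|/LU //].
  by apply/eqP/negPn/negP => /hL.
apply/continuous_cabs => eps eps0.
have [t st ht] := level_near Ue; have ie := U_iso Ue.
pose d := eps / n.+1%:R; have d0 : 0 < d by rewrite divr_gt0 // ltr0n.
have /CcP[cth _ _] := ch.
have /choice[BN hBN] : forall i, exists BN : set E * set E, [/\ nbhs (t i) BN.1,
    nbhs e BN.2 & forall b x : E, BN.1 b -> BN.2 x -> rng b = rng x -> src x = rng b ->
      cabs (h (conjugate (t i) e) - h (conjugate b x)) < d].
  move=> i; have [Si ri si] := st.1 i; have et : src e = rng (t i) by grpd.
  have /continuous_cabs/(_ _ d0) nA := cth (conjugate (t i) e).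
  have [B [N [nB nN BNh]]] := conjugate_near ri et nA.
  by exists (B, N); split => // b x Bb Nx bx xb; exact: BNh.
have n1 : \forall x \near e, forall i, (BN i).2 x.
  by apply: filter_forall => i; case: (hBN i).
have n2 := ht (fun i => (BN i).1) (fun i => let: And3 a _ _ := hBN i in a).
apply: filterS (filterI n1 n2) => x [Nx [Ux [t' st' Bt']]].
have ix := U_iso Ux.
rewrite (orbit_sumE h st (interior_subset Ue)) (orbit_sumE h st' (interior_subset Ux)).
rewrite -sumrB; apply: cabs_sum_lt => // i.
have [_ _] := hBN i; have [Si ri si] := st'.1 i.
by apply => //; grpd.
Qed.

Lemma orbit_sum_Cc : CcT (orbit_sum h).
Proof.
have [L [cL LU hL]] := orbit_sum_compact; have eh := Cc_equivariant ch.
apply/CcP; split; [exact: orbit_sum_continuous| |by exists L].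
move=> z e hz; have [Ue|nUe] := pselect (U e); last first.
  have F0 x : ~ U x -> orbit_sum h x = 0.
    by move=> nUx; apply/eqP/negPn/negP => /hL /LU.
  rewrite !F0 ?mulr0 // => /(U_tact (circle_inv hz)).
  by rewrite tactA ?mulVf ?tact1 ?circle_neq0 //; exact: circle_inv.
have [t st _] := level_near Ue; have ie := U_iso Ue.
have conjz i : conjugate (t i) (tact z e) = tact z (conjugate (t i) e).
  have [Si ri si] := st.1 i.
  by rewrite /conjugate -tact_gmull -?tact_gmulr //; grpd.
have st' : separating (tact z e) t.
  split=> [i|i j /=]; first by rewrite rng_tact //; exact: st.1.
  by rewrite !conjz !proj_tact //; exact: st.2.
rewrite (orbit_sumE h st (interior_subset Ue)).
rewrite (orbit_sumE h st' (interior_subset (U_tact hz Ue))) mulr_sumr.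
by apply: eq_bigr => i _; rewrite conjz eh.
Qed.

Lemma orbit_sum_commutes : commutes_with (orbit_sum h).
Proof.
apply: commute_of_invariant => //; first exact: orbit_sum_Cc.
  by move=> e nie; rewrite /orbit_sum asboolF.
move=> e t St ie rt st; have Ae : Ad S e (gmul (ginv t) (gmul e t)) by exists t.
by rewrite /orbit_sum !asboolT ?(Ad_eq subS ie Ae) //; exact: Ad_isotropy Ae.
Qed.

End Sum.

(* The witness is the orbit sum of a bump function that is supported near e. *)
Lemma level_commuting e : restr E S (rng e) -> U e -> exists f,
  [/\ CcT f, commutes_with f & f e != 0].
Proof.
move=> Se Ue; have /Omega_preimageP [ie [s [sn us As]]] := interior_subset Ue.
have es : e \in s by have := Ad_self ie Se; rewrite As.
(* The bump avoids the other points of the orbit, so the orbit sum at [e] reduces to h(e). *)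
pose A := [set` [seq pi x | x <- s & x != e]].
have fA : finite_set A by exact: finite_seq.
have oO : open (pi @` U `&` ~` A).
  apply: openI; first exact: proj_open.
  apply: closed_openC; apply: (accessible_finite_set_closed.1 _ A fA).
  exact: hausdorff_accessible (@groupoid_hausdorff G).
have Oe : (pi @` U `&` ~` A) (pi e).
  split; first by exists e.
  move=> /mapP[x]; rewrite mem_filter => /andP[xe xs] /(uniq_map_inj us es xs) ex.
  by rewrite ex eqxx in xe.
have [h [ch he [K [cK KO hK]]]] := bump oO Oe.
have KU : K `<=` U by move=> x /KO [Ux _]; exact: U_saturated.
exists (orbit_sum h); split.
- exact: orbit_sum_Cc ch cK KU hK.
- exact: orbit_sum_commutes ch cK KU hK.
rewrite /orbit_sum asboolT // As -fsbig_seq ?(map_uniq us) //.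
rewrite (bigD1_seq e) ?(map_uniq us) //= big1_seq ?addr0 // => x /andP[xe xs].
apply/eqP/negPn/negP => /hK /KO [_]; apply.
by apply: map_f; rewrite mem_filter xe.
Qed.

End Level.
Let above n := Omega_preimage E S [set m | (n < m)%N].

(** Separating conjugators persist near [e]; that Omega_S stays finite there comes from the interior
    of [above 1]. *)
Lemma above_near n e : interior (above 1) e -> above n e ->
  \forall x \near e, above n x.
Proof.
move=> We /Omega_preimageP [ie [s [/= ns us As]]].
have [t st] := separating_exists ie us As.
have nW : nbhs e (interior (above 1)) by apply: open_nbhs_nbhs; split => //; exact: open_interior.
have nT i : nbhs (t i) setT by exact: filterT.
have h := separating_near ie st nT.
apply: filterS (filterI nW h) => x [/interior_subset Wx hx].
have [ix [m m1 Om]] := Wx; have [t' st' _] := hx ix.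
have /Omega_seqP [s' [s'm us' As']] := Om.
split => //; exists m => //=; rewrite -s'm (leq_trans ns) //.
exact: separating_size st' As'.
Qed.

(* Baire category: a finite lower semicontinuous function on an open set is
   locally constant somewhere. *)
Lemma level_of_above : interior (above 1) !=set0 ->
  exists n, (1 < n)%N /\ interior (Omega_preimage E S [set n]) !=set0.
Proof.
move=> [e0 We0]; apply: contrapT => nolevel.
set W := interior (above 1) in We0 *.
have oW : open W by exact: open_interior.
(* If Omega_S exceeds n + 1 at a point of [V] but exceeds n + 2 nowhere on [V], then it equals n + 2
   near that point, against [nolevel]. *)
have unbounded n (V : set E) e : open V -> V `<=` W -> V e ->
    exists2 x, V x & above n.+1 x.
  elim: n e => [|n IH] e oV VW Ve; first by exists e => //; exact: interior_subset (VW _ Ve).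
  have [x Vx ax] := IH e oV VW Ve; apply: contrapT => nx; apply: nolevel.
  exists n.+2; split => //; exists x.
  have nV : nbhs x V by exact: open_nbhs_nbhs.
  apply: filterS (filterI nV (above_near (VW _ Vx) ax)) => y [Vy [iy [m m1 Om]]].
  split => //; exists m => //=; apply/eqP; rewrite eqn_leq m1 andbT leqNgt.
  by apply/negP => mn; apply: nx; exists y => //; split => //; exists m.
pose good (V : set E) := [/\ open V, V !=set0 & V `<=` W].
pose T := {V : set E | good V}.
(* The nested compact sets have non-empty interior, and Omega_S exceeds n + 1 on the n-th one; at a
   common point it could not be finite. *)
have step (p : nat * T) : exists V' : T, exists K : set E,
    [/\ compact K, sval V' `<=` K, K `<=` sval p.2 & K `<=` above p.1.+1].
  case: p => n [V [oV [e Ve] VW]] /=.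
  have [x Vx ax] := unbounded n V e oV VW Ve.
  have nV : nbhs x V by exact: open_nbhs_nbhs.
  have [K [nK cK KV]] := compact_nbhs_in (filterI nV (above_near (VW _ Vx) ax)).
  have hV' : good (interior K).
    split; [exact: open_interior|by exists x|].
    by move=> y /interior_subset /KV [/VW].
  exists (exist good _ hV'), K; split => //=; first exact: interior_subset.
    by move=> y /KV [].
  by move=> y /KV [].
have [next /choice[K hK]] := choice step.
have h0 : good W by split => //; exists e0.
pose V := fix V n : T := if n is m.+1 then next (m, V m) else exist good W h0.
have Vdec n m : sval (V (n + m)%N) `<=` sval (V n).
  elim: m => [|m IH]; first by rewrite addn0.
  rewrite addnS => x Vx; apply: IH.
  have [_ h1 h2 _] := hK ((n + m)%N, V (n + m)%N).
  by apply: h2; apply: h1.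
pose F : set_system E := filter_from setT (fun n => sval (V n)).
have FF : Filter F.
  apply: filter_from_filter; first by exists 0%N.
  move=> n m _ _; exists (n + m)%N => // x Vx; split; first exact: Vdec Vx.
  by move: Vx; rewrite addnC; exact: Vdec.
have PF : ProperFilter F.
  by apply: filter_from_proper => n _; have [_ [x Vx] _] := svalP (V n); exists x.
have [cK0 h1 _ _] := hK (0%N, V 0%N).
have FK0 : F (K (0%N, V 0%N)) by exists 1%N.
have [x [K0x clx]] := cK0 F PF FK0.
have xa n : above n.+1 x.
  have [cKn hn1 _ hn2] := hK (n, V n); apply: hn2.
  have clKn : closed (K (n, V n)) by exact: compact_closed_groupoid.
  apply: clKn => B nB; apply: clx => //.
  by exists n.+1.
have [_ [m _ Om]] := xa 0%N; have [_ [m' /= mm' Om']] := xa m.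
by move: Om'; rewrite Om => -[mm]; move: mm'; rewrite -mm ltnNge leqnSn.
Qed.

End OrbitSums.

(** * From (i) to (ii) *)

Local Notation OmegaOne := (Omega_preimage E S [set 1%N]).

Lemma subalgebra_commutes f k : (forall X Y, B X -> B Y -> cmul setT X Y = cmul setT Y X) ->
  Cc S f -> Cc S k -> conv f k = conv k f.
Proof.
move=> Bcomm cf ck; have cTf := CcS_T cf; have cTk := CcS_T ck.
have := Bcomm _ _ (B_cst_intro cf) (B_cst_intro ck).
move/(cmul_comm etG (cau_cst etG cTf) (cau_cst etG cTk)) => h.
apply/funext => e; apply/eqP; rewrite -subr_eq0; apply/eqP/cabs_le_eps => eps eps0.
by have [N /(_ N (leqnn N))] := null_pointwise e h eps0.
Qed.

(** Functions in C_c(S; E_S) commute with each other, so they vanish off the isotropy and are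
    constant on orbits; there are enough bump functions to make E_S isotropic with trivial
    orbits. *)
Lemma abelian_of_commutative :
  (forall X Y, B X -> B Y -> cmul setT X Y = cmul setT Y X) ->
  abelian_subset (restr E S).
Proof.
move=> Bcomm; have comm k : Cc S k -> commutes_with k.
  by move=> ck k' ck'; exact: subalgebra_commutes.
have eqk k : Cc S k -> equivariant k by move/(CcS_T)/Cc_equivariant.
have iS : restr E S `<=` @isotropy E.
  move=> e Se; apply: contrapT => ne.
  have [k [ck ke _ _ _]] := bump_bisection Se openT I.
  move/eqP: ke; apply.
  exact: (commuting_nonisotropic (eqk _ ck) (comm _ ck) (restr_rng subS Se) ne).
split => // e t Se St et; have ie := iS _ Se; have it := iS _ St.
have rt : rng t = rng e by grpd.
have st : src t = rng e by grpd.
suff c : gmul (ginv t) (gmul e t) = e.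
  by rewrite -{2}c gmulVKg //; grpd.
have kinv k : Cc S k -> k (gmul (ginv t) (gmul e t)) = k e.
  by move=> ck; apply: (commuting_conj (eqk _ ck) (comm _ ck)).
have pc : pi e = pi (gmul (ginv t) (gmul e t)).
  apply: contrapT => ne.
  have oO : open (~` [set pi (gmul (ginv t) (gmul e t))]).
    by apply: open_setC1; exact: groupoid_hausdorff.
  have [k [ck ke kO _ _]] := bump_bisection Se oO ne.
  by move: ke; rewrite -(kinv _ ck) => /kO; apply.
(* Equal projections leave a phase [z], and k(z e) = k(e) with k(e) non-zero forces z = 1. *)
have [z hz cE] := phase pc; have [k [ck ke _ _ _]] := bump_bisection Se openT I.
rewrite cE; have : z * k e = 1 * k e by rewrite mul1r -(eqk _ ck) // -cE kinv.
by move=> /(mulIf ke) ->; rewrite tact1.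
Qed.

Lemma one_imp_two : maximal_abelian setT B -> condition_two E S.
Proof.
move=> maxB; have [[_ Bcomm] _] := maxB.
have aS := abelian_of_commutative Bcomm; have iS := aS.1.
(* A bump on the open set of units outside [S] has product 0 with C_c(S; E_S) on both sides; so it
   commutes, and would have to vanish off E_S. *)
have uS : @units E `<=` restr E S.
  move=> u uu; apply: contrapT => nSu.
  have oO : open (@units G `&` ~` S).
    by apply: openI; [exact: units_open|exact: closed_openC].
  have Ou : (@units G `&` ~` S) (pi u) by split => //; exact: units_proj.
  have [h [ch hu [K [cK KO hK]]]] := bump oO Ou.
  have hO x : h x != 0 -> units (pi x) /\ ~ S (pi x) by move=> /hK /KO.
  have eh := Cc_equivariant ch.
  move/eqP: hu; apply.
  apply: (maximal_commuting_vanish maxB ch) => // k ck.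
  have cTk := CcS_T ck; have ek := Cc_equivariant cTk.
  have kS x : k x != 0 -> restr E S x.
    exact: vanishes_off_neq0 (CcS_vanish ck).
  apply/funext => e; transitivity (0 : C).
    apply/eqP/negPn/negP => /(conv_neq0 etG eh cTk).
    move=> [x [y [xy _ /hO [ux nSx] /kS /(restr_rng subS)]]].
    by rewrite -xy /restr /= proj_src units_src.
  apply/esym/eqP; apply: contrapT => /negP /(conv_neq0 etG ek ch).
  move=> [x [y [xy _ /kS /(restr_src subS) + /hO [uy nSy]]]].
  by rewrite xy /restr /= proj_rng (uy : rng _ = _).
have level n : interior (Omega_preimage E S [set n]) `<=` restr E S.
  move=> e Ue; apply: contrapT => nSe.
  have Sr : restr E S (rng e) by apply: uS; exact: units_rngE.
  have [f [cf fc fe]] := level_commuting iS Sr Ue.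
  move/eqP: fe; apply.
  exact: (maximal_commuting_vanish maxB cf fc).
have abI := abelian_interior subS oS aS.
split.
- by move=> u /uS; exact: abI.
- by apply/seteqP; split; [exact: level|exact: abI].
apply/seteqP; split => // e We.
have [n [n1 [x Ux]]] := level_of_above iS (ex_intro _ e We).
have /(abelian_Omega_one subS aS)/Omega_oneP [_ O1] := level _ _ Ux.
have [_ [m /= mn Om]] := interior_subset Ux.
by move: n1; rewrite -mn; move: Om; rewrite O1 => -[<-].
Qed.

(** * From (ii) to (i) *)

Lemma cauS_intro a : cauT a -> (forall n, vanishes_off (restr E S) (a n)) ->
  cauchy_Cc S a.
Proof.
move=> /(cauTP etG) [ca ha] va; apply/(cauchyP etG _ subS (CcS_T)).
split=> [n|eps /ha [N hN]]; first by apply/(CcSP oS cS).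
by exists N => m n Nm Nn; apply: bnd_weaken; exact: hN.
Qed.

Lemma list_pointwise_small (d : nat -> E -> C) (l : seq E) (eps : R) :
  (forall e, exists N, forall n, (N <= n)%N -> cabs (d n e) <= eps) ->
  exists N, forall n e, (N <= n)%N -> e \in l -> cabs (d n e) <= eps.
Proof.
move=> hd; elim: l => [|e l [N hN]]; first by exists 0%N.
have [M hM] := hd e; exists (maxn N M) => n x; rewrite geq_max => /andP[Nn Mn].
by rewrite inE => /orP[/eqP ->|xl]; [exact: hM|exact: hN].
Qed.

(** Cutting down to E_S gives a Cauchy sequence b, by [bnd_cut]. The difference d = a - b is Cauchy
    and tends to 0 pointwise, so d n is the pointwise limit in m of d n - d m, which is small in
    norm; [bnd_limit] makes d null. *)
Lemma B_intro a : cauT a -> (forall e, ~ restr E S e -> forall eps : R, 0 < eps ->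
    exists N, forall n, (N <= n)%N -> cabs (a n e) <= eps) ->
  B (clsT a).
Proof.
move=> ca ha; have /(cauTP etG) [cc hcau] := ca.
pose b n := cut S (a n).
have cutB f k : (fun e => cut S f e - cut S k e) = cut S (fun e => f e - k e).
  apply/funext => e; have [Se|nSe] := pselect (restr E S e); first by rewrite !cutE.
  by rewrite !cut_out // subrr.
have cb : cauT b.
  apply/(cauTP etG); split=> [n|eps eps0]; first by apply: (CcS_T); exact: cut_Cc.
  have [N hN] := hcau _ eps0; exists N => m n Nm Nn; rewrite cutB.
  by apply: bnd_cut => //; [exact: ltW|exact: hN].
have cbS : cauchy_Cc S b by apply: cauS_intro => // n e; exact: cut_out.
have ab : eqv a b.
  pose d n e := a n e - b n e.
  have d0 e (eps : R) : 0 < eps -> exists N, forall n, (N <= n)%N -> cabs (d n e) <= eps.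
    move=> eps0; have [Se|nSe] := pselect (restr E S e).
      by exists 0%N => n _; rewrite /d /b cutE // subrr cabs0 ltW.
    have [N hN] := ha e nSe _ eps0; exists N => n Nn.
    by rewrite /d /b cut_out // subr0; exact: hN.
  move=> eps eps0; have e2 : 0 < eps / 2 by rewrite divr_gt0.
  have [N hN] := hcau _ e2; exists N => n Nn; apply: bnd_limit => l eps' eps'0.
  have [M hM] := list_pointwise_small l (fun e => d0 e _ eps'0).
  pose m := maxn N M; exists (fun e => d n e - d m e); split.
    have k1 := hN n m Nn (leq_maxl _ _).
    have k2 := bnd_cut subS (ltW e2) k1.
    have := bnd_sub k1 k2; rewrite -splitr -cutB.
    by congr bnd; apply/funext => e; rewrite /d /b; ring.
  move=> e el; rewrite -/(d n e) opprB addrC subrK; apply: hM => //.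
  exact: leq_maxr.
apply/(mem_B); exists b; first exact: cbS.
exact: (cls_eqv etG ca cb).2 ab.
Qed.

(** Closedness under limits reduces by [B_intro] to convergence to 0 at each point off E_S, which
    approximation in norm preserves. *)
Lemma B_subalgebra : cstar_subalgebra setT B.
Proof.
have BP := mem_B.
have vS a n : cauchy_Cc S a -> vanishes_off (restr E S) (a n).
  by move=> [ca _]; exact: (CcS_vanish (ca n)).
have cT a : cauchy_Cc S a -> cauT a by exact: cauS_T.
split.
- split; first by move=> X /BP [a /cT ca ->]; exists a.
  apply/BP; exists (fun=> fun=> 0) => //; apply: cauS_intro.
    exact: (cau_cst etG (@Cc0 R G E)).
  by [].
- split.
    move=> X Y /BP [a ca ->] /BP [b cb ->]; apply/BP.
    exists (fun n e => a n e + b n e).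
      apply: cauS_intro; first exact: (cauD etG (cT _ ca) (cT _ cb)).
      by move=> n e ne; rewrite (vS a) // (vS b) // addr0.
    exact: (cadd_cls etG (cT _ ca) (cT _ cb)).
  move=> k X /BP [a ca ->]; apply/BP; exists (fun n e => k * a n e).
    apply: cauS_intro; first exact: (cauZ etG k (cT _ ca)).
    by move=> n e ne; rewrite (vS a) // mulr0.
  exact: (cscale_cls etG k (cT _ ca)).
- move=> X Y /BP [a ca ->] /BP [b cb ->]; apply/BP.
  exists (fun n => conv (a n) (b n)).
    apply: cauS_intro; first exact: (cau_conv etG (cT _ ca) (cT _ cb)).
    move=> n e ne; apply/eqP/negPn/negP.
    move=> /(conv_neq0 etG (Cc_equivariant (cau_Cc (cT _ ca) n)) (cau_Cc (cT _ cb) n)).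
    move=> [x [y [xy eE ax byn]]]; apply: ne; rewrite eE; apply: restr_gmul => //.
      exact: vanishes_off_neq0 (vS a n ca) ax.
    exact: vanishes_off_neq0 (vS b n cb) byn.
  exact: (cmul_cls etG (cT _ ca) (cT _ cb)).
- move=> X /BP [a ca ->]; apply/BP; exists (fun n => starf (a n)).
    apply: cauS_intro; first exact: (cau_star etG (cT _ ca)).
    move=> n e ne; rewrite /starf (vS a) ?conjc0 // => Se; apply: ne.
    by rewrite -[e]ginvK; exact: restr_ginv.
  exact: (cstar_cls etG (cT _ ca)).
- move=> X [a ca <-] hX; apply: B_intro => // e ne eps eps0.
  have e3 : 0 < eps / 3 by rewrite divr_gt0.
  have [Y BY [a1 [b [h1 h2 [N1 _ hN1]]]]] := hX _ e3.
  have [ca1 aa1] := (mem_cls etG _ ca).1 h1.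
  have YC : Cstar E setT Y by move/BP: BY => [a' /cT ca' ->]; exists a'.
  have [cb YE] := Cstar_cls etG YC h2; rewrite YE in BY.
  have [N2 hN2] := null_pointwise e aa1 e3.
  have [N3 hN3] := B_vanish cb BY ne e3.
  exists (maxn N1 (maxn N2 N3)) => n; rewrite !geq_max => /and3P[n1 n2 n3].
  have k1 := rnorm_bnd e3 (subgroupoidT G) (Cc_sub (cau_Cc ca1 n) (cau_Cc cb n)) (ltW (hN1 _ n1)).
  have := bnd_entry e k1; have := hN2 _ n2; have := hN3 _ n3.
  have := cabs_tri (a n e) 0 (a1 n e); have := cabs_tri (a1 n e) 0 (b n e).
  rewrite !subr0; lra.
Qed.

(** Norms dominate values, so pointwise limits exist and are attained uniformly on E. *)
Lemma cauchy_limit a : cauT a -> exists f : E -> C, [/\ continuous f, equivariant f &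
  forall eps : R, 0 < eps -> exists N, forall n e, (N <= n)%N -> cabs (f e - a n e) <= eps].
Proof.
move=> /(cauTP etG) [cc hcau].
have hcau' (eps : R) : 0 < eps -> exists N, forall m n e, (N <= m)%N -> (N <= n)%N ->
    cabs (a m e - a n e) <= eps.
  by move=> /hcau [N hN]; exists N => m n e Nm Nn; exact: bnd_entry (hN _ _ Nm Nn).
have /choice[f hf] : forall e, exists l : C, forall eps : R, 0 < eps ->
    exists N, forall n, (N <= n)%N -> cabs (l - a n e) <= eps.
  move=> e; apply: complex_complete => eps /hcau' [N hN].
  by exists N => m n Nm Nn; exact: hN.
have unif (eps : R) : 0 < eps -> exists N, forall n e, (N <= n)%N ->
    cabs (f e - a n e) <= eps.
  move=> eps0; have e2 : 0 < eps / 2 by rewrite divr_gt0.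
  have [N hN] := hcau' _ e2; exists N => n e Nn.
  have [M hM] := hf e _ e2; pose m := maxn N M.
  have := hM m (leq_maxr _ _); have := hN m n e (leq_maxl _ _) Nn.
  have := cabs_tri (f e) (a n e) (a m e); lra.
exists f; split => //.
- move=> e; apply/continuous_cabs => eps eps0.
  have e3 : 0 < eps / 3 by rewrite divr_gt0.
  have [N hN] := unif _ e3; have /CcP[ca _ _] := cc N.
  have /continuous_cabs/(_ _ e3) := ca e; apply: filterS => x hx.
  have := hN N e (leqnn N); have := hN N x (leqnn N).
  have := cabs_tri (f e) (f x) (a N e); have := cabs_tri (a N e) (f x) (a N x).
  rewrite (cabsB (a N x) (f x)); lra.
- move=> z e hz; apply/eqP; rewrite -subr_eq0; apply/eqP/cabs_le_eps => eps eps0.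
  have e2 : 0 < eps / 2 by rewrite divr_gt0.
  have [N hN] := unif _ e2; have := hN N (tact z e) (leqnn N).
  have := hN N e (leqnn N); rewrite (Cc_equivariant (cc N)) // => h1 h2.
  have : cabs (z * f e - z * a N e) <= eps / 2.
    by rewrite -mulrBr cabsM (circleP z).1 // mul1r.
  have := cabs_tri (f (tact z e)) (z * f e) (z * a N e).
  rewrite (cabsB (z * a N e)); lra.
Qed.

(** At a fixed point both convolutions are finite sums over lists that depend on [k] only, so they
    pass to the limit although [f] need not have compact support. *)
Lemma limit_commutes a f k : cauT a -> equivariant f ->
  (forall eps : R, 0 < eps -> exists N, forall n e, (N <= n)%N -> cabs (f e - a n e) <= eps) ->
  CcT k -> commseq a (fun=> k) -> conv f k = conv k f.
Proof.
move=> ca ef hf ck hcomm; apply/funext => e.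
have [W1 hW1] := conv_list_r etG (src e) ck.
have [W2 hW2] := conv_list_l etG e ck.
(* The two sums weight the errors of the two convolutions, and the 1 accounts for the commutator of
   [a n] and [k]. *)
pose M := \sum_(w <- W1) cabs (k w) + \sum_(w <- W2) cabs (k (gmul e (ginv w))) + 1.
have M0 : 0 < M by rewrite ltr_wpDl // addr_ge0 // sumr_ge0 // => w _; exact: cabs_ge0.
apply/eqP; rewrite -subr_eq0; apply/eqP/cabs_le_eps => eps eps0.
pose d := eps / M; have d0 : 0 < d by rewrite divr_gt0.
have [N1 hN1] := hf _ d0; have [N2 hN2] := null_pointwise e hcomm d0.
pose n := maxn N1 N2; have ea := Cc_equivariant (cau_Cc ca n).
have fa x : cabs (f x - a n x) <= d by apply: hN1; exact: leq_maxl.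
have k1 : cabs (conv f k e - conv (a n) k e) <= d * \sum_(w <- W1) cabs (k w).
  rewrite !hW1 // -sumrB (le_trans (cabs_sum _ _)) // mulr_sumr.
  apply: ler_sum => w _; rewrite -mulrBl cabsM ler_wpM2r ?cabs_ge0 //.
have k2 : cabs (conv k (a n) e - conv k f e) <= d * \sum_(w <- W2) cabs (k (gmul e (ginv w))).
  rewrite !hW2 // -sumrB (le_trans (cabs_sum _ _)) // mulr_sumr.
  by apply: ler_sum => w _; rewrite -mulrBr cabsM mulrC ler_wpM2r ?cabs_ge0 // cabsB.
have k3 := hN2 n (leq_maxr _ _).
have dM : d * \sum_(w <- W1) cabs (k w) + d * \sum_(w <- W2) cabs (k (gmul e (ginv w))) + d = eps.
  by rewrite -!mulrDr -[X in _ + X]mulr1 -mulrDr -/M /d divfK // lt0r_neq0.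
have := cabs_tri (conv f k e) (conv k f e) (conv (a n) k e).
have := cabs_tri (conv (a n) k e) (conv k f e) (conv k (a n) e).
lra.
Qed.

Lemma two_imp_one : condition_two E S -> maximal_abelian setT B.
Proof.
move=> h2; have [_ aS _ _] := two_imp_three subS oS h2.
have [uI IS i1] := h2; have iS := aS.1.
have uS : @units E `<=` restr E S by rewrite -IS.
have BP := mem_B.
(* Conjugation by elements of E_S fixes the points of the abelian E_S and preserves its complement
   in the isotropy. *)
have comm k : Cc S k -> commutes_with k.
  move=> ck; apply: commute_of_invariant => //; first exact: (CcS_T).
    by move=> e nie; apply: (CcS_vanish ck) => /iS.
  move=> e t St ie rt st; have [Se|nSe] := pselect (restr E S e).
    by rewrite (aS.2 e t) // ?gmulKg //; grpd.
  rewrite !(CcS_vanish ck) // => Sc; apply: nSe.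
  rewrite -(conjVK ie rt st); apply: restr_gmul => //; first by grpd.
  by apply: restr_gmul => //; [grpd|exact: restr_ginv].
have abB X Y : B X -> B Y -> cmul setT X Y = cmul setT Y X.
  move=> /BP [a ca ->] /BP [b cb ->].
  apply/(cmul_comm etG (cauS_T ca) (cauS_T cb)).
  rewrite /commseq; have -> : (fun n => conv (a n) (b n)) = (fun n => conv (b n) (a n)).
    by apply/funext => n; apply: comm; [case: ca|case: cb].
  exact: eqv_refl.
split; first by split; [exact: B_subalgebra|exact: abB].
move=> D [[[DC _] _ _ _ _] Dcomm] BD; apply/seteqP; split => // X DX.
have [a ca XE] : exists2 a, cauT a & X = clsT a by have [a ca <-] := DC _ DX; exists a.
rewrite XE in DX *.
have [f [cf ef hf]] := cauchy_limit ca.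
have fcomm : commutes_with f.
  move=> k ck; have cTk := CcS_T ck; apply: (limit_commutes ca ef hf cTk).
  apply: (cmul_comm etG ca (cau_cst etG cTk)).1; apply: Dcomm; first exact: DX.
  by apply: BD; exact: B_cst_intro.
suff f0 e : ~ restr E S e -> f e = 0.
  apply: B_intro => // e /f0 fe eps /hf [N hN]; exists N => n Nn.
  by have := hN n e Nn; rewrite fe sub0r cabsN.
move=> nSe; apply/eqP/negPn/negP => fe.
pose W := [set x | f x != 0] `&` ~` restr E S.
have oW : open W.
  apply: openI; last by apply: closed_openC; exact: restr_closed.
  rewrite openE => x /= fx.
  have fx0 : 0 < cabs (f x).
    by rewrite lt_neqAle cabs_ge0 andbT eq_sym; apply: contra_neq fx; exact: cabs0_eq0.
  have /continuous_cabs/(_ _ fx0) := cf x; apply: filterS => y /= hy.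
  by apply: contraTneq hy => ->; rewrite subr0 ltxx.
have WO x : W x -> Omega_preimage E S [set m | (0 < m)%N] x.
  move=> [/= fx nSx].
  have Sr : restr E S (rng x) by apply: uS; exact: units_rngE.
  have ix : isotropy x.
    apply: contrapT => nix; move/eqP: fx; apply.
    exact: (commuting_nonisotropic ef fcomm Sr nix).
  have fAd y : Ad S x y -> f y = f x.
    by move=> [t [St rt st ->]]; exact: (commuting_conj ef fcomm St ix rt st).
  (* Two orbit points over one element of [G] differ by a phase z, and f takes the same non-zero
     value at both, so z = 1. *)
  have injA : {in Ad S x &, injective pi}.
    move=> y y' /set_mem Ay /set_mem Ay' /phase [z hz yE].
    have := fAd _ Ay'; rewrite yE ef // (fAd _ Ay) -[RHS]mul1r => /(mulIf fx) z1.
    by rewrite z1 tact1.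
  (* An approximant within |f(x)| / 2 of f is non-zero on the whole orbit, where f is constant; its
     compact support meets the fibre in finitely many classes, so the orbit is finite. *)
  have fx2 : 0 < cabs (f x) / 2.
    rewrite divr_gt0 // lt_neqAle cabs_ge0 andbT eq_sym.
    by apply: contra_neq fx; exact: cabs0_eq0.
  have [N /(_ N _ (leqnn N)) hN] := hf _ fx2.
  have [V [V1 V2 V3]] := Cc_fibre etG (src x) (cau_Cc ca N).
  have finA : finite_set (Ad S x).
    rewrite -(eq_finite_set (inj_card_eq injA)).
    apply: (@sub_finite_set _ _ [set` map pi V]); last exact: finite_seq.
    move=> _ [y Ay <-] /=; apply: V3; first by rewrite (Ad_src ix Ay).
    apply/eqP => ay0; have := hN y; rewrite ay0 subr0 (fAd _ Ay).
    by move: fx2; lra.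
  have AE : Ad S x = [set` enum_fset (fset_set (Ad S x))] by rewrite -{1}(fset_setK finA).
  apply/Omega_preimageP; split => //; exists (enum_fset (fset_set (Ad S x))); split => //.
  - rewrite /= lt0n; apply/eqP => /size0nil h; have := Ad_self ix Sr.
    by rewrite AE h.
  - rewrite map_inj_in_uniq ?fset_uniq // => y y' ys y's.
    by apply: injA; apply/mem_set; rewrite AE.
(* If Omega_S(x) > 1 at a point of [W], separating conjugators and finiteness on [W] keep it finite
   and > 1 nearby, so x would lie in the interior that (ii) declares empty. *)
have W1 : W `<=` OmegaOne.
  move=> x Wx; have [ix [m /= m0 Om]] := WO _ Wx; split => //.
  exists m => //=; apply/eqP; rewrite eqn_leq m0 andbT leqNgt; apply/negP => m1.
  suff : interior (Omega_preimage E S [set n | (1 < n)%N]) x by rewrite i1.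
  have /Omega_seqP [s [sm us As]] := Om.
  have [t st] := separating_exists ix us As.
  have nT i : nbhs (t i) setT by exact: filterT.
  have nW : nbhs x W by exact: open_nbhs_nbhs.
  have h := separating_near iS ix st nT.
  apply: filterS (filterI nW h) => y [/WO [iy [m' _ Om']] hy].
  have [t' st' _] := hy iy; have /Omega_seqP [s' [s'm us' As']] := Om'.
  split => //; exists m' => //=; rewrite -s'm.
  by apply: leq_trans (separating_size st' As'); rewrite sm.
have : interior OmegaOne e.
  have nW : nbhs e W by exact: open_nbhs_nbhs.
  by apply: filterS nW.
by rewrite IS => /nSe.
Qed.

End Subalgebra.

Theorem proposition3p14 (R : realType) (G : groupoid) (E : twist R G)
    (S : set G) :
  etale G -> subgroupoid S -> open S -> closed S ->
  let cond_i := maximal_abelian setT (incl E S @` Cstar E S) in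
  let cond_ii :=
    [/\ @units E `<=` interior (Omega_preimage E S [set 1%N]),
        interior (Omega_preimage E S [set 1%N]) = restr E S &
        interior (Omega_preimage E S [set n | (1 < n)%N]) = set0] in
  let cond_iii :=
    [/\ open_isotropy_subgroupoid S,
        abelian_subset (restr E S),
        (forall S' : set G, open_isotropy_subgroupoid S' ->
           abelian_subset (restr E S') -> S `<=` S' -> S' = S) &
        interior (Omega_preimage E S [set n | (1 < n)%N]) = set0] in
  (cond_i <-> cond_ii) /\ (cond_ii <-> cond_iii).
Proof.
move=> etG subS oS cS cond_i cond_ii cond_iii; split; split.
- exact: one_imp_two.
- exact: two_imp_one.
- exact: two_imp_three.
- exact: three_imp_two.
Qed.
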